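(* Let $k=\mathbb{C}$, let $s\geq 4$, $n\geq 1$, let $P=\mathbb{C}[x_0,\ldots,x_n]$ and let $a=\lfloor s/2\rfloor$. Then the fourth secant variety $\sigma_4(v_s(\mathbb{P}^n))\subseteq\mathbb{P}(P_s)$ to the $s$-th Veronese reembedding of $\mathbb{P}^n$ is set-theoretically defined by the condition $\operatorname{rk}\varphi_{a,s-a}\leq 4$, i.e. $$\sigma_4(v_s(\mathbb{P}^n))=\{[F]\in\mathbb{P}(P_s)\ :\ \operatorname{rk}\varphi_{a,s-a}(F)\leq 4\}.$$
   Context: $P_m$ is the space of forms of degree $m$ in $P$, and $S_m$ the space of forms of degree $m$ in the dual variables $\alpha_0,\ldots,\alpha_n$. Contraction is the bilinear action with $\alpha^{\mathbf b}\lrcorner x^{\mathbf a}=x^{\mathbf a-\mathbf b}$ if $a_i\geq b_i$ for all $i$, and $0$ otherwise. For $F\in P_s$, $\varphi_{a,s-a}(F):S_a\to P_{s-a}$ is the linear map $\sigma\mapsto\sigma\lrcorner F$; its matrix is the $a$-catalecticant matrix. For a linear form $\ell=\sum c_ix_i$ put $\ell^{[s]}=\sum_{|\mathbf a|=s}c^{\mathbf a}x^{\mathbf a}$ (the $s$-th divided power, which corresponds to the ordinary $s$-th power, up to the factor $s!$, under the identification turning contraction into differentiation). The Veronese embedding is $v_s:\mathbb{P}^n=\mathbb{P}(P_1)\to\mathbb{P}(P_s)$, $[\ell]\mapsto[\ell^{[s]}]$, and $\sigma_4(v_s(\mathbb{P}^n))$ is the Zariski closure of the union of the linear spans of $4$-tuples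 of points of $v_s(\mathbb{P}^n)$. *)

(* Defs.v *)
From HB Require Import structures.
From mathcomp Require Import all_boot all_order all_algebra.
From mathcomp Require Import boolp classical_sets reals.
From mathcomp Require Import complex mpoly.

Set Implicit Arguments.
Unset Strict Implicit.
Unset Printing Implicit Defensive.

Import GRing.Theory.
Local Open Scope ring_scope.
Local Open Scope classical_set_scope.

(** The projective space P(V) of lines through the origin of V: a point is a
    one-dimensional subspace of V. *)
Record pspace (K : fieldType) (V : vectType K) := PSpace {
  pline :> {vspace V};
  _ : \dim pline == 1%N
}.

HB.instance Definition _ (K : fieldType) (V : vectType K) :=
  [isSub for @pline K V].
HB.instance Definition _ (K : fieldType) (V : vectType K) :=
  [Choice of pspace V by <:].

Section ProjectiveSpace.
Variables (K : fieldType) (V : vectType K).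
Implicit Types (v : V) (p q : pspace V) (X : set (pspace V)).

Fact dim_ppoint v : v != 0 -> \dim <[v]> == 1%N.
Proof. by move=> v0; rewrite dim_vline v0. Qed.

Definition ppoint v (v0 : v != 0) : pspace V := PSpace (dim_ppoint v0).

Fact vpick_pline_neq0 p : vpick p != 0.
Proof.
by case: p => L /= dL; rewrite vpick0 -dimv_eq0; rewrite (eqP dL).
Qed.

Lemma ppoint_vpick p : ppoint (vpick_pline_neq0 p) = p.
Proof.
apply/val_inj/eqP => /=; rewrite eqEdim -memvE memv_pick dim_vline.
by rewrite vpick_pline_neq0; case: (p) => L /= /eqP ->.
Qed.

(** Polynomial functions on V are written in the coordinates of a fixed basis;
    which of them are homogeneous of degree d does not depend on this basis. *)
Definition coord_eval (f : {mpoly K[\dim {:V}]}) v : K :=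
  f.@[fun i => coord (vbasis {:V}) i v].

(** As f is homogeneous, it vanishes on the whole line p as soon as it vanishes
    at one nonzero vector of p. *)
Definition zariski_closed X : Prop :=
  exists2 I : set {mpoly K[\dim {:V}]},
    (forall f, I f -> exists d, f \is d.-homog) &
    X = [set p | forall f, I f -> forall v, v \in pline p -> coord_eval f v = 0].

Definition zariski_closure X : set (pspace V) := smallest zariski_closed X.

(** For points regarded as lines of V, the linear span of q_1, ..., q_r is the set
    of the lines contained in the vector space q_1 + ... + q_r. *)
Definition secant_union (r : nat) X : set (pspace V) :=
  [set p | exists2 t : r.-tuple (pspace V), {in t, forall q, X q} &
                                  (pline p <= \sum_(q <- t) pline q)%VS].

Definition secant_variety (r : nat) X : set (pspace V) :=
  zariski_closure (secant_union r X).

End ProjectiveSpace.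

(** [dhomog n.+1 K d] is both P_d and S_d: the polynomial ring S of dual
    variables is represented by the same type as P. *)
Section Contraction.
Variables (K : fieldType) (n : nat).
Implicit Types (sigma F : {mpoly K[n]}) (a b m : 'X_{1..n}).

Definition contraction sigma F : {mpoly K[n]} :=
  \sum_(b <- msupp sigma) \sum_(a <- msupp F | (b <= a)%MM)
     (sigma@_b * F@_a) *: 'X_[a - b].

Lemma mcoeff_contraction sigma F m :
  (contraction sigma F)@_m = \sum_(b <- msupp sigma) sigma@_b * F@_(m + b).
Proof.
rewrite /contraction raddf_sum; apply: eq_bigr => b _ /=.
rewrite raddf_sum /= (eq_bigr (fun a => if a == (m + b)%MM then
  sigma@_b * F@_(m + b) else 0)); last first.
  move=> a le_ba; rewrite mcoeffZ mcoeffX.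
  have -> : ((a - b)%MM == m) = (a == (m + b)%MM).
    by apply/eqP/eqP => [<-|->]; rewrite ?submK ?addmK.
  by case: eqP => [->|_]; rewrite ?mulr1 ?mulr0.
rewrite -big_mkcondr /=.
have [Fmb|Fmb] := boolP ((m + b)%MM \in msupp F).
  rewrite -big_filter (_ : [seq _ <- _ | _] = [:: (m + b)%MM]) ?big_seq1 //.
  rewrite -(filter_pred1_uniq (msupp_uniq F) Fmb); apply: eq_filter => a.
  by rewrite /=; case: eqP => [->|_]; rewrite ?andbF // lem_addl.
by rewrite (memN_msupp_eq0 Fmb) mulr0 big1.
Qed.

Lemma contractionX a b :
  contraction 'X_[b] 'X_[a] = if (b <= a)%MM then 'X_[a - b] else 0.
Proof.
rewrite /contraction msuppX big_seq1 msuppX big_mkcond big_seq1.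
by rewrite !mcoeffX !eqxx mulr1 scale1r.
Qed.

Lemma contraction_is_linear F : linear (contraction^~ F).
Proof.
move=> c p q; apply/mpolyP => m.
rewrite mcoeffD mcoeffZ !mcoeff_contraction.
pose r := undup (msupp (c *: p + q) ++ msupp p ++ msupp q).
have sumE (u : {mpoly K[n]}) : {subset msupp u <= r} ->
    \sum_(b <- msupp u) u@_b * F@_(m + b) = \sum_(b <- r) u@_b * F@_(m + b).
  move=> sur; rewrite [RHS](bigID (fun b => b \in msupp u)) /=.
  rewrite [X in _ + X]big1 ?addr0; last first.
    by move=> b bu; rewrite memN_msupp_eq0 ?mul0r.
  rewrite -[RHS]big_filter; apply: perm_big.
  apply: uniq_perm; rewrite ?msupp_uniq ?filter_uniq ?undup_uniq // => b.
  by rewrite mem_filter; case: (boolP (b \in msupp u)) => // /sur ->.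
rewrite !sumE; first last.
- by move=> b bu; rewrite mem_undup !mem_cat bu.
- by move=> b bu; rewrite mem_undup !mem_cat bu !orbT.
- by move=> b bu; rewrite mem_undup !mem_cat bu !orbT.
rewrite mulr_sumr -big_split; apply: eq_bigr => b _ /=.
by rewrite mcoeffD mcoeffZ mulrDl mulrA.
Qed.

Lemma contraction_homog (d e : nat) sigma F :
  sigma \is d.-homog -> F \is e.-homog -> contraction sigma F \is (e - d).-homog.
Proof.
move=> /dhomogP sd /dhomogP Fe; rewrite /contraction big_seq.
apply: rpred_sum => b bs; rewrite big_seq_cond.
apply: rpred_sum => a /andP [aF le_ba]; apply: rpredZ; rewrite dhomogX.
apply/eqP; have := mdegD (a - b) b.
by rewrite (submK le_ba) [mdeg a](Fe a aF) [mdeg b](sd b bs) => ->; rewrite addnK.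
Qed.

End Contraction.

Section Catalecticant.
Variables (K : fieldType) (n s a : nat) (F : dhomog n.+1 K s).

Definition contract_form (sigma : dhomog n.+1 K a) : dhomog n.+1 K (s - a) :=
  DHomog (contraction_homog (dhomog_is_dhomog sigma) (dhomog_is_dhomog F)).

Fact contract_form_is_linear : linear contract_form.
Proof. by move=> c p q; apply/val_inj/contraction_is_linear. Qed.

HB.instance Definition _ :=
  GRing.isLinear.Build K (dhomog n.+1 K a) (dhomog n.+1 K (s - a)) _
    contract_form contract_form_is_linear.

(** phi_(a, s - a)(F) : S_a -> P_(s - a). *)
Definition catalecticant : 'Hom(dhomog n.+1 K a, dhomog n.+1 K (s - a)) :=
  linfun contract_form.

Lemma catalecticantE sigma :
  catalecticant sigma = contraction sigma F :> {mpoly K[n.+1]}.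
Proof. by rewrite lfunE. Qed.

Definition catalecticant_rank : nat := \dim (limg catalecticant).

End Catalecticant.

Section Veronese.
Variables (K : fieldType) (n s : nat).
Implicit Types l : dhomog n.+1 K 1.

(** l^[s] in P_s, the c_i of l = sum c_i x_i being the coefficients l@_U_(i). *)
Definition divided_power_mpoly l : {mpoly K[n.+1]} :=
  \sum_(a : 'X_{1..n.+1 < s.+1} | mdeg a == s)
     (\prod_(i < n.+1) l@_U_(i) ^+ a i) *: 'X_[a].

Fact divided_power_homog l : divided_power_mpoly l \is s.-homog.
Proof. by apply: rpred_sum => a /eqP da; apply: rpredZ; rewrite dhomogX; apply/eqP. Qed.

Definition divided_power l : dhomog n.+1 K s := DHomog (divided_power_homog l).

Lemma mcoeff_divided_power l (a : 'X_{1..n.+1}) : mdeg a = s ->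
  (divided_power l)@_a = \prod_(i < n.+1) l@_U_(i) ^+ a i.
Proof.
move=> da; have lt_as : (mdeg a < s.+1)%N by rewrite da.
rewrite /= raddf_sum /= (bigD1 (BMultinom lt_as)) /= ?da //.
rewrite mcoeffZ mcoeffX eqxx mulr1 -[RHS]addr0; congr (_ + _).
apply: big1 => b /andP [_ ne_ba].
rewrite mcoeffZ mcoeffX; case: eqP => [E|_]; last by rewrite mulr0.
by case/eqP: ne_ba; apply: val_inj.
Qed.

Fact divided_power_neq0 l : l != 0 -> divided_power l != 0.
Proof.
move=> l0; have [i li0] : exists i, l@_U_(i) != 0.
  apply/existsP; apply: contraR l0; rewrite negb_exists => /forallP l0.
  apply/eqP/val_inj/mpolyP => m /=; rewrite mcoeff0.
  have [/mdeg1P [i /eqP ->]|dm] := boolP (mdeg m == 1%N).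
    by apply/eqP; move: (l0 i); rewrite negbK.
  exact: (dhomog_nemf_coeff (dhomog_is_dhomog l)).
apply/eqP => /(congr1 (fun F : dhomog n.+1 K s => F@_(U_(i) *+ s))).
rewrite mcoeff_divided_power ?mdegMn ?mdeg1 ?mul1n // mcoeff0.
rewrite (bigD1 i) //= big1 ?mulr1 => [|j ne_ji]; last first.
  by rewrite mulmnE mnm1E eq_sym (negPf ne_ji) mul0n expr0.
by move/eqP; rewrite mulmnE mnm1E eqxx mul1n expf_eq0 (negPf li0) andbF.
Qed.

(** The Veronese map v_s : P(P_1) -> P(P_s), defined through a chosen generator
    of each line; [veronese_ppoint] shows that the choice does not matter. *)
Definition veronese (p : pspace (dhomog n.+1 K 1)) : pspace (dhomog n.+1 K s) :=
  ppoint (divided_power_neq0 (vpick_pline_neq0 p)).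

Lemma divided_powerZ c l : divided_power (c *: l) = c ^+ s *: divided_power l.
Proof.
apply/val_inj; rewrite /= /divided_power_mpoly scaler_sumr.
apply: eq_bigr => a /eqP da; rewrite scalerA; congr (_ *: _).
under eq_bigr => i _ do rewrite mcoeffZ exprMn.
rewrite big_split /=; congr (_ * _).
by rewrite -[X in _ = c ^+ X]da mdegE expr_sum.
Qed.

Lemma veronese_ppoint l (l0 : l != 0) :
  veronese (ppoint l0) = ppoint (divided_power_neq0 l0).
Proof.
have := memv_pick (pline (ppoint l0)); have := vpick_pline_neq0 (ppoint l0).
rewrite /veronese => v0 /vlineP [c E].
apply/val_inj => /=; rewrite [vpick _]E divided_powerZ.
apply/eqP; rewrite eqEdim -memvE memvZ ?memv_line //=.
rewrite !dim_vline scaler_eq0 expf_eq0.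
case: (c =P 0) => [c0|_]; last by rewrite andbF /= divided_power_neq0.
by rewrite E c0 scale0r eqxx in v0.
Qed.

End Veronese.

(* Main.v *)
Require Import Defs.
From mathcomp Require Import all_boot all_order all_algebra.
From mathcomp Require Import boolp classical_sets reals.
From mathcomp Require Import complex mpoly.
From mathcomp Require Import mxred spectral ring zify.

Set Implicit Arguments.
Unset Strict Implicit.
Unset Printing Implicit Defensive.

Import Order.TTheory GRing.Theory Num.Theory.
Local Open Scope ring_scope.

(** Let A = S / Ann(F), so that dim A_i = rk phi_(i, s - i). The proof works with the
    functional f on S taking sigma to the constant coefficient of its contraction
    with F: a form x of degree i vanishes in A iff f (x z) = 0 for all z of degree s - i.

    Assume dim A_a <= 4 for a = floor(s/2). Unless F is a power, a general linear
    form L is injective on A_i below the middle degree: elements killed by three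
    general L's would generate a triangular nonsingular 5 x 5 array of values of f.
    Hence dim A_i <= 4 for every i, and F depends on N = dim A_1 <= 4 variables.

    For N <= 2 a relation of degree 4 between two linear forms makes the coefficients
    of F a linear recurrent sequence. For N = 3 and 4, if there are x, y with x^2, y^2 in
    L A_1, multiplication on A is modelled on the algebra
    K[x, y] / (x^2 - a0 - a1 x - a2 y, y^2 - b0 - b1 x - b2 y), for a2 <> 0 generated by x
    alone; perturbing the matrix of x to a diagonalisable one exhibits F as a limit of
    sums of 4 powers. For N = 3 the only other case is y x, y^2 in L A_1: moving L
    reduces it to the previous one unless xy = 0 and y^2 = k L y, when F is an explicit
    limit. For N = 4, A_2 = L A_1, and x, y are isotropic vectors, orthogonal to w, of the
    quadratic form f (L^(s-3) w u v) for a suitable linear form w.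

    Conversely, rk phi <= 4 amounts to the vanishing of the 5 x 5 minors of phi, which
    holds for sums of 4 powers. *)

(** The rank bound concerns one middle degree, and the Hilbert function of a Gorenstein algebra may
    a priori be larger below it; an injective multiplication by L rules this out. Where that
    multiplication has maximal rank, deforming L shows that, for y in its kernel, M y pairs to zero
    with everything orthogonal to L A_c. Such classes are isotropic, and an isotropic family counts
    twice, once for itself and once for its dual family: this is how few elements already exceed
    dimension 4. Dividing by L turns linear forms into commuting matrices, and the coefficients of F
    into matrix coefficients of monomials in them. Simultaneously diagonalisable matrices give sums
    of powers, so the obstacle is an algebra with two generators: it has to be deformed into one
    with a single generator before its eigenvalues can be separated. For four variables, L plays the
    role of the unit, and w is chosen to make it isotropic: its orthogonal modulo L is then a
    hyperbolic plane, which provides x and y. Limits are expressed by polynomials vanishing along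
    curves, so that no topology on K is involved. *)

Lemma poly_eq0_horner (K : numFieldType) (p : {poly K}) :
  (forall t, p.[t] = 0) -> p = 0.
Proof.
move=> p0; apply/eqP; apply: contraT => nz.
have := @max_poly_roots _ p [seq i%:R | i <- iota 0 (size p)] nz.
rewrite size_map size_iota ltnn => ->//; first by apply/allP => t _; rewrite /root p0.
rewrite map_inj_uniq ?iota_uniq // => i j /eqP.
by rewrite eqr_nat => /eqP.
Qed.

Lemma poly_nonroot (K : numFieldType) (p : {poly K}) :
  p != 0 -> exists t, p.[t] != 0.
Proof.
move=> nz; apply: contrapT => H; move/eqP: nz; apply; apply: poly_eq0_horner => t.
by apply/eqP; apply: contraPT H => pt H; apply: H; exists t.
Qed.

(** * Linear functionals on polynomials and their values along lines *)

Section Functional.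
Variables (K : numFieldType) (n : nat).
Local Notation S := {mpoly K[n.+1]}.

Definition hg (d : nat) (p : S) : Prop := p \is d.-homog.

Lemma hgD d p q : hg d p -> hg d q -> hg d (p + q).
Proof. exact: rpredD. Qed.
Lemma hgB d p q : hg d p -> hg d q -> hg d (p - q).
Proof. exact: rpredB. Qed.
Lemma hgZ d c p : hg d p -> hg d (c *: p).
Proof. exact: rpredZ. Qed.
Lemma hg_sum d (I : Type) (r : seq I) (P : pred I) (x : I -> S) :
  (forall i, P i -> hg d (x i)) -> hg d (\sum_(i <- r | P i) x i).
Proof. exact: rpred_sum. Qed.
Lemma hgM d e k p q : hg d p -> hg e q -> (d + e = k)%N -> hg k (p * q).
Proof. by move=> hp hq <-; apply: dhomogM. Qed.
Lemma hg1 : hg 0 1.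
Proof. exact: dhomog1. Qed.
Lemma hgE d k p i : hg d p -> (d * i = k)%N -> hg k (p ^+ i).
Proof. by move=> hp <-; apply: dhomogMn. Qed.
Lemma hg0 d : hg d 0.
Proof. exact: rpred0. Qed.
Lemma hgX i : hg 1 'X_i.
Proof. by rewrite /hg dhomogX; apply/eqP; exact: mdeg1. Qed.

Variable f : S -> K.
Hypothesis f_lin : forall c p q, f (c *: p + q) = c * f p + f q.

Lemma fD p q : f (p + q) = f p + f q.
Proof. by have := f_lin 1 p q; rewrite scale1r mul1r. Qed.
Lemma f0 : f 0 = 0.
Proof. by apply: (addrI (f 0)); rewrite -fD !addr0. Qed.
Lemma fZ c p : f (c *: p) = c * f p.
Proof. by rewrite -[c *: p]addr0 f_lin f0 addr0. Qed.
Lemma fN p : f (- p) = - f p.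
Proof. by rewrite -scaleN1r fZ mulN1r. Qed.
Lemma fB p q : f (p - q) = f p - f q.
Proof. by rewrite fD fN. Qed.
Lemma f_sum (I : Type) (r : seq I) (P : pred I) (x : I -> S) :
  f (\sum_(i <- r | P i) x i) = \sum_(i <- r | P i) f (x i).
Proof. exact: (big_morph f fD f0). Qed.
Lemma fMn p k : f (p *+ k) = f p *+ k.
Proof. by elim: k => [|k IH]; rewrite ?mulr0n ?f0 // !mulrS fD IH. Qed.

Definition line_poly k (q L M : S) : {poly K} :=
  \poly_(i < k.+1) (f (L ^+ (k - i) * M ^+ i * q) *+ 'C(k, i)).

Lemma horner_line_poly k q L M t :
  (line_poly k q L M).[t] = f ((L + t *: M) ^+ k * q).
Proof.
rewrite horner_poly exprDn mulr_suml f_sum; apply: eq_bigr => i _.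
have -> : (L ^+ (k - i) * (t *: M) ^+ i) *+ 'C(k, i) * q =
    t ^+ i *: ((L ^+ (k - i) * M ^+ i * q) *+ 'C(k, i)).
  by rewrite exprZn -scalerAr mulrnAl -scalerAl scalerMnr.
by rewrite fZ fMn mulrC.
Qed.

(** Polarisation: a polynomial in t that vanishes everywhere has zero coefficients, and the binomial
    factors can be cancelled in characteristic zero. *)
Lemma line_poly_coef0 k q L M :
  (forall t, f ((L + t *: M) ^+ k * q) = 0) ->
  forall i, (i <= k)%N -> f (L ^+ (k - i) * M ^+ i * q) = 0.
Proof.
move=> H i le_ik; have : (line_poly k q L M)`_i = 0.
  by rewrite (_ : line_poly _ _ _ _ = 0) ?coef0 //; apply: poly_eq0_horner => t;
     rewrite horner_line_poly H.
rewrite coef_poly ltnS le_ik => /eqP; rewrite mulrn_eq0 => /orP [|/eqP //].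
by rewrite -leqn0 leqNgt bin_gt0 le_ik.
Qed.

(** S_(i+1) is spanned by products of a linear form and a form of degree i; as an induction
    principle, this replaces computations with monomials. *)
Lemma hgS_ind (i : nat) (P : S -> Prop) :
  P 0 -> (forall p q, P p -> P q -> P (p + q)) ->
  (forall M q, hg 1 M -> hg i q -> P (M * q)) ->
  forall p, hg i.+1 p -> P p.
Proof.
move=> P0 PD PM p hp.
have Ps (r : seq 'X_{1..n.+1}) : {subset r <= msupp p} ->
    P (\sum_(m <- r) p@_m *: 'X_[m]).
  elim: r => [|m r IH] sub; rewrite ?big_nil // big_cons; apply: PD; last first.
    by apply: IH => x xr; apply: sub; rewrite inE xr orbT.
  have mp : m \in msupp p by apply: sub; rewrite inE eqxx.
  have dm : mdeg m = i.+1 by have /dhomogP := hp; apply.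
  have [k km] : exists k, (0 < m k)%N.
    apply: contrapT => H; suff : mdeg m = 0%N by rewrite dm.
    rewrite mdegE big1 // => k _; apply/eqP; rewrite -leqn0 leqNgt.
    by apply/negP => km; apply: H; exists k.
  have le : (U_(k) <= m)%MM by rewrite lep1mP -lt0n.
  rewrite -(submK le) addmC mpolyXD scalerAl; apply: PM.
    exact/hgZ/hgX.
  rewrite /hg dhomogX; apply/eqP.
  have := mdegD (m - U_(k)) U_(k); rewrite (submK le) dm mdeg1 addn1 /=.
  by move=> [<-].
by rewrite [p]mpolyE; apply: Ps.
Qed.

End Functional.

Definition functional (K : numFieldType) n (f : {mpoly K[n.+1]} -> K) :=
  forall c p q, f (c *: p + q) = c * f p + f q.

(** * The pairing between complementary degrees of A *)

Section Pairing.
Variables (K : numFieldType) (n : nat).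
Local Notation S := {mpoly K[n.+1]}.
Implicit Types (f : S -> K) (p q x y z L M : S).

Lemma functional_mulr f M : functional f -> functional (fun p => f (M * p)).
Proof. by move=> lin c p q; rewrite mulrDr -scalerAr lin. Qed.

(** Powers of linear forms span S_s in characteristic zero. The coefficient of t in f ((L + t
    M)^(s+1)) gives f (M L^s) = 0, and the induction hypothesis is applied to q |-> f (M q). *)
Lemma powers_span f s : functional f ->
  (forall L, hg 1 L -> f (L ^+ s) = 0) -> forall p, hg s p -> f p = 0.
Proof.
elim: s f => [|s IH] f lin H p hp.
  have -> : p = p@_0 *: 1.
    apply/mpolyP => m; rewrite mcoeffZ mcoeff1.
    case: eqP => [->|/eqP]; rewrite ?mulr1 // mulr0 -mdeg_eq0 => nz.
    exact: dhomog_nemf_coeff hp nz.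
  by rewrite (fZ lin) -(expr0 'X_0) H ?mulr0 //; apply: hgX.
have fM M q : hg 1 M -> hg s q -> f (M * q) = 0.
  move=> hM; apply: (IH (fun q => f (M * q))) => [|L hL]; first exact: functional_mulr.
  have := @line_poly_coef0 _ _ f lin s.+1 1 L M _ 1%N isT.
  rewrite subSS subn0 expr1 mulr1 mulrC; apply => t.
  by rewrite mulr1 H //; apply: hgD hL _; apply: hgZ.
apply: (hgS_ind (P := fun p => f p = 0) _ _ fM hp); first exact: f0.
by move=> u v fu fv; rewrite (fD lin) fu fv addr0.
Qed.

Variable f : S -> K.
Hypothesis lin : functional f.

Lemma fZr c x y : f (x * (c *: y)) = c * f (x * y).
Proof. by rewrite -scalerAr (fZ lin). Qed.
Lemma fBr x y z : f (x * (y - z)) = f (x * y) - f (x * z).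
Proof. by rewrite mulrBr (fB lin). Qed.
Lemma fBZl x c y z w : f ((x - c *: y) * z * w) = f (x * z * w) - c * f (y * z * w).
Proof. by rewrite !mulrBl -!scalerAl (fB lin) (fZ lin). Qed.

(* x, of degree s - j, is zero in A. *)
Definition nul (j : nat) x := forall z, hg j z -> f (x * z) = 0.

Lemma nulZ j c x : nul j x -> nul j (c *: x).
Proof. by move=> nx z hz; rewrite -scalerAl (fZ lin) nx ?mulr0. Qed.
Lemma nul0 j : nul j 0.
Proof. by move=> z _; rewrite mul0r (f0 lin). Qed.
Lemma nulM d j k x y : nul k x -> hg d y -> (d + j = k)%N -> nul j (x * y).
Proof. by move=> nx hy e z hz; rewrite -mulrA; apply: nx; apply: hgM hy hz e. Qed.
Lemma nulMl d j k x y : nul k x -> hg d y -> (d + j = k)%N -> nul j (y * x).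
Proof. by rewrite [y * x]mulrC; apply: nulM. Qed.

(** The Gorenstein property of A: below degree s no nonzero class is killed by all linear forms. *)
Lemma nul_S1 j x : (forall M, hg 1 M -> nul j (M * x)) -> nul j.+1 x.
Proof.
move=> H z hz; apply: (hgS_ind (P := fun z => f (x * z) = 0) _ _ _ hz).
- by rewrite mulr0 (f0 lin).
- by move=> u v fu fv; rewrite mulrDr (fD lin) fu fv addr0.
- by move=> M q hM hq; move: (H M hM q hq); rewrite [M * x]mulrC -mulrA.
Qed.

(** Consider the matrix of f (x_i z), z running over a basis of S_j. If its columns are independent,
    a left inverse yields the dual family; otherwise a vector of the kernel is a relation modulo
    Ann(F). *)
Lemma dual_or_dependent k j (x : 'I_k -> S) :
  (exists2 z : 'I_k -> S, forall i, hg j (z i) &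
     forall i i', f (x i * z i') = (i == i')%:R) \/
  (exists2 c : 'I_k -> K, exists i, c i != 0 & nul j (\sum_i c i *: x i)).
Proof.
pose e := vbasis {:dhomog n.+1 K j}.
pose A := \matrix_(b < \dim {:dhomog n.+1 K j}, i < k) f (x i * (tnth e b : S)).
have [/row_fullP [B BA]|nfull] := boolP (row_full A).
  left; exists (fun i => \sum_b B i b *: (tnth e b : S)).
    by move=> i; apply: hg_sum => b _; apply: hgZ; apply: dhomog_is_dhomog.
  move=> i i'; have := congr1 (fun C : 'M_k => C i' i) BA.
  rewrite !mxE eq_sym => <-; rewrite mulr_sumr (f_sum lin); apply: eq_bigr => b _.
  by rewrite -scalerAr (fZ lin) mxE.
right; have : kermx A^T != 0.
  by rewrite kermx_eq0 /row_free mxrank_tr.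
case/rowV0Pn => v /sub_kermxP vA v0.
exists (fun i => v 0 i).
  apply: contrapT => H; case/eqP: v0; apply/rowP => i; rewrite mxE; apply/eqP.
  by apply: contraPT H => ? H; apply: H; exists i.
move=> z hz; pose z' := DHomog hz.
have -> : z = \sum_b coord e b z' *: (tnth e b : S).
  rewrite -[LHS]/(val z') [in LHS](coord_vbasis (memvf z')) raddf_sum.
  by apply: eq_bigr => b _; rewrite (tnth_nth 0).
rewrite mulr_sumr (f_sum lin) big1 // => b _.
rewrite -scalerAr (fZ lin); apply/eqP; rewrite mulf_eq0; apply/orP; right; apply/eqP.
rewrite mulr_suml (f_sum lin).
have := congr1 (fun C : 'rV_(\dim {:dhomog n.+1 K j}) => C 0 b) vA.
rewrite !mxE => vAb; rewrite -[RHS]vAb; apply: eq_bigr => i _.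
by rewrite -scalerAl (fZ lin) !mxE.
Qed.

(* dim A_i <= 4, where i + j = s. *)
Definition dep5 i j := forall x : 'I_5 -> S, (forall k, hg i (x k)) ->
  exists2 c : 'I_5 -> K, exists k, c k != 0 & nul j (\sum_k c k *: x k).

(** In a relation among the x_k, take the largest k with a nonzero coefficient and pair with z_k:
    only the diagonal term survives. *)
Lemma triangular_contra i j (x z : 'I_5 -> S) : dep5 i j ->
  (forall k, hg i (x k)) -> (forall k, hg j (z k)) ->
  (forall k l : 'I_5, (k < l)%N -> f (x k * z l) = 0) ->
  (forall k, f (x k * z k) != 0) -> False.
Proof.
move=> dep hx hz tri dg; have [c [k0 ck0] nc] := dep x hx.
have [k ck maxk] := @arg_maxnP _ k0 (fun k => c k != 0) (fun k => k : nat) ck0.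
have := nc _ (hz k); rewrite mulr_suml (f_sum lin) (bigD1 k) //= big1 => [|l lk].
  rewrite addr0 -scalerAl (fZ lin) => /eqP; rewrite mulf_eq0 (negPf ck) /=.
  by rewrite (negPf (dg k)).
rewrite -scalerAl (fZ lin); have [->|cl] := eqVneq (c l) 0; first by rewrite mul0r.
rewrite tri ?mulr0 // ltn_neqAle; apply/andP; split=> //; exact: maxk.
Qed.

Lemma tri5_contra i j x0 x1 x2 x3 x4 z0 z1 z2 z3 z4 : dep5 i j ->
  hg i x0 -> hg i x1 -> hg i x2 -> hg i x3 -> hg i x4 ->
  hg j z0 -> hg j z1 -> hg j z2 -> hg j z3 -> hg j z4 ->
  f (x0 * z0) != 0 -> f (x1 * z1) != 0 -> f (x2 * z2) != 0 ->
  f (x3 * z3) != 0 -> f (x4 * z4) != 0 ->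
  f (x0 * z1) = 0 -> f (x0 * z2) = 0 -> f (x0 * z3) = 0 -> f (x0 * z4) = 0 ->
  f (x1 * z2) = 0 -> f (x1 * z3) = 0 -> f (x1 * z4) = 0 ->
  f (x2 * z3) = 0 -> f (x2 * z4) = 0 -> f (x3 * z4) = 0 -> False.
Proof.
move=> dep; intros.
apply: (@triangular_contra i j (tnth [tuple x0; x1; x2; x3; x4])
                          (tnth [tuple z0; z1; z2; z3; z4])) => //.
- by move=> [[|[|[|[|[|?]]]]] ?].
- by move=> [[|[|[|[|[|?]]]]] ?].
- by move=> [[|[|[|[|[|?]]]]] ?] [[|[|[|[|[|?]]]]] ?].
- by move=> [[|[|[|[|[|?]]]]] ?].
Qed.

End Pairing.

(** * The weak Lefschetz property *)

Section Generic.
Variables (K : numFieldType) (n : nat).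
Local Notation S := {mpoly K[n.+1]}.
Implicit Types (p q x y z L M : S).

(** A substitute for Zariski open sets of linear forms: only the traces on lines are tested, which
    suffices to show that two nonempty ones meet. *)
Definition zopen (O : S -> Prop) := forall L M, hg 1 L -> hg 1 M -> O L ->
  exists p : {poly K}, p.[0] != 0 /\ forall t, p.[t] != 0 -> O (L + t *: M).

Lemma zopenI O1 O2 : zopen O1 -> zopen O2 -> zopen (fun L => O1 L /\ O2 L).
Proof.
move=> z1 z2 L M hL hM [o1 o2].
have [p1 [p10 h1]] := z1 _ _ hL hM o1; have [p2 [p20 h2]] := z2 _ _ hL hM o2.
exists (p1 * p2); split=> [|t]; first by rewrite hornerM mulf_neq0.
by rewrite hornerM mulf_eq0 negb_or => /andP [/h1 ? /h2].
Qed.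

Lemma zopen_meet O1 O2 : zopen O1 -> zopen O2 ->
  (exists2 L, hg 1 L & O1 L) -> (exists2 L, hg 1 L & O2 L) ->
  exists L, [/\ hg 1 L, O1 L & O2 L].
Proof.
move=> z1 z2 [L1 hL1 o1] [L2 hL2 o2].
have [p1 [p10 h1]] := z1 _ _ hL1 (hgB hL2 hL1) o1.
have [p2 [p20 h2]] := z2 _ _ hL2 (hgB hL1 hL2) o2.
(* On the line joining L1 to L2, the parameter t counted from L1 is 1 - t counted from L2. *)
have [|t] := @poly_nonroot _ (p1 * (p2 \Po (1 - 'X))).
  rewrite mulf_neq0 //; first by apply: contraNneq p10 => ->; rewrite horner0.
  apply: contraNneq p20 => /(congr1 (fun r : {poly K} => r.[1])).
  by rewrite horner0 horner_comp !hornerE subrr => ->.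
rewrite hornerM horner_comp !hornerE mulf_eq0 negb_or => /andP [/h1 H1 /h2 H2].
exists (L1 + t *: (L2 - L1)); split=> //.
  exact: hgD hL1 (hgZ _ (hgB hL2 hL1)).
suff -> : L1 + t *: (L2 - L1) = L2 + (1 - t) *: (L1 - L2) by [].
by rewrite -!mul_mpolyC; ring.
Qed.

Variable f : S -> K.
Hypothesis lin : functional f.

Lemma zopen_pow k q : zopen (fun L => f (L ^+ k * q) != 0).
Proof.
move=> L M hL hM o; exists (line_poly f k q L M).
by split=> [|t]; rewrite (horner_line_poly lin) // scale0r addr0.
Qed.

(** Multiplication by L from A_c to A_(c+1) has rank at least k. A nonzero minor expresses this as
    an open condition on L. *)
Definition rank_ge c j k L := exists x z : 'I_k -> S,
  [/\ forall i, hg c (x i), forall i, hg j (z i) &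
      \det (\matrix_(i, i') f (L * x i * z i')) != 0].

Lemma zopen_rank_ge c j k : zopen (rank_ge c j k).
Proof.
move=> L M hL hM [x [z [hx hz d0]]].
pose A := \matrix_(i, i') ((f (L * x i * z i'))%:P + f (M * x i * z i') *: 'X).
have dA t : (\det A).[t] = \det (\matrix_(i, i') f ((L + t *: M) * x i * z i')).
  rewrite -[LHS]/(horner_eval t _) -det_map_mx; congr (\det _).
  apply/matrixP => i i'; rewrite !mxE /= /horner_eval !hornerE.
  by rewrite !mulrDl -!scalerAl (fD lin) (fZ lin) (mulrC t).
exists (\det A); split=> [|t]; rewrite dA.
  by rewrite scale0r addr0.
by exists x, z.
Qed.

(* The derivative along M of the (k+1)-minors of multiplication by L. *)
Lemma pencil c j k L M y z : hg 1 L -> hg 1 M -> hg c y -> hg j z ->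
  rank_ge c j k L -> (forall L', hg 1 L' -> ~ rank_ge c j k.+1 L') ->
  nul f j (L * y) -> (forall x, hg c x -> f (L * x * z) = 0) ->
  f (M * y * z) = 0.
Proof.
move=> hL hM hy hz [x0 [z0 [hx0 hz0 d0]]] max Ly Lz.
pose x (i : 'I_(k + 1)) := match split i with inl i => x0 i | inr _ => y end.
pose w (i : 'I_(k + 1)) := match split i with inl i => z0 i | inr _ => z end.
pose A := \matrix_(i, i') ((f (L * x0 i * z0 i'))%:P + f (M * x0 i * z0 i') *: 'X).
(* The minor of L + t M bordered by y and z, with a factor t removed from its last row, which is
   possible because L y pairs to zero with S_j. At t = 0 the last column vanishes above the corner,
   so that the value is the nonzero k-minor times f (M y z). *)
pose B : {poly K} := \det (block_mx A
  (\col_(i < k) (f (M * x0 i * z) *: 'X))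
  (\row_(i < k) (f (M * y * z0 i))%:P) (f (M * y * z))%:P%:M).
have xl i : x (lshift 1 i) = x0 i by rewrite /x (unsplitK (inl i)).
have xr i : x (rshift k i) = y by rewrite /x (unsplitK (inr i)).
have wl i : w (lshift 1 i) = z0 i by rewrite /w (unsplitK (inl i)).
have wr i : w (rshift k i) = z by rewrite /w (unsplitK (inr i)).
have hB t : t * B.[t] = 0.
  pose G := \matrix_(i < k + 1, i' < k + 1) f ((L + t *: M) * x i * w i').
  have -> : t * B.[t] = \det G; last first.
    apply/eqP; apply: contraT => dG; case: (max (L + t *: M)).
      by apply: hgD hL _; apply: hgZ.
    by rewrite -addn1; exists x, w; split=> // i; rewrite /x /w; case: split.
  have dt : \det (block_mx (1%:M : 'M_k) 0 0 (t%:M : 'M_1)) = t.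
    by rewrite det_lblock det1 mul1r det_scalar expr1.
  rewrite -[X in X * B.[t]]dt -[B.[t]]/(horner_eval t B) -det_map_mx -det_mulmx.
  congr (\det _); rewrite map_block_mx mulmx_block !mul1mx !mul0mx !addr0 !add0r.
  rewrite -[G]submxK; congr block_mx; apply/matrixP => i i';
    rewrite ?mul_scalar_mx !mxE /= /horner_eval ?hornerE ?xl ?wl ?xr ?wr
      !mulrDl -!scalerAl (fD lin) (fZ lin) ?Lz ?Ly ?add0r //.
- by rewrite [X in _ + X]mulrC.
- by rewrite mulrC.
- by rewrite (ord1 i) (ord1 i') mulr1n hornerC.
have B0 : B = 0.
  suff /eqP : 'X * B = 0 by rewrite mulf_eq0 polyX_eq0 => /eqP.
  by apply: poly_eq0_horner => t; rewrite !hornerE hB.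
have := congr1 (horner_eval 0) B0.
rewrite -det_map_mx map_block_mx.
have -> : map_mx (horner_eval 0) (\col_(i < k) (f (M * x0 i * z) *: 'X)) = 0.
  by apply/matrixP => i i'; rewrite !mxE /= /horner_eval !hornerE ?mulr0.
rewrite det_lblock /horner_eval horner0 => /eqP; rewrite mulf_eq0 => /orP [|].
  suff -> : map_mx (horner_eval 0) A = \matrix_(i, i') f (L * x0 i * z0 i').
    by rewrite (negPf d0).
  by apply/matrixP => i i'; rewrite !mxE /= /horner_eval !hornerE ?mulr0 ?addr0.
by rewrite det_mx11 !mxE mulr1n /= /horner_eval hornerC => /eqP.
Qed.

End Generic.

Ltac hom := match goal with
  | |- hg _ (_ * _) => eapply hgM; [hom | hom | first [reflexivity | lia]]
  | |- hg _ (_ ^+ _) => eapply hgE; [hom | first [reflexivity | lia]]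
  | |- hg _ (_ + - _) => apply: hgB; hom
  | |- hg _ (_ + _) => apply: hgD; hom
  | |- hg _ (_ *: _) => apply: hgZ; hom
  | |- hg _ 1 => exact: hg1
  | |- _ => eassumption
  end.

(** * Linear forms with a kernel *)

Section Lefschetz.
Variables (K : numFieldType) (n : nat).
Local Notation S := {mpoly K[n.+1]}.
Implicit Types (p q x y z L M : S).
Variable f : S -> K.
Hypothesis lin : functional f.
Variables (c j : nat).

(* L kills y in A_(c+1), and S_1 y is the line spanned by m y. *)
Definition bad L y m q0 := [/\ [/\ hg 1 L, hg c y, hg 1 m & hg j q0],
  nul f j (L * y), f (m * y * q0) = 1 &
  forall M, hg 1 M -> nul f j ((M - f (M * y * q0) *: m) * y)].

(** S_1 y is nonzero since y is. Two independent classes in it would admit dual forms q0 and q1,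
    which the last hypothesis excludes; hence it is a line. *)
Lemma bad_exists L y : hg 1 L -> hg c y -> nul f j (L * y) -> ~ nul f j.+1 y ->
  (forall m M1 q0 q1, hg 1 m -> hg 1 M1 -> hg j q0 -> hg j q1 ->
     f (m * y * q0) = 1 -> f (m * y * q1) = 0 ->
     f (M1 * y * q0) = 0 -> f (M1 * y * q1) = 1 -> False) ->
  exists m q0, bad L y m q0.
Proof.
move=> hL hy Ly ny C1.
have [m hm [q hq fq]] : exists2 m, hg 1 m & exists2 q, hg j q & f (m * y * q) != 0.
  apply: contrapT => H; apply: ny; apply: (nul_S1 lin) => M hM z hz.
  by apply/eqP; apply: contraPT H => fz; apply; exists M => //; exists z.
have [q0 hq0 fq0] : exists2 q0, hg j q0 & f (m * y * q0) = 1.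
  by exists ((f (m * y * q))^-1 *: q); [hom | rewrite (fZr lin) mulVf].
exists m, q0; split=> // M hM z hz; set M1 := M - _.
have hM1 : hg 1 M1 by rewrite /M1; hom.
have M1q0 : f (M1 * y * q0) = 0.
  by rewrite /M1 (fBZl lin) fq0 mulr1 subrr.
apply/eqP; apply: contraT => nz.
pose z1 := (f (M1 * y * z))^-1 *: z.
have z1E : f (M1 * y * z1) = 1 by rewrite /z1 (fZr lin) mulVf.
have hz1 : hg j z1 by rewrite /z1; hom.
case: (C1 m M1 q0 (z1 - f (m * y * z1) *: q0)) => //.
- hom.
- by rewrite (fBr lin) (fZr lin _ _ q0) fq0 mulr1 subrr.
- by rewrite (fBr lin) (fZr lin _ _ q0) M1q0 mulr0 subr0.
Qed.

Lemma badE L y m q0 M q : bad L y m q0 -> hg 1 M -> hg j q ->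
  f (M * y * q) = f (M * y * q0) * f (m * y * q).
Proof.
move=> [_ _ _ H] hM hq; have := H M hM q hq.
by rewrite (fBZl lin) => /eqP; rewrite subr_eq0 => /eqP.
Qed.

(** As S_1 y is the line of m y, each S_(i+1) y is spanned by m^(i+1) y. In degree s the functional
    f does not vanish on this span, because f (m y q0) = 1. *)
Lemma bad_pow L y m q0 : bad L y m q0 -> f (m * y * m ^+ j) != 0.
Proof.
move=> B; have [[hL hy hm hq0] _ fq0 _] := B.
have H i e : (i + e = j)%N -> forall p, hg i p ->
    exists k, forall q, hg e q -> f (m * y * p * q) = k * f (m * y * m ^+ i * q).
  elim: i e => [|i IH] e ie p hp.
    exists p@_0 => q hq; have -> : p = p@_0 *: 1.
      apply/mpolyP => m'; rewrite mcoeffZ mcoeff1.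
      case: eqP => [->|/eqP]; rewrite ?mulr1 // mulr0 -mdeg_eq0 => nz.
      exact: dhomog_nemf_coeff hp nz.
    by rewrite mcoeffZ mcoeff1 eqxx mulr1 expr0 -scalerAr -scalerAl (fZ lin).
  apply: (hgS_ind (i := i) (P := fun p => exists k, forall q, hg e q ->
    f (m * y * p * q) = k * f (m * y * m ^+ i.+1 * q)) _ _ _ hp).
  - by exists 0 => q _; rewrite mulr0 mul0r (f0 lin) mul0r.
  - move=> u v [k1 H1] [k2 H2]; exists (k1 + k2) => q hq.
    by rewrite mulrDr mulrDl (fD lin) H1 // H2 // mulrDl.
  - move=> M r hM hr; have [|k Hk] := IH e.+1 _ r hr; first by lia.
    exists (f (M * y * q0) * k) => q hq.
    have -> : m * y * (M * r) * q = M * y * (m * r * q) by ring.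
    rewrite (badE B) //; last by hom.
    have -> : m * y * (m * r * q) = m * y * r * (m * q) by ring.
    rewrite Hk ?mulrA; last by hom.
    by rewrite exprSr !mulrA.
have [k Hk] := H j 0%N (addn0 j) q0 hq0.
have := Hk 1 (hg1 _ _); rewrite !mulr1 fq0 => /eqP; apply: contraTneq => ->.
by rewrite mulr0 oner_eq0.
Qed.

(** L2 kills y2 but not y1: subtracting a multiple of L2 from m2 produces a form that kills y1 and
    still acts on y2 as m2. *)
Lemma bad_kill L1 y1 m1 q1 L2 y2 m2 q2 : bad L1 y1 m1 q1 -> bad L2 y2 m2 q2 ->
  f (L2 * y1 * q1) != 0 ->
  exists e, [/\ hg 1 e, nul f j (e * y1) & f (e * y2 * q2) = 1].
Proof.
move=> [_ _ _ H1] [[hL2 _ hm2 hq2] L2y2 fq2 _] nz.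
pose e := m2 - (f (m2 * y1 * q1) / f (L2 * y1 * q1)) *: L2.
have he : hg 1 e by rewrite /e; hom.
exists e; split=> //.
  have e0 : f (e * y1 * q1) = 0 by rewrite /e (fBZl lin) divfK // subrr.
  by have := H1 e he; rewrite e0 scale0r subr0.
by rewrite /e (fBZl lin) L2y2 // mulr0 subr0.
Qed.

(** t_i is m_i^j with some factors replaced by forms that kill the earlier y's and act on y_i as m_i
    does. Two factors are replaced in t3, hence the condition 2 <= j. *)
Lemma three_bad L1 y1 m1 q1 L2 y2 m2 q2 L3 y3 m3 q3 : (2 <= j)%N ->
  bad L1 y1 m1 q1 -> bad L2 y2 m2 q2 -> bad L3 y3 m3 q3 ->
  f (L2 * y1 * q1) != 0 -> f (L3 * y1 * q1) != 0 -> f (L3 * y2 * q2) != 0 ->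
  exists t1 t2 t3, [/\ hg j t1, hg j t2, hg j t3,
    [/\ f (m1 * y1 * t1) != 0, f (m2 * y2 * t2) != 0 & f (m3 * y3 * t3) != 0] &
    forall M, hg 1 M -> [/\ f (M * y1 * t2) = 0, f (M * y1 * t3) = 0 &
                            f (M * y2 * t3) = 0]].
Proof.
move=> j2 B1 B2 B3 u12 u13 u23.
have [[_ _ hm1 _] _ _ _] := B1; have [[_ _ hm2 _] _ _ _] := B2.
have [[_ _ hm3 _] _ _ _] := B3.
have [e12 [he12 e12y1 e12u]] := bad_kill B1 B2 u12.
have [e13 [he13 e13y1 e13u]] := bad_kill B1 B3 u13.
have [e23 [he23 e23y2 e23u]] := bad_kill B2 B3 u23.
exists (m1 ^+ j), (e12 * m2 ^+ (j - 1)), (e13 * e23 * m3 ^+ (j - 2)).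
split; try by hom.
  have p1 := bad_pow B1; have p2 := bad_pow B2; have p3 := bad_pow B3; split=> //.
    have -> : m2 * y2 * (e12 * m2 ^+ (j - 1)) = e12 * y2 * m2 ^+ j.
      by rewrite [in RHS](_ : j = (j - 1).+1) ?exprS; [ring | lia].
    by rewrite (badE B2) ?e12u ?mul1r //; hom.
  have -> : m3 * y3 * (e13 * e23 * m3 ^+ (j - 2)) = e13 * y3 * (m3 * e23 * m3 ^+ (j - 2)).
    by ring.
  rewrite (badE B3) ?e13u ?mul1r //; last by hom.
  have -> : m3 * y3 * (m3 * e23 * m3 ^+ (j - 2)) = e23 * y3 * m3 ^+ j.
    by rewrite [in RHS](_ : j = (j - 2).+2) ?exprS; [ring | lia].
  by rewrite (badE B3) ?e23u ?mul1r //; hom.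
move=> M hM; split.
- have -> : M * y1 * (e12 * m2 ^+ (j - 1)) = e12 * y1 * (M * m2 ^+ (j - 1)) by ring.
  by apply: e12y1; hom.
- have -> : M * y1 * (e13 * e23 * m3 ^+ (j - 2)) = e13 * y1 * (M * e23 * m3 ^+ (j - 2)).
    by ring.
  by apply: e13y1; hom.
- have -> : M * y2 * (e13 * e23 * m3 ^+ (j - 2)) = e23 * y2 * (M * e13 * m3 ^+ (j - 2)).
    by ring.
  by apply: e23y2; hom.
Qed.

End Lefschetz.

(** * Injectivity of a general linear form *)

Section Core.
Variables (K : numFieldType) (n : nat).
Local Notation S := {mpoly K[n.+1]}.
Implicit Types (p q x y z L M : S).
Variable f : S -> K.
Hypothesis lin : functional f.
Variables (c j : nat).

(** [even] is the parity of s = c + j + 1: S_1 y pairs with S_1 y when s is even, with y itself when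
    s is odd. By [badE] all the values are multiples of a single one, the value at m1; taking L2
    instead gives zero, because L2 y2 = 0, while L2 y1 is a nonzero multiple of m1 y1. *)
Lemma bad_pairs (even : bool) L1 y1 m1 q1 L2 y2 m2 q2 : (c + even = j)%N ->
  bad f c j L1 y1 m1 q1 -> bad f c j L2 y2 m2 q2 -> f (L2 * y1 * q1) != 0 ->
  forall M M', hg 1 M -> hg 1 M' ->
    f (M * y1 * ((if even then M' else 1) * y2)) = 0.
Proof.
move=> cj B1 B2 u12; have [[_ hy1 hm1 hq1] _ _ _] := B1.
have [[hL2 hy2 hm2 hq2] L2y2 _ _] := B2.
have hz M' : hg 1 M' -> hg j ((if even then M' else 1) * y2).
  by move=> hM'; case: even cj => cj; hom.
suff m1m1 : f (m1 * y1 * ((if even then m1 else 1) * y2)) = 0.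
  move=> M M' hM hM'; rewrite (badE lin B1 hM (hz _ hM')).
  case: even hz {cj} m1m1 => hz m1m1; last by rewrite m1m1 mulr0.
  have -> : m1 * y1 * (M' * y2) = M' * y1 * (m1 * y2) by ring.
  by rewrite (badE lin B1 hM' (hz _ hm1)) m1m1 !mulr0.
have := L2y2 ((if even then L2 else 1) * y1); case: even hz cj => hz cj H.
  have : f (L2 * y2 * (L2 * y1)) = 0 by apply: H; hom.
  have -> : L2 * y2 * (L2 * y1) = L2 * y1 * (L2 * y2) by ring.
  rewrite (badE lin B1 hL2 (hz _ hL2)).
  have -> : m1 * y1 * (L2 * y2) = L2 * y1 * (m1 * y2) by ring.
  rewrite (badE lin B1 hL2 (hz _ hm1)) => /eqP.
  by rewrite !mulf_eq0 (negPf u12) => /eqP.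
have : f (L2 * y2 * (1 * y1)) = 0 by apply: H; hom.
have -> : L2 * y2 * (1 * y1) = L2 * y1 * (1 * y2) by ring.
by rewrite (badE lin B1 hL2 (hz _ hm1)) => /eqP; rewrite mulf_eq0 (negPf u12) => /eqP.
Qed.

(** Otherwise three successive general L's have kernels. The three y_i, multiplied by m_i if s is
    even, are matched with the t_i; by isotropy, t2 and t1 can be added, matched with m2 y2 and m1
    y1, and the array reaches size five. [Good] stands for the open condition that ensures isotropy
    and makes S_1 y a line. *)
Lemma lefschetz_core (even : bool) (Good : S -> Prop) :
  (2 <= j)%N -> (c + even = j)%N -> dep5 f j c.+1 ->
  zopen Good -> (exists2 L, hg 1 L & Good L) ->
  (forall L y, hg 1 L -> Good L -> hg c y -> nul f j (L * y) ->
    (forall M M', hg 1 M -> hg 1 M' ->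
      f (M * y * ((if even then M' else 1) * y)) = 0) /\
    (forall m M1 q0 q1, hg 1 m -> hg 1 M1 -> hg j q0 -> hg j q1 ->
     f (m * y * q0) = 1 -> f (m * y * q1) = 0 ->
     f (M1 * y * q0) = 0 -> f (M1 * y * q1) = 1 -> False)) ->
  exists L, [/\ hg 1 L, Good L &
    forall y, hg c y -> nul f j (L * y) -> nul f j.+1 y].
Proof.
move=> j2 cj dep zo exG HG; apply: contrapT => H.
have badG L : hg 1 L -> Good L -> exists y m q0, bad f c j L y m q0.
  move=> hL gL; apply: contrapT => nb; apply: H; exists L; split=> // y hy Ly.
  apply: contrapT => ny; apply: nb; exists y.
  by have [_ C1] := HG L y hL gL hy Ly; apply: (bad_exists lin hL hy Ly ny).
have zo1 y q : zopen (fun L => f (L * y * q) != 0).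
  move=> L M hL hM; rewrite -mulrA -(expr1 L) => /(@zopen_pow _ _ _ lin 1 (y * q) _ _ hL hM).
  by case=> p [p0 Hp]; exists p; split=> // t /Hp; rewrite expr1 mulrA.
have bad1 L y m q0 : bad f c j L y m q0 -> exists2 L, hg 1 L & f (L * y * q0) != 0.
  by move=> [[_ _ hm _] _ e _]; exists m; rewrite // e oner_eq0.
have [L1 hL1 g1] := exG.
have [y1 [m1 [q1 B1]]] := badG _ hL1 g1.
have [L2 [hL2 g2 u12]] := zopen_meet zo (zo1 y1 q1) exG (bad1 _ _ _ _ B1).
have [y2 [m2 [q2 B2]]] := badG _ hL2 g2.
have [L3 [hL3 [g3 u13] u23]] : exists L, [/\ hg 1 L, Good L /\ f (L * y1 * q1) != 0
    & f (L * y2 * q2) != 0].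
  apply: (zopen_meet (zopenI zo (zo1 y1 q1)) (zo1 y2 q2)); last exact: bad1 B2.
  by exists L2.
have [y3 [m3 [q3 B3]]] := badG _ hL3 g3.
have [t1 [t2 [t3 [ht1 ht2 ht3 [n1 n2 n3] Ht]]]] := three_bad lin j2 B1 B2 B3 u12 u13 u23.
have [[_ hy1 hm1 _] L1y1 _ _] := B1; have [[_ hy2 hm2 _] L2y2 _ _] := B2.
have [[_ hy3 hm3 _] L3y3 _ _] := B3.
have [i1 _] := HG _ _ hL1 g1 hy1 L1y1; have [i2 _] := HG _ _ hL2 g2 hy2 L2y2.
have i12 := bad_pairs cj B1 B2 u12; have i13 := bad_pairs cj B1 B3 u13.
have i23 := bad_pairs cj B2 B3 u23.
pose x (m y : S) : S := (if even then m else 1) * y.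
pose w (m t : S) : S := (if even then 1 else m) * t.
have sym m y M' y' : f (x m y * (M' * y')) = f (M' * y' * ((if even then m else 1) * y)).
  by rewrite mulrC.
have sym' m y M' y' : exists m0 m1, [/\ hg 1 m -> hg 1 M' -> hg 1 m0,
   hg 1 m -> hg 1 M' -> hg 1 m1 & x m y * (M' * y') =
     m0 * y * ((if even then m1 else 1) * y')].
  rewrite /x; case: (even); first by exists m, M'; split.
  by exists M', M'; split=> //; ring.
have [ma [mb [hma hmb e1]]] := sym' m1 y1 m2 y2.
have hw m t : hg 1 m -> hg j t -> hg c.+1 (w m t).
  by rewrite /w; case: (even) cj => cj *; hom.
have hx m y : hg 1 m -> hg c y -> hg j (x m y).
  by rewrite /x; case: (even) cj => cj *; hom.
have xw m y M t : x m y * w M t = (if even then m else M) * y * t.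
  by rewrite /x /w; case: (even); ring.
have hif m M : hg 1 m -> hg 1 M -> hg 1 (if even then m else M) by case: (even).
apply: (@tri5_contra _ _ _ lin _ _ (x m1 y1) (x m2 y2) (x m3 y3) t2 t1
  (w m1 t1) (w m2 t2) (w m3 t3) (m2 * y2) (m1 * y1) dep); rewrite ?xw ?if_same //;
  try (by [apply: hx|apply: hw|hom]).
- by rewrite mulrC.
- by rewrite mulrC.
- by case: (Ht _ (hif _ _ hm1 hm2)).
- by case: (Ht _ (hif _ _ hm1 hm3)).
- by rewrite e1; apply: i12; auto.
- by rewrite sym; apply: i1.
- by case: (Ht _ (hif _ _ hm2 hm3)).
- by rewrite sym; apply: i2.
- by rewrite sym; apply: i12.
- by rewrite sym; apply: i23.
- by rewrite sym; apply: i13.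
- by rewrite mulrC; case: (Ht _ hm1).
Qed.
End Core.

(** * Maximal rank and the Hessian *)

Section LefschetzThm.
Variables (K : numFieldType) (n : nat).
Local Notation S := {mpoly K[n.+1]}.
Implicit Types (p q x y z L M : S).
Variable f : S -> K.
Hypothesis lin : functional f.

(** Up to a constant factor, the Hessian determinant at (1, 0) of the binary form (a, b) |-> f ((a L
    + b M)^s). *)
Definition hessian s L M := f (L ^+ s) * f (L ^+ (s - 2) * M ^+ 2) - f (L ^+ (s - 1) * M) ^+ 2.

Lemma zopen_hessian s : zopen (fun L => exists2 M, hg 1 M & hessian s L M != 0).
Proof.
move=> L M hL hM [N hN nz].
pose p := line_poly f s 1 L M * line_poly f (s - 2) (N ^+ 2) L M -
          line_poly f (s - 1) N L M ^+ 2.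
have pE t : p.[t] = hessian s (L + t *: M) N.
  by rewrite /p !hornerE !(horner_line_poly lin) mulr1.
exists p; split=> [|t]; first by rewrite pE scale0r addr0.
by rewrite pE; exists N.
Qed.

Lemma max_rank_exists c j : (forall L, hg 1 L -> ~ rank_ge f c j 5 L) ->
  exists2 k, exists2 L, hg 1 L & rank_ge f c j k L &
             forall L, hg 1 L -> ~ rank_ge f c j k.+1 L.
Proof.
move=> no5; apply: contrapT => H.
have H' k : exists2 L, hg 1 L & rank_ge f c j k L.
  elim: k => [|k [L hL rL]].
    exists 0; first exact: hg0.
    by exists (fun=> 0), (fun=> 0); split=> [[]|[]|] //; rewrite det_mx00 oner_eq0.
  apply: contrapT => H1; apply: H; exists k; first by exists L.
  by move=> L' hL' rL'; apply: H1; exists L'.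
by have [L hL /no5] := H' 5%N; apply.
Qed.

(** In f (L x z) the factor L is attached to x if s is even and to z if s is odd, which leaves the
    degrees j and c + 1 of the hypothesis. *)
Lemma rank_lt5 (even : bool) c j L : (c + even = j)%N -> dep5 f j c.+1 -> hg 1 L ->
  ~ rank_ge f c j 5 L.
Proof.
move=> cj dep hL [x [z [hx hz]]] /negP; apply; apply/det0P.
have [|a [k0 ak0] na] := dep (fun i => (if even then L else 1) * x i).
  by move=> k; have := hx k; case: (even) cj => cj ?; hom.
exists (\row_i a i).
  by apply: contraNneq ak0 => /rowP /(_ k0); rewrite !mxE => ->.
apply/rowP => i; rewrite !mxE.
have hz' : hg c.+1 ((if even then 1 else L) * z i).
  by have := hz i; case: (even) cj => cj ?; hom.
rewrite -[RHS](na _ hz') mulr_suml (f_sum lin); apply: eq_bigr => k _.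
rewrite !mxE -scalerAl (fZ lin); congr (_ * f _).
by case: (even); ring.
Qed.

(** Isotropy comes from [pencil]. If S_1 y contained two independent classes, then for s even they
    would form an isotropic plane which, with a dual plane and L^j orthogonal to it, makes five. For
    s odd, y alone replaces the plane in degree j, and the missing class L^(c-1) N is supplied by
    the Hessian. *)
Theorem lefschetz s (even : bool) c j : (2 <= j)%N -> (c + even = j)%N -> (c + j).+1 = s ->
  dep5 f j c.+1 -> (exists2 L, hg 1 L & f (L ^+ s) != 0) ->
  (exists2 L, hg 1 L & exists2 M, hg 1 M & hessian s L M != 0) ->
  exists L, [/\ hg 1 L, f (L ^+ s) != 0 &
    forall y, hg c y -> nul f j (L * y) -> nul f j.+1 y].
Proof.
move=> j2 cj cjs dep exp exh.
have [k exk maxk] := max_rank_exists (fun L => @rank_lt5 even c j L cj dep).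
pose Good L := [/\ rank_ge f c j k L, f (L ^+ s) != 0 &
                   exists2 M, hg 1 M & hessian s L M != 0].
have zp : zopen (fun L => f (L ^+ s) != 0).
  move=> L M hL hM; rewrite -[L ^+ s]mulr1 => /(@zopen_pow _ _ _ lin s 1 _ _ hL hM).
  by case=> p [p0 Hp]; exists p; split=> // t /Hp; rewrite mulr1.
have zr := @zopen_rank_ge _ _ _ lin c j k.
have zh := @zopen_hessian s.
have zG : zopen Good.
  move=> L M hL hM [g1 g2 g3].
  have [p [p0 Hp]] := zopenI (zopenI zr zp) zh hL hM (conj (conj g1 g2) g3).
  by exists p; split=> // t /Hp [[]].
have exG : exists2 L, hg 1 L & Good L.
  have [L1 [hL1 a1 b1]] := zopen_meet zr zp exk exp.
  have [L [hL [a b] d]] := zopen_meet (zopenI zr zp) zh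
    (ex_intro2 _ _ L1 hL1 (conj a1 b1)) exh.
  by exists L.
have [|L [hL [_ Ls _] inj]] := lefschetz_core lin j2 cj dep zG exG; last by exists L.
move=> {exk exp exh exG} L y hL [rL Ls [M0 hM0 hess]] hy Ly.
have pen M z : hg 1 M -> hg j z -> (forall x, hg c x -> f (L * x * z) = 0) ->
    f (M * y * z) = 0.
  by move=> hM hz; apply: (pencil lin hL hM hy hz rL maxk Ly).
have isoy M M' : hg 1 M -> hg 1 M' -> f (M * y * ((if even then M' else 1) * y)) = 0.
  move=> hM hM'; apply: pen => //; first by case: (even) cj => cj; hom.
  move=> x hx.
  have -> : L * x * ((if even then M' else 1) * y) =
    L * y * ((if even then M' else 1) * x) by ring.
  by apply: Ly; case: (even) cj => cj; hom.
split=> // m M1 q0 q1 hm hM1 hq0 hq1 e00 e01 e10 e11.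
have n0 : 1 != 0 :> K by rewrite oner_eq0.
case: (even) cj isoy => cj isoy.
- have hq0' : hg c.+1 q0 by rewrite (_ : c.+1 = j) //; lia.
  have hq1' : hg c.+1 q1 by rewrite (_ : c.+1 = j) //; lia.
  have Lj M : hg 1 M -> f (M * y * L ^+ j) = 0.
    move=> hM; have -> : M * y * L ^+ j = L * y * (M * L ^+ c).
      by rewrite -cj addn1 exprS; ring.
    by apply: Ly; hom.
  apply: (@tri5_contra _ _ _ lin _ _ (m * y) (M1 * y) (L ^+ j) q0 q1
    q0 q1 (L ^+ j) (m * y) (M1 * y) dep); try (by hom).
  + by rewrite e00.
  + by rewrite e11.
  + by rewrite -exprD (_ : j + j = s)%N //; lia.
  + by rewrite mulrC e00.
  + by rewrite mulrC e11.
  + exact: Lj.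
  + exact: isoy.
  + exact: isoy.
  + exact: Lj.
  + exact: isoy.
  + exact: isoy.
  + by rewrite mulrC Lj.
  + by rewrite mulrC Lj.
  + by rewrite mulrC e10.
have c2 : (2 <= c)%N by lia.
have jc : j = c by lia.
clear cj; subst j.
have Lq q : hg c.+1 q -> f (y * (L * q)) = f (L * y * q) by move=> _; congr f; ring.
(* Subtracting a multiple of L does not change the Hessian, which becomes f (L^s) f (L^(s-2) N^2)
   once f (L^(s-1) N) = 0. *)
pose N := M0 - (f (L ^+ (s - 1) * M0) / f (L ^+ s)) *: L.
have hN : hg 1 N by rewrite /N; hom.
have LN : f (L ^+ (s - 1) * N) = 0.
  rewrite /N (fBr lin) (fZr lin) -exprSr (_ : (s - 1).+1 = s); last by lia.
  by rewrite divfK // subrr.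
have LNN : f (L ^+ (s - 2) * N ^+ 2) != 0.
  have -> : L ^+ (s - 2) * N ^+ 2 = L ^+ (s - 2) * M0 ^+ 2 -
    (f (L ^+ (s - 1) * M0) / f (L ^+ s)) *: (L ^+ (s - 1) * M0) -
    (f (L ^+ (s - 1) * M0) / f (L ^+ s)) *: (L ^+ (s - 1) * N).
    rewrite /N; move: (f _ / f _) => k0.
    have -> : (s - 1 = (s - 2).+1)%N by lia.
    by rewrite !exprS -!mul_mpolyC; ring.
  rewrite !(fB lin) !(fZ lin) LN mulr0 subr0; apply: contraNneq hess => H.
  rewrite /hessian -[X in X - _](@mulfK _ (f (L ^+ s))) //.
  have -> : f (L ^+ s) * f (L ^+ (s - 2) * M0 ^+ 2) * f (L ^+ s) / f (L ^+ s) =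
    f (L ^+ s) * f (L ^+ (s - 2) * M0 ^+ 2) by rewrite mulfK.
  move/eqP: H; rewrite subr_eq0 => /eqP ->.
  by rewrite mulrA [X in X * _]mulrC divfK // subrr.
have Ly0 q : hg c q -> f (y * (L * q)) = 0.
  by move=> hq; rewrite mulrA [y * L]mulrC; apply: Ly.
have LLN : f (L ^+ c * (L ^+ c * N)) = 0.
  by rewrite mulrA -exprD (_ : c + c = s - 1)%N //; lia.
apply: (@tri5_contra _ _ _ lin _ _ y (L ^+ c) (L ^+ (c - 1) * N) q0 q1
    (m * q0) (L ^+ c.+1) (L ^+ c * N) (m * y) (M1 * y) dep); try (by hom).
+ by rewrite mulrA [y * m]mulrC e00.
+ by rewrite -exprD (_ : c + c.+1 = s)%N //; lia.
+ have -> : L ^+ (c - 1) * N * (L ^+ c * N) = L ^+ (c - 1 + c) * N ^+ 2 by rewrite exprD; ring.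
  by rewrite (_ : c - 1 + c = s - 2)%N //; lia.
+ by rewrite mulrC e00.
+ by rewrite mulrC e11.
+ by rewrite exprS; apply: Ly0; hom.
+ by rewrite (_ : c = (c - 1).+1) ?exprS -?mulrA; [apply: Ly0; hom | lia].
+ by have := isoy m m hm hm; rewrite mul1r mulrC.
+ by have := isoy M1 m hM1 hm; rewrite mul1r mulrC.
+ have -> : L ^+ c * (m * y) = y * (L * (m * L ^+ (c - 1))).
    by rewrite [in LHS](_ : c = (c - 1).+1) ?exprS; [ring | lia].
  by apply: Ly0; hom.
+ have -> : L ^+ c * (M1 * y) = y * (L * (M1 * L ^+ (c - 1))).
    by rewrite [in LHS](_ : c = (c - 1).+1) ?exprS; [ring | lia].
  by apply: Ly0; hom.
+ have -> : L ^+ (c - 1) * N * (m * y) = y * (L * (m * N * L ^+ (c - 2))).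
    by rewrite (_ : c - 1 = (c - 2).+1)%N ?exprS; [ring | lia].
  by apply: Ly0; hom.
+ have -> : L ^+ (c - 1) * N * (M1 * y) = y * (L * (M1 * N * L ^+ (c - 2))).
    by rewrite (_ : c - 1 = (c - 2).+1)%N ?exprS; [ring | lia].
  by apply: Ly0; hom.
+ by rewrite mulrC e10.
Qed.
End LefschetzThm.

(** * Consequences for the dimensions of A *)

Section Consequences.
Variables (K : numFieldType) (n : nat).
Local Notation S := {mpoly K[n.+1]}.
Implicit Types (p q x y z L M N : S).
Variable f : S -> K.
Hypothesis lin : functional f.

(** Let f (L0^(s-1) N) = 0. On the line L0 + t N the vanishing Hessian reads g g2 = g1^2; by
    induction the coefficient of t^(k-2) reduces to f (L0^s) f (L0^(s-k) N^k), so all these values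
    vanish for k >= 1. Polarising over such N shows that N is zero in A. *)
Lemma hessian0_power s L0 : (2 <= s)%N -> hg 1 L0 -> f (L0 ^+ s) != 0 ->
  (forall L M, hg 1 L -> hg 1 M -> hessian f s L M = 0) ->
  forall M, hg 1 M -> exists c, nul f (s - 1) (M - c *: L0).
Proof.
move=> s2 hL0 nz hess.
have C1 N : hg 1 N -> f (L0 ^+ (s - 1) * N) = 0 ->
    forall k, (1 <= k)%N -> (k <= s)%N -> f (L0 ^+ (s - k) * N ^+ k) = 0.
  move=> hN N0; elim/ltn_ind => k IH k1 ks.
  have [->|k2] := eqVneq k 1%N; first by rewrite expr1.
  pose g := line_poly f s 1 L0 N; pose g2 := line_poly f (s - 2) (N ^+ 2) L0 N.
  pose g1 := line_poly f (s - 1) N L0 N.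
  have E : g * g2 = g1 * g1.
    apply/eqP; rewrite -subr_eq0; apply/eqP/poly_eq0_horner => t.
    rewrite !hornerE !(horner_line_poly lin) mulr1.
    by rewrite -[RHS](hess (L0 + t *: N) N) /hessian ?expr2 //; hom.
  have gi i : (1 <= i)%N -> (i < k)%N -> f (L0 ^+ (s - i) * N ^+ i) = 0.
    by move=> i1 ik; apply: IH; rewrite //; lia.
  have := congr1 (fun r : {poly K} => r`_(k - 2)) E; rewrite !coefM.
  rewrite [RHS]big1 => [|[i /= ik] _]; last first.
    rewrite /g1 coef_poly ifT; last by lia.
    have -> : L0 ^+ (s - 1 - i) * N ^+ i * N = L0 ^+ (s - i.+1) * N ^+ i.+1.
      by rewrite exprSr mulrA (_ : s - 1 - i = s - i.+1)%N //; lia.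
    by rewrite gi ?mul0rn ?mul0r //; lia.
  rewrite big_ord_recl big1 /= => [|[i /= ik] _]; last first.
    rewrite /g coef_poly ifT /bump /=; last by lia.
    by rewrite mulr1 gi ?mul0rn ?mul0r //; lia.
  rewrite addr0 subn0 /g /g2 !coef_poly !ifT; try lia.
  rewrite subn0 expr0 !mulr1 bin0 mulr1n => /eqP.
  rewrite mulf_eq0 (negPf nz) /= mulrn_eq0 => /orP [|/eqP].
    by rewrite -leqn0 leqNgt bin_gt0; have -> : (k - 2 <= s - 2)%N by lia.
  rewrite -mulrA -exprD (_ : k - 2 + 2 = k)%N; last by lia.
  by rewrite (_ : s - 2 - (k - 2) = s - k)%N //; lia.
have C2 N N' j : hg 1 N -> hg 1 N' -> f (L0 ^+ (s - 1) * N) = 0 ->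
    f (L0 ^+ (s - 1) * N') = 0 -> (j < s)%N ->
    f (N' ^+ j * L0 ^+ (s - 1 - j) * N) = 0.
  move=> hN hN' N0 N0' js.
  have := @line_poly_coef0 _ _ _ lin j.+1 (L0 ^+ (s - j.+1)) N' N _ 1%N isT.
  have -> : N' ^+ (j.+1 - 1) * N ^+ 1 * L0 ^+ (s - j.+1) =
    N' ^+ j * L0 ^+ (s - 1 - j) * N.
    by rewrite subSS subn0 expr1 (_ : s - j.+1 = s - 1 - j)%N; [ring | lia].
  apply => t; rewrite mulrC; apply: C1 => //; first by hom.
  by rewrite mulrDr (fD lin) (fZr lin) N0 N0' mulr0 addr0.
move=> M hM; pose c := f (L0 ^+ (s - 1) * M) / f (L0 ^+ s); exists c.
have L0s : L0 ^+ (s - 1) * L0 = L0 ^+ s by rewrite -exprSr (_ : (s - 1).+1 = s) //; lia.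
have proj M' : f (L0 ^+ (s - 1) * (M' - (f (L0 ^+ (s - 1) * M') / f (L0 ^+ s)) *: L0)) = 0.
  by rewrite (fBr lin) (fZr lin) L0s divfK // subrr.
set N := M - _; have hN : hg 1 N by rewrite /N; hom.
apply: (@powers_span _ _ (fun p => f (N * p))) => [|L hL]; first exact: functional_mulr.
pose d := f (L0 ^+ (s - 1) * L) / f (L0 ^+ s); pose N' := L - d *: L0.
have hN' : hg 1 N' by rewrite /N'; hom.
have -> : L = N' + d *: L0 by rewrite /N' subrK.
rewrite mulrC -(horner_line_poly lin) horner_poly big1 // => [[i /= ik]] _.
have := C2 N N' (s - 1 - i)%N hN hN' (proj M) (proj L).
rewrite (_ : s - 1 - (s - 1 - i) = i)%N; last by lia.
by move=> ->; rewrite ?mul0rn ?mul0r //; lia.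
Qed.

Section Dep.
Variables (s c j : nat) (L : S).
Hypotheses (cjs : (c + j).+1 = s) (cj : (c <= j)%N) (jc : (j <= c.+1)%N).
Hypotheses (hL : hg 1 L) (dep : dep5 f j c.+1).
Hypothesis inj : forall y, hg c y -> nul f j (L * y) -> nul f j.+1 y.

(** Injectivity descends from degree c: if L kills y, it kills every M y, so that S_1 y = 0 one
    degree higher, and y = 0 by [nul_S1]. *)
Lemma mul_inj i y : (i <= c)%N -> hg i y -> nul f (s - i.+1) (L * y) -> nul f (s - i) y.
Proof.
move: i y; suff H d i y : (i + d = c)%N -> hg i y -> nul f (s - i.+1) (L * y) ->
    nul f (s - i) y.
  by move=> i y ic; apply: (H (c - i)%N); lia.
elim: d i y => [|d IH] i y id hy Ly.
  rewrite (_ : s - i = j.+1)%N; last by lia.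
  apply: inj; first by rewrite -id addn0.
  by rewrite (_ : j = s - i.+1)%N //; lia.
rewrite (_ : s - i = (s - i.+1).+1)%N; last by lia.
apply: nul_S1 => // M hM; apply: IH; [by lia | by hom |].
rewrite mulrCA; apply: (nulMl (d := 1) Ly hM); lia.
Qed.

Lemma pow_inj d i y : (i + d <= c.+1)%N -> hg i y -> nul f (s - (i + d)) (L ^+ d * y) ->
  nul f (s - i) y.
Proof.
elim: d i y => [|d IH] i y id hy; first by rewrite addn0 expr0 mul1r.
rewrite exprSr -mulrA => H; apply: mul_inj => //; first by lia.
by apply: (IH i.+1); [lia | hom | rewrite addSnnS].
Qed.

(** Up to degree j, a power of L embeds A_i into A_j. Above, five independent classes would have
    five dual ones, again independent, in degree s - i. *)
Lemma dep5_all i : (i <= s)%N -> dep5 f i (s - i).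
Proof.
have low i' : (i' <= j)%N -> dep5 f i' (s - i').
  move=> ij x hx; have [|a a0 na] := @dep (fun k => L ^+ (j - i') * x k).
    by move=> k; have hk := hx k; hom.
  exists a => //; apply: (@pow_inj (j - i')%N); first by lia.
    by apply: hg_sum => k _; apply: hgZ.
  rewrite (_ : s - (i' + (j - i')) = c.+1)%N; last by lia.
  rewrite mulr_sumr; move: na; congr (nul f _ _); apply: eq_bigr => k _.
  by rewrite scalerAr.
move=> i_s; have [ij|ji] := leqP i j; first exact: low.
move=> x hx; have [[z hz xz]|//] := dual_or_dependent lin (s - i) x.
have [|a [k ak] na] := low (s - i)%N _ z hz; first by lia.
have := na (x k); rewrite subKn // => /(_ (hx k)).
rewrite mulr_suml (f_sum lin) (bigD1 k) //= big1 => [|l lk].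
  by rewrite addr0 -scalerAl (fZ lin) [z k * _]mulrC xz eqxx mulr1 => /eqP; rewrite (negPf ak).
by rewrite -scalerAl (fZ lin) [z l * _]mulrC xz eq_sym (negPf lk) mulr0.
Qed.
End Dep.

Theorem lefschetz_reduction s : (4 <= s)%N -> dep5 f s./2 (s - s./2) ->
  (exists2 p, hg s p & f p != 0) ->
  exists L, [/\ hg 1 L, f (L ^+ s) != 0 &
    (forall M, hg 1 M -> exists c, nul f (s - 1) (M - c *: L)) \/
    ((forall i, (i <= s)%N -> dep5 f i (s - i)) /\
     (forall M, hg 1 M -> nul f (s - 2) (L * M) -> nul f (s - 1) M))].
Proof.
move=> s4 dep [p hp fp].
have exp : exists2 L, hg 1 L & f (L ^+ s) != 0.
  apply: contrapT => H; move/eqP: fp; apply; apply: (powers_span lin _ hp) => L hL.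
  by apply/eqP; apply: contraPT H => nz; apply; exists L.
have [[L hL [M hM hess]]|nh] := EM (exists2 L, hg 1 L & exists2 M, hg 1 M & hessian f s L M != 0);
    last first.
  have [L0 hL0 nz] := exp; exists L0; split=> //; left.
  apply: hessian0_power => //; first by lia.
  move=> L M hL hM; apply/eqP; apply: contraPT nh => nz'; apply.
  by exists L => //; exists M.
(* Multiplication by L from A_c to A_(c+1) reaches the middle: c + 1 + j = s, with c = j - 1 for s
   even and c = j for s odd. As 4 <= s, one has 2 <= j and 1 <= c, so that A_1 is within reach of
   [mul_inj]. *)
pose c := (s.-1)./2; pose j := s./2.
have oh := odd_double_half s.
have oh1 : (odd s.-1 + c.*2 = s.-1)%N := odd_double_half s.-1.
have ev : (c + ~~ odd s = j)%N.
  by rewrite /c /j; case: (s) s4 oh1 => //= s' _ _; rewrite uphalf_half; lia.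
have cjs : (c + j).+1 = s by rewrite -ev; case: (odd s) oh ev; rewrite /j /=; lia.
have dep' : dep5 f j c.+1 by rewrite (_ : c.+1 = s - j)%N //; lia.
have [|L1 [hL1 nz inj]] := @lefschetz _ _ _ lin s _ c j _ ev cjs dep' exp
  (ex_intro2 _ _ L hL (ex_intro2 _ _ M hM hess)).
  by rewrite /j; lia.
have cj : (c <= j)%N by rewrite -ev leq_addr.
have jc : (j <= c.+1)%N by rewrite -ev; case: (odd s) => /=; lia.
exists L1; split=> //; right; split.
  by move=> i si; apply: (dep5_all cjs cj jc hL1 dep' inj).
by move=> N hN; apply: (@mul_inj s c j L1 cjs cj jc inj 1%N N) => //; lia.
Qed.

End Consequences.

(** * Limits of sums of powers *)

Section Limits.
Variables (K : numFieldType) (n s : nat).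
Local Notation V := (dhomog n.+1 K s).
Implicit Types (g : 'X_{1..n.+1} -> K).

Definition form_mpoly g : {mpoly K[n.+1]} :=
  \sum_(a : 'X_{1..n.+1 < s.+1} | mdeg a == s) g a *: 'X_[a].

Fact form_homog g : form_mpoly g \is s.-homog.
Proof. by apply: rpred_sum => a /eqP da; apply: rpredZ; rewrite dhomogX; apply/eqP. Qed.

Definition form g : V := DHomog (form_homog g).

Lemma mcoeff_form g a : mdeg a = s -> (form g)@_a = g a.
Proof.
move=> da; have lt_as : (mdeg a < s.+1)%N by rewrite da.
rewrite /= raddf_sum /= (bigD1 (BMultinom lt_as)) /= ?da //.
rewrite mcoeffZ mcoeffX eqxx mulr1 big1 ?addr0 // => b /andP [_ ne_ba].
rewrite mcoeffZ mcoeffX; case: eqP => [E|_]; last by rewrite mulr0.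
by case/eqP: ne_ba; apply: val_inj.
Qed.

Lemma eq_form g1 g2 : (forall a, mdeg a = s -> g1 a = g2 a) -> form g1 = form g2.
Proof.
move=> E; apply/val_inj/eq_bigr => a /eqP da; congr (_ *: _); exact: E.
Qed.

Lemma form_mcoeff (F : V) : form (fun a => F@_a) = F.
Proof.
apply/val_inj/mpolyP => a; have [da|da] := eqVneq (mdeg a) s.
  exact: (mcoeff_form (fun a => F@_a) da).
by rewrite !(dhomog_nemf_coeff (dhomog_is_dhomog _) da).
Qed.

Lemma form_is_linear c g1 g2 : form (fun a => c * g1 a + g2 a) = c *: form g1 + form g2.
Proof.
apply/val_inj; rewrite /= /form_mpoly scaler_sumr -big_split /=.
by apply: eq_bigr => a _; rewrite scalerDl scalerA.
Qed.

Definition monoform (a : 'X_{1..n.+1}) : V := form (fun b => (a == b)%:R).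

Lemma form_sum g : form g = \sum_(a : 'X_{1..n.+1 < s.+1} | mdeg a == s) g a *: monoform a.
Proof.
apply/val_inj; rewrite raddf_sum /=; apply: eq_bigr => a da.
transitivity (g a *: val (monoform a)) => //; congr (_ *: _); apply/mpolyP => b.
have [db|db] := eqVneq (mdeg b) s.
  by rewrite mcoeffX [RHS](mcoeff_form (fun b => (_ == b)%:R) db).
rewrite mcoeffX [RHS](dhomog_nemf_coeff (dhomog_is_dhomog _) db).
by case: eqP => // E; rewrite -E (eqP da) eqxx in db.
Qed.

Lemma coord_eval_family (P : {mpoly K[\dim {:V}]}) (G : 'X_{1..n.+1} -> {poly K}) :
  exists q : {poly K}, forall t, q.[t] = coord_eval P (form (fun a => (G a).[t])).
Proof.
pose w i : {poly K} := \sum_(a : 'X_{1..n.+1 < s.+1} | mdeg a == s)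
  coord (vbasis {:V}) i (monoform a) *: G a.
exists (\sum_(m <- msupp P) P@_m *: \prod_i w i ^+ m i) => t.
rewrite /coord_eval mevalE horner_sum; apply: eq_bigr => m _.
rewrite hornerZ horner_prod; congr (_ * _); apply: eq_bigr => i _.
rewrite horner_exp; congr (_ ^+ _).
rewrite horner_sum form_sum linear_sum; apply: eq_bigr => a _.
by rewrite linearZ hornerZ mulrC.
Qed.

Definition power_sum k (c : 'I_k -> K) (l : 'I_k -> 'I_n.+1 -> K) (a : 'X_{1..n.+1}) :=
  \sum_i c i * \prod_j l i j ^+ a j.

(* The form with coefficients g lies in the Zariski closure of the sums of k
   powers of linear forms. *)
Definition limit_power_sum k g := forall P : {mpoly K[\dim {:V}]},
  (forall c l, coord_eval P (form (@power_sum k c l)) = 0) -> coord_eval P (form g) = 0.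

Lemma eq_limit k g1 g2 : (forall a, mdeg a = s -> g1 a = g2 a) ->
  limit_power_sum k g1 -> limit_power_sum k g2.
Proof. by move=> E H P /H; rewrite (eq_form E). Qed.

Lemma limit_power_sum_power_sum k c l : limit_power_sum k (@power_sum k c l).
Proof. by move=> P; apply. Qed.

(** Along the curve, P becomes a polynomial q in t such that p q vanishes everywhere, so q = 0.
    Every passage to the limit below goes through this lemma. *)
Lemma limit_power_sum_curve k (G : 'X_{1..n.+1} -> {poly K}) (p : {poly K}) t0 :
  p != 0 -> (forall t, p.[t] != 0 -> limit_power_sum k (fun a => (G a).[t])) ->
  limit_power_sum k (fun a => (G a).[t0]).
Proof.
move=> p0 H P HP; have [q Hq] := coord_eval_family P G.
suff q0 : q = 0 by rewrite -Hq q0 horner0.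
suff /eqP : p * q = 0 by rewrite mulf_eq0 (negPf p0) => /eqP.
apply: poly_eq0_horner => t; rewrite hornerM.
have [->|pt] := eqVneq p.[t] 0; first by rewrite mul0r.
by rewrite Hq (H t pt P HP) mulr0.
Qed.

(** If P vanishes on sums of k + 1 powers, its translate Q by the added power vanishes on sums of k
    powers. *)
Lemma limit_power_sum_add k g d m : limit_power_sum k g ->
  limit_power_sum k.+1 (fun a => g a + d * \prod_j m j ^+ a j).
Proof.
move=> H P HP; pose w := form (fun a => \prod_j m j ^+ a j).
pose Q := P \mPo [tuple 'X_i + (d * coord (vbasis {:V}) i w)%:MP | i < \dim {:V}].
have QE v : coord_eval Q v = coord_eval P (d *: w + v).
  rewrite /coord_eval comp_mpoly_meval; apply: meval_eq => i.
  by rewrite tnth_mktuple mevalD mevalXU mevalC linearD linearZ /= addrC.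
have E g' : form (fun a => g' a + d * \prod_j m j ^+ a j) = d *: w + form g'.
  by rewrite -form_is_linear; apply: eq_form => a _; rewrite addrC.
rewrite E -QE; apply: H => c l; rewrite QE -E.
pose c' i := if unlift ord_max i is Some i' then c i' else d.
pose l' i := if unlift ord_max i is Some i' then l i' else m.
rewrite -[RHS](HP c' l'); congr coord_eval; apply: eq_form => a _.
rewrite [RHS]/power_sum [RHS]big_ord_recr /= /c' /l' !unlift_none; congr (_ + _).
apply: eq_bigr => i _; rewrite (_ : widen_ord _ i = lift ord_max i) ?liftK //.
by apply/val_inj; rewrite /= /bump leqNgt ltn_ord.
Qed.

Lemma limit_power_sum_mono k1 k2 g : (k1 <= k2)%N ->
  limit_power_sum k1 g -> limit_power_sum k2 g.
Proof.
elim: k2 => [|k2 IH]; first by rewrite leqn0 => /eqP ->.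
rewrite leq_eqVlt => /orP [/eqP -> //|lt] /(IH lt) H.
have := limit_power_sum_add 0 (fun=> 0) H.
by apply: eq_limit => a _; rewrite mul0r addr0.
Qed.

End Limits.

(** * Forms attached to one matrix *)

Section Monogenic.
Variables (K : numClosedFieldType) (n s : nat).

Lemma diagonalizable_distinct r (T : 'M[K]_r.+1) : is_trig_mx T ->
  (forall i j, i != j -> T i i != T j j) -> diagonalizable T.
Proof.
move=> trT dT; apply/diagonalizableP; exists [seq T i i | i <- enum 'I_r.+1].
  rewrite map_inj_in_uniq ?enum_uniq // => i j _ _ E.
  by apply: contrapT => /eqP /dT; rewrite E eqxx.
rewrite big_map enumT -(char_poly_trig trT); exact: mxminpoly_dvd_char.
Qed.

(** The coefficients obtained by sending the i-th variable to p_i(C) in the algebra K[C] and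
    applying the functional A |-> u A w. *)
Definition mxform r (u : 'rV[K]_r.+1) (C : 'M[K]_r.+1) (w : 'cV[K]_r.+1)
  (p : 'I_n.+1 -> {poly K}) (a : 'X_{1..n.+1}) : K :=
  (u *m horner_mx C (\prod_i p i ^+ a i) *m w) 0 0.

(** Each eigenvalue contributes a power: the linear form has as coefficients the values of the p_i
    there, and the weight is a product of coordinates of u and w in the eigenbasis. *)
Lemma mxform_diagonalizable r u (C : 'M[K]_r.+1) w p : diagonalizable C ->
  limit_power_sum s r.+1 (mxform u C w p).
Proof.
case=> Q Qu /(similar_diagLR Qu) [d].
rewrite conjumx ?unitmx_inv // invmxK => ->.
pose l k i := (p i).[d 0 k].
apply: (eq_limit _ (@limit_power_sum_power_sum _ _ _ _
  (fun k => (u *m invmx Q) 0 k * (Q *m w) k 0) l)) => a _.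
rewrite /mxform horner_mx_uconjC // horner_mx_diag !mulmxA -[_ *m Q *m w]mulmxA.
rewrite /power_sum; move: (u *m invmx Q) (Q *m w) => A B.
rewrite mul_mx_diag mxE; apply: eq_bigr => k _.
rewrite !mxE mulrAC; congr (_ * _ * _).
by rewrite horner_prod; apply: eq_bigr => i _; rewrite horner_exp.
Qed.

(** T + t diag(0, ..., r) remains triangular, and its diagonal entries are distinct whenever t is
    not a root of q. *)
Lemma mxform_trig r u (T : 'M[K]_r.+1) w p : is_trig_mx T ->
  limit_power_sum s r.+1 (mxform u T w p).
Proof.
move=> trT; pose D : 'M[K]_r.+1 := diag_mx (\row_i (i : nat)%:R).
pose TX := map_mx polyC T + 'X *: map_mx polyC D.
pose G (a : 'X_{1..n.+1}) : {poly K} :=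
    (map_mx polyC u *m horner_mx TX (map_poly polyC (\prod_i p i ^+ a i)) *m
             map_mx polyC w) 0 0.
have polyCK m1 m2 (M : 'M[K]_(m1, m2)) t : map_mx (horner_eval t) (map_mx polyC M) = M.
  by apply/matrixP => i j; rewrite !mxE /= /horner_eval hornerC.
have GE t a : (G a).[t] = mxform u (T + t *: D) w p a.
  rewrite -[LHS]/(horner_eval t (G a)).
  have -> : horner_eval t (G a) = (map_mx (horner_eval t) (map_mx polyC u *m
    horner_mx TX (map_poly polyC (\prod_i p i ^+ a i)) *m map_mx polyC w)) 0 0.
    by rewrite [RHS]mxE.
  rewrite !map_mxM !polyCK map_horner_mx -map_poly_comp; congr ((_ *m horner_mx _ _ *m _) 0 0).
    apply/matrixP => i j; rewrite !mxE /= /horner_eval !hornerE.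
    by case: eqP => _; rewrite ?mulr1n ?mulr0n ?hornerE.
  by rewrite map_poly_id // => x _ /=; rewrite /horner_eval hornerC.
pose q : {poly K} := \prod_(ij : 'I_r.+1 * 'I_r.+1 | ij.1 != ij.2)
  ((T ij.1 ij.1 - T ij.2 ij.2)%:P + ((ij.1 : nat)%:R - (ij.2 : nat)%:R) *: 'X).
have q0 : q != 0.
  apply/prodf_neq0 => [[i j] /= ij]; apply/eqP => /(congr1 (fun r : {poly K} => r`_1)).
  rewrite coefD coefC coefZ coefX /= add0r mulr1 coef0 => /eqP.
  by rewrite subr_eq0 eqr_nat => /eqP /val_inj E; rewrite E eqxx in ij.
have := @limit_power_sum_curve _ _ s r.+1 G q 0 q0.
under eq_fun do rewrite GE scale0r addr0; apply => t qt.
apply: (eq_limit (fun a _ => esym (GE t a))).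
apply/mxform_diagonalizable/diagonalizable_distinct.
  apply/is_trig_mxP => i j ij; rewrite !mxE (is_trig_mxP trT) // add0r.
  by rewrite (negPf (_ : i != j)) ?mulr0n ?mulr0 //; apply: contraTneq ij => ->; rewrite ltnn.
move=> i j ij; rewrite !mxE !eqxx !mulr1n -subr_eq0.
move: qt; rewrite /q horner_prod => /prodf_neq0 /(_ (i, j) ij) /=.
rewrite !hornerE; apply: contraNneq => E; apply/eqP; rewrite -[RHS]E; ring.
Qed.

Theorem mxform_limit r u (C : 'M[K]_r.+1) w p : limit_power_sum s r.+1 (mxform u C w p).
Proof.
have [P /unitarymx_unit Pu] := @Schur _ _ C isT.
rewrite /similar_to conjumx // => trT.
apply: (eq_limit _ (mxform_trig (u *m invmx P) (P *m w) p trT)) => a _.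
have CE : C = invmx P *m (P *m C *m invmx P) *m P by rewrite !mulmxA mulVmx // mul1mx mulmxKV.
by rewrite [in RHS]CE /mxform horner_mx_uconjC // !mulmxA.
Qed.

End Monogenic.

(** * Monomials as lists of variables *)

Section Multinomials.
Variable n : nat.

Definition mlist (b : 'X_{1..n}) : seq 'I_n := flatten [seq nseq (b i) i | i <- index_enum 'I_n].

Lemma prod_mlist (R : pzSemiRingType) (A : 'I_n -> R) b :
  \prod_(k <- mlist b) A k = \prod_(i < n) A i ^+ b i.
Proof.
rewrite big_flatten big_map; apply: eq_bigr => i _ /=.
by rewrite big_nseq; elim: (b i) => [|k /= ->]; rewrite ?expr0 ?exprS.
Qed.

Lemma size_mlist b : size (mlist b) = mdeg b.
Proof.
rewrite size_flatten /shape -map_comp mdegE sumnE big_map.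
by apply: eq_bigr => i _; rewrite /= size_nseq.
Qed.

End Multinomials.

(** * Explicit limits of sums of powers *)

Section Families.
Variables (K : numClosedFieldType) (n s : nat).

Lemma size_prod_linear (c d : 'I_n.+1 -> K) (a : 'X_{1..n.+1}) :
  (size (\prod_i ((c i)%:P + d i *: 'X) ^+ a i)%R <= (mdeg a).+1)%N.
Proof.
rewrite -(prod_mlist (fun i => (c i)%:P + d i *: 'X)) -size_mlist.
elim: (mlist a) => [|i l IH]; first by rewrite big_nil size_poly1.
rewrite big_cons; apply: leq_trans (size_polyMleq _ _) _.
have : (size ((c i)%:P + d i *: 'X)%R <= 2)%N.
  apply: leq_trans (size_polyD _ _) _; rewrite geq_max size_polyC.
  by rewrite (leq_trans (leq_b1 _)) //= (leq_trans (size_scale_leq _ _)) ?size_polyX.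
by move: IH => /=; lia.
Qed.

(** C is the companion matrix of the recurrence, w holds its initial values and u reads the first
    coordinate, so that u C^j w = h j for j <= s. The variables are sent to c_i + d_i C. *)
Lemma binary_limit r (h g : nat -> K) (c d : 'I_n.+1 -> K) : g r.+1 != 0 ->
  (forall i, (i + r.+1 <= s)%N -> \sum_(k < r.+2) g k * h (i + k)%N = 0) ->
  limit_power_sum s r.+1 (fun a : 'X_{1..n.+1} =>
    \sum_(j < s.+1) (\prod_i ((c i)%:P + d i *: 'X) ^+ a i)`_j * h j).
Proof.
move=> gr rel; pose u : 'rV[K]_r.+1 := delta_mx 0 0.
pose w : 'cV[K]_r.+1 := \col_i h i.
pose C : 'M[K]_r.+1 := \matrix_(i, j)
  (if (i < r)%N then (j == i.+1 :> nat)%:R else - g j / g r.+1).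
pose p i : {poly K} := (c i)%:P + d i *: 'X.
have Cw k (i : 'I_r.+1) : (k + i <= s)%N -> (C ^+ k *m w) i 0 = h (k + i)%N.
  elim: k i => [|k IH] i ks; first by rewrite expr0 mul1mx mxE.
  rewrite exprS -mulmxA mxE.
  have [ir|ri] := ltnP i r.
    rewrite (bigD1 (Ordinal (ir : i.+1 < r.+1)%N)) //= big1 => [|j ij].
      by rewrite mxE ir eqxx mul1r addr0 IH /= ?addSnnS //; lia.
    by rewrite mxE ir (negPf (_ : (j : nat) != i.+1)) ?mul0r.
  have ir : i = r :> nat by apply/eqP; rewrite eqn_leq ri -ltnS ltn_ord.
  have := rel k; rewrite big_ord_recr /= => /(_ _)/eqP; rewrite addr_eq0.
  have -> : (k + r.+1 <= s)%N by lia.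
  move=> /(_ isT)/eqP E.
  under eq_bigr => j _.
    rewrite mxE ir ltnn IH; last by have := ltn_ord j; lia.
    rewrite (_ : - g j / g r.+1 * h (k + j)%N = - (g j * h (k + j)%N) / g r.+1); last by ring.
    over.
  rewrite -mulr_suml sumrN E opprK mulrC mulKf // ir; congr h; lia.
apply: (eq_limit _ (@mxform_limit _ _ _ _ u C w p)) => a da; rewrite /mxform.
rewrite -/(p _); set q := \prod_i _.
have -> : q = \poly_(i < s.+1) q`_i.
  apply/polyP => i; rewrite coef_poly; case: ltnP => // si.
  by rewrite nth_default // (leq_trans _ si) // -da; apply: size_prod_linear.
rewrite poly_def linear_sum mulmx_sumr mulmx_suml summxE; apply: eq_bigr => j _.
rewrite linearZ /= -scalemxAr -scalemxAl mxE coef_sum (bigD1 j) //=; congr (_ * _).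
  rewrite big1 => [|i ij]; rewrite coefZ coefXn ?eqxx ?mulr1 ?addr0 //.
  by rewrite eq_sym (negPf (ij : i != j :> nat)) mulr0.
rewrite rmorphXn /= horner_mx_X -mulmxA /u -rowE mxE Cw ?addn0 //.
by rewrite -ltnS ltn_ord.
Qed.

Section CompleteIntersection.
Variables (R : comNzRingType) (a0 a1 a2 b0 b1 b2 : R).

(* Multiplication by x and y on the basis 1, x, y, xy of
   R[x, y]/(x^2 - a0 - a1 x - a2 y, y^2 - b0 - b1 x - b2 y). *)
Definition ci_x : 'M[R]_4 := \matrix_(i, j) nth 0 (nth [::] [::
  [:: 0; 1; 0; 0]; [:: a0; a1; a2; 0]; [:: 0; 0; 0; 1];
  [:: a2 * b0; a2 * b1; a0 + a2 * b2; a1]] i) j.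
Definition ci_y : 'M[R]_4 := \matrix_(i, j) nth 0 (nth [::] [::
  [:: 0; 0; 1; 0]; [:: 0; 0; 0; 1]; [:: b0; b1; b2; 0];
  [:: b1 * a0; b0 + b1 * a1; b1 * a2; b2]] i) j.

Lemma ci_comm : ci_x * ci_y = ci_y * ci_x.
Proof.
apply/matrixP => i j; rewrite !mxE !big_ord_recl !big_ord0 !mxE /=.
by case: i j => [[|[|[|[|//]]]] ?] [[|[|[|[|//]]]] ?] /=; ring.
Qed.

Lemma ci_xx : ci_x * ci_x = a0%:M + a1 *: ci_x + a2 *: ci_y.
Proof.
apply/matrixP => i j; rewrite !mxE !big_ord_recl !big_ord0 !mxE /=.
by case: i j => [[|[|[|[|//]]]] ?] [[|[|[|[|//]]]] ?] /=; rewrite ?mulr1n ?mulr0n; ring.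
Qed.

Definition ci_elt (m : 'I_4 -> R) : 'M[R]_4 :=
  (m 0)%:M + m 1 *: ci_x + m 2%:R *: ci_y + m 3%:R *: (ci_x * ci_y).

End CompleteIntersection.

Definition ciform (a0 a1 a2 b0 b1 b2 : K) (m : 'I_n.+1 -> 'I_4 -> K) (w : 'cV[K]_4)
  (a : 'X_{1..n.+1}) : K :=
  (delta_mx 0 0 *m (\prod_i ci_elt a0 a1 a2 b0 b1 b2 (m i) ^+ a i) *m w : 'M_1) 0 0.

(** Replace a2 by a2 + t. For all t but one this is nonzero, and the relation for x^2 then expresses
    y as a quadratic polynomial in x: the algebra is generated by one matrix. *)
Theorem ciform_limit a0 a1 a2 b0 b1 b2 m w :
  limit_power_sum s 4 (ciform a0 a1 a2 b0 b1 b2 m w).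
Proof.
pose M i : 'M[{poly K}]_4 := ci_elt a0%:P a1%:P (a2%:P + 'X) b0%:P b1%:P b2%:P
  (fun k => (m i k)%:P).
pose G (a : 'X_{1..n.+1}) : {poly K} :=
  (delta_mx 0 0 *m (\prod_i M i ^+ a i) *m map_mx polyC w : 'M_1) 0 0.
have ME t i : map_mx (horner_eval t) (M i) = ci_elt a0 a1 (a2 + t) b0 b1 b2 (m i).
  rewrite /M /ci_elt !map_mxD !map_mxZ map_scalar_mx map_mxM /= /horner_eval !hornerC.
  have -> : map_mx (horner_eval t) (ci_x a0%:P a1%:P (a2%:P + 'X) b0%:P b1%:P b2%:P) =
    ci_x a0 a1 (a2 + t) b0 b1 b2.
    apply/matrixP => k l; rewrite !mxE /horner_eval.
    by case: k l => [[|[|[|[|//]]]] ?] [[|[|[|[|//]]]] ?] /=; rewrite !hornerE.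
  have -> // : map_mx (horner_eval t) (ci_y a0%:P a1%:P (a2%:P + 'X) b0%:P b1%:P b2%:P) =
    ci_y a0 a1 (a2 + t) b0 b1 b2.
  apply/matrixP => k l; rewrite !mxE /horner_eval.
  by case: k l => [[|[|[|[|//]]]] ?] [[|[|[|[|//]]]] ?] /=; rewrite !hornerE.
have GE t a : (G a).[t] = ciform a0 a1 (a2 + t) b0 b1 b2 m w a.
  rewrite -[LHS]/(horner_eval t (G a)).
  have -> : horner_eval t (G a) = (map_mx (horner_eval t) (delta_mx 0 0 *m
    (\prod_i M i ^+ a i) *m map_mx polyC w : 'M_1)) 0 0 by rewrite [RHS]mxE.
  rewrite !map_mxM map_delta_mx rmorph_prod /ciform.
  congr ((_ *m _ *m _) 0 0).
    by apply: eq_bigr => i _; rewrite rmorphXn /= ME.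
  by apply/matrixP => i j; rewrite !mxE /= /horner_eval hornerC.
have q0 : 'X + a2%:P != 0 :> {poly K} by rewrite -size_poly_eq0 size_XaddC.
have := @limit_power_sum_curve _ _ s 4 G _ 0 q0.
under eq_fun do rewrite GE addr0; apply => t; rewrite !hornerE addrC => nz.
apply: (eq_limit (fun a _ => esym (GE t a))).
set X := ci_x a0 a1 (a2 + t) b0 b1 b2; set Y := ci_y a0 a1 (a2 + t) b0 b1 b2.
pose q : {poly K} := (a2 + t)^-1 *: ('X ^+ 2 - a1 *: 'X - a0%:P).
have qE : horner_mx X q = Y.
  rewrite /q linearZ !linearB linearZ rmorphXn /= horner_mx_X horner_mx_C expr2.
  rewrite ci_xx -/X -/Y.
  have -> : a0%:M + a1 *: X + (a2 + t) *: Y - a1 *: X - a0%:M = (a2 + t) *: Y.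
    by move: a0%:M (a1 *: X) (_ *: Y) => A B Z; rewrite [A + B + Z]addrC -addrA -opprD [B + A]addrC addrK.
  by rewrite scalerA mulVf ?scale1r.
clearbody q.
apply: (eq_limit _ (@mxform_limit _ _ _ _ (delta_mx 0 0) X w (fun i => (m i 0)%:P + m i 1 *: 'X +
  m i 2%:R *: q + m i 3%:R *: ('X * q)))) => a _.
rewrite /mxform /ciform rmorph_prod /=; congr ((_ *m _ *m _) 0 0).
apply: eq_bigr => i _; rewrite rmorphXn /= !linearD !linearZ rmorphM /=.
by rewrite horner_mx_C horner_mx_X qE.
Qed.

(* Adding the tangent vector at x |-> c x along e to a binary form which is
   killed by a cubic up to a correction at the index 0. *)
Lemma tangent_limit (h g : nat -> K) (b C : K) (c d e : 'I_n.+1 -> K) :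
  g 3%N != 0 -> g 0%N = 0 -> g 1%N * h 1%N + g 2%N * h 2%N + g 3%N * h 3%N + b * C = 0 ->
  (forall i, (1 <= i)%N -> (i + 3 <= s)%N ->
    g 1%N * h (i + 1)%N + g 2%N * h (i + 2)%N + g 3%N * h (i + 3)%N = 0) ->
  limit_power_sum s 4 (fun a : 'X_{1..n.+1} =>
    \sum_(j < s.+1) (\prod_i ((c i)%:P + d i *: 'X) ^+ a i)`_j * h j +
    C * (\prod_i ((c i)%:P + e i *: 'X) ^+ a i)`_1).
Proof.
move=> g3 g0 rel0 rel.
(* [hh] deforms h so as to satisfy the recurrence with g 0 replaced by - b t, provided that h 0 is
   replaced by h 0 - C / t; the constant b C in [h3] is the product of these two corrections. *)
pose nxt (v : {poly K} * {poly K} * {poly K}) : {poly K} * {poly K} * {poly K} :=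
  (v.1.2, v.2, - (g 3%N)^-1 *: (- b *: ('X * v.1.1) + g 1%N *: v.1.2 + g 2%N *: v.2)).
pose h3 : {poly K} := - (g 3%N)^-1 *:
  (- (b * h 0%N) *: 'X + (b * C + g 1%N * h 1%N + g 2%N * h 2%N)%:P).
pose hh j : {poly K} := if j is j'.+1
  then (iter j' nxt ((h 1%N)%:P, (h 2%N)%:P, h3)).1.1 else (h 0%N)%:P.
have R j : hh (j + 4)%N = - (g 3%N)^-1 *:
    (- b *: ('X * hh (j + 1)%N) + g 1%N *: hh (j + 2)%N + g 2%N *: hh (j + 3)%N).
  by rewrite !addnS addn0.
have hh0 j : (j <= s)%N -> (hh j).[0] = h j.
  elim/ltn_ind: j => -[|[|[|[|j]]]] IH js; rewrite ?hornerC //.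
    rewrite /= /h3 !(hornerD, hornerZ, hornerM, hornerX, hornerC).
    apply: (mulfI g3); rewrite mulrA mulrN divff // mulN1r.
    have -> : g 3%N * h 3%N = - (g 1%N * h 1%N + g 2%N * h 2%N + b * C).
      by apply/eqP; rewrite -addr_eq0 -rel0; apply/eqP; ring.
    by ring.
  have := R j; rewrite addn4 => ->; rewrite !(hornerD, hornerZ, hornerM, hornerX, hornerC).
  rewrite !IH; try lia.
  apply: (mulfI g3); rewrite mulrA mulrN divff // mulN1r.
  have := rel j.+1 isT; rewrite !addSn !addnS !addn0 => /(_ js) rel1.
  have -> : g 3%N * h j.+4 = - (g 1%N * h j.+2 + g 2%N * h j.+3).
    by apply/eqP; rewrite -addr_eq0 -rel1; apply/eqP; ring.
  by ring.
have hh_0 : hh 0%N = (h 0%N)%:P by [].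
have hh_1 : hh 1%N = (h 1%N)%:P by [].
have hh_2 : hh 2%N = (h 2%N)%:P by [].
have hh_3 : hh 3%N = h3 by [].
have R' j : hh j.+4 = - (g 3%N)^-1 *:
    (- b *: ('X * hh j.+1) + g 1%N *: hh j.+2 + g 2%N *: hh j.+3).
  by have := R j; rewrite !addnS !addn0.
clearbody hh; clear R.
pose W (f : 'I_n.+1 -> K) (a : 'X_{1..n.+1}) : {poly K} := \prod_i ((c i)%:P + f i *: 'X) ^+ a i.
have W0 f a : (W f a)`_0 = \prod_i c i ^+ a i.
  rewrite -horner_coef0 horner_prod; apply: eq_bigr => i _.
  by rewrite horner_exp !(hornerD, hornerZ, hornerX, hornerC) mulr0 addr0.
pose E a : {poly K} := \poly_(k < s) (W e a)`_k.+1.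
have WE a : mdeg a = s -> W e a = (\prod_i c i ^+ a i)%:P + 'X * E a.
  move=> da; apply/polyP => -[|k].
    by rewrite coefD coefC coefXM /= addr0 W0.
  rewrite coefD coefC coefXM /= add0r coef_poly; case: ltnP => // sk.
  by rewrite nth_default // (leq_trans (size_prod_linear c e a)) // da.
pose G a : {poly K} := \sum_(j < s.+1) (W d a)`_j *: hh j + C *: E a.
have G0 a : mdeg a = s -> (G a).[0] = \sum_(j < s.+1) (W d a)`_j * h j + C * (W e a)`_1.
  move=> da; rewrite /G hornerD horner_sum hornerZ; congr (_ + _ * _).
    by apply: eq_bigr => j _; rewrite hornerZ hh0 // -ltnS.
  rewrite horner_coef0 coef_poly; case: ltnP => // s0.
  by rewrite nth_default // (leq_trans (size_prod_linear c e a)) // da.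
have := @limit_power_sum_curve _ _ s 4 G 'X 0 (negbT (polyX_eq0 K)).
move=> H; apply: (eq_limit G0); apply: H => t; rewrite hornerX => t0.
(* The power of c + t e with weight C / t and the term - C / t placed in index 0, which multiplies
   the power of c, form a difference quotient tending to the tangent term. The recurrence of order
   three accounts for the other three powers. *)
pose ht j := if j is 0 then h 0%N - C / t else (hh j).[t].
pose gt k := if k is 0 then - b * t else g k.
have := @binary_limit 2 ht gt c d g3.
move=> /(_ _)/(limit_power_sum_add (C / t) (fun i => c i + e i * t)) H.
apply: (eq_limit _ (H _)) => [a da|i is_].
  have -> : \prod_j (c j + e j * t) ^+ a j = (W e a).[t].
    rewrite horner_prod; apply: eq_bigr => i _.
    by rewrite horner_exp !(hornerD, hornerZ, hornerC, hornerX).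
  rewrite /G hornerD horner_sum hornerZ -/(W d a).
  rewrite [X in X + _ = _]big_ord_recl [X in _ = X + _]big_ord_recl /= W0 hornerZ hh_0 hornerC.
  rewrite WE // hornerD hornerM hornerX hornerC.
  under [X in _ = _ + X + _]eq_bigr do rewrite hornerZ.
  by field.
rewrite !big_ord_recl big_ord0 /= addr0.
case: i is_ => [|i] is_.
  rewrite /= /bump /= !(addSn, add0n, addn0) hh_1 hh_2 hh_3 /h3.
  rewrite !(hornerD, hornerZ, hornerX, hornerC).
  by field; rewrite t0 g3.
rewrite /= /bump /= !(addSn, addnS, add0n, addn0) /= R' !(hornerD, hornerZ, hornerM, hornerX).
by field.
Qed.

End Families.

(** * Forms in at most four variables *)

Section Matching.
Variables (K : numClosedFieldType) (n s : nat).
Local Notation S := {mpoly K[n.+1]}.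
Implicit Types (p q x y z L M N : S).
Variable f : S -> K.
Hypothesis lin : functional f.

Definition cong j p q := forall z, hg j z -> f (p * z) = f (q * z).

Lemma congP j p q : nul f j (p - q) <-> cong j p q.
Proof.
split=> H z hz; first by have /eqP := H z hz; rewrite mulrBl (fB lin) subr_eq0 => /eqP.
by rewrite mulrBl (fB lin) H ?subrr.
Qed.

Lemma cong_refl j p : cong j p p. Proof. by []. Qed.
Lemma cong_eq j p q : p = q -> cong j p q. Proof. by move=> ->. Qed.
Lemma cong_sym j p q : cong j p q -> cong j q p.
Proof. by move=> H z hz; rewrite H. Qed.
Lemma cong_trans j p q r : cong j p q -> cong j q r -> cong j p r.
Proof. by move=> H1 H2 z hz; rewrite H1 // H2. Qed.
Lemma congD j p1 q1 p2 q2 : cong j p1 q1 -> cong j p2 q2 -> cong j (p1 + p2) (q1 + q2).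
Proof. by move=> H1 H2 z hz; rewrite !mulrDl !(fD lin) H1 // H2. Qed.
Lemma congB j p1 q1 p2 q2 : cong j p1 q1 -> cong j p2 q2 -> cong j (p1 - p2) (q1 - q2).
Proof. by move=> H1 H2 z hz; rewrite !mulrBl !(fB lin) H1 // H2. Qed.
Lemma congZ j c p q : cong j p q -> cong j (c *: p) (c *: q).
Proof. by move=> H z hz; rewrite -!scalerAl !(fZ lin) H. Qed.
Lemma cong_mulr d j k p q u : cong k p q -> hg d u -> (d + j = k)%N -> cong j (p * u) (q * u).
Proof. by move=> H hu e z hz; rewrite -!mulrA; apply: H; apply: hgM hu hz e. Qed.
Lemma cong_mull d j k p q u : cong k p q -> hg d u -> (d + j = k)%N -> cong j (u * p) (u * q).
Proof. by rewrite !(mulrC u); apply: cong_mulr. Qed.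
Lemma cong_sum j (I : Type) (r : seq I) (P : pred I) (u v : I -> S) :
  (forall i, P i -> cong j (u i) (v i)) ->
  cong j (\sum_(i <- r | P i) u i) (\sum_(i <- r | P i) v i).
Proof.
move=> H; elim/big_rec2: _ => [|i a b Pi ab]; first exact: cong_refl.
by apply: congD => //; apply: H.
Qed.

Lemma mpolyX_mlist (a : 'X_{1..n.+1}) : 'X_[a] = \prod_(k <- mlist a) 'X_k :> S.
Proof. by rewrite prod_mlist mpolyXE_id. Qed.

Lemma hg_prodX (l : seq 'I_n.+1) : hg (size l) (\prod_(k <- l) 'X_k : S).
Proof.
elim: l => [|k l IH]; first by rewrite big_nil; apply: hg1.
by rewrite big_cons; apply: (hgM (hgX _ k) IH).
Qed.

(** Each variable may be replaced, one factor at a time, by any representative of its class in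
    A_1. *)
Lemma subst_linear (v : 'I_n.+1 -> S) (a : 'X_{1..n.+1}) : mdeg a = s ->
  (forall i, hg 1 (v i)) -> (forall i, cong (s - 1) 'X_i (v i)) ->
  f 'X_[a] = f (\prod_i v i ^+ a i).
Proof.
move=> da hv HX; rewrite mpolyX_mlist -(prod_mlist v).
suff H (l : seq 'I_n.+1) p k : hg k p -> (k + size l)%N = s ->
    f (p * \prod_(i <- l) 'X_i) = f (p * \prod_(i <- l) v i).
  by rewrite -[X in f X]mul1r (H _ _ 0%N) ?mul1r ?size_mlist //; apply: hg1.
elim: l p k => [|i l IH] p k hp kl; first by rewrite !big_nil.
have hl := hg_prodX l; rewrite /= in kl; have hvi := hv i.
rewrite !big_cons mulrCA HX; last by hom.
rewrite [LHS](_ : _ = f (p * v i * \prod_(j <- l) 'X_j)); last by congr f; ring.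
by rewrite (IH _ k.+1); [rewrite mulrA | hom | lia].
Qed.

(* Dehomogenisation of the functional on the forms in L and x. *)
Lemma binary_expand L x (c d : 'I_n.+1 -> K) (a : 'X_{1..n.+1}) : mdeg a = s ->
  f (\prod_i (c i *: L + d i *: x) ^+ a i) =
    \sum_(j < s.+1) (\prod_i ((c i)%:P + d i *: 'X) ^+ a i)`_j *
    f (L ^+ (s - j) * x ^+ j).
Proof.
move=> da.
pose psi (q : {poly K}) := \sum_(j < s.+1) q`_j * f (L ^+ (s - j) * x ^+ j).
have psiD (q1 q2 : {poly K}) : psi (q1 + q2) = psi q1 + psi q2.
  by rewrite -big_split; apply: eq_bigr => j _; rewrite coefD mulrDl.
have psiZ k (q : {poly K}) : psi (k *: q) = k * psi q.
  by rewrite /psi mulr_sumr; apply: eq_bigr => j _; rewrite coefZ mulrA.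
pose p i : {poly K} := (c i)%:P + d i *: 'X.
pose v i := c i *: L + d i *: x.
suff H (l : seq 'I_n.+1) i : (i + size l <= s)%N ->
    f (L ^+ (s - i - size l) * x ^+ i * \prod_(k <- l) v k) =
    psi ('X^i * \prod_(k <- l) p k).
  have := H (mlist a) 0%N; rewrite size_mlist da => /(_ (leqnn _)).
  by rewrite subn0 subnn !expr0 !mul1r !prod_mlist.
elim: l i => [|k l IH] i il.
  rewrite !big_nil !mulr1 subn0 /psi; rewrite /= addn0 in il.
  have is1 : (i < s.+1)%N by [].
  rewrite (bigD1 (Ordinal is1)) //= coefXn eqxx mul1r big1 ?addr0 // => j ij.
  by rewrite coefXn (negPf (_ : (j : nat) != i)) ?mul0r.
rewrite /= in il; rewrite !big_cons.
have -> : 'X^i * (p k * \prod_(j <- l) p j) =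
    c k *: ('X^i * \prod_(j <- l) p j) + d k *: ('X^(i.+1) * \prod_(j <- l) p j).
  by rewrite /p exprS -!mul_polyC; ring.
rewrite psiD !psiZ -!IH; try lia.
rewrite -!(fZ lin) -(fD lin); congr f; rewrite {1}/v.
have -> : (s - i - size l = (s - i - size (k :: l)).+1)%N by rewrite /=; lia.
have -> : (s - i.+1 - size l = (s - i - size (k :: l)))%N by rewrite /=; lia.
by rewrite !exprS -!mul_mpolyC; ring.
Qed.

Section Module.
Variables (L : S) (del : nat) (w : 'I_4 -> S).
Hypotheses (hL : hg 1 L) (hw : forall k, hg del (w k)) (del_s : (del < s)%N).

(* p acts on the span of w, modulo Ann f, by the matrix A times L. *)
Definition acts p (A : 'M[K]_4) :=
  forall k, cong (s - del.+1) (p * w k) (L * \sum_l A k l *: w l).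

Lemma acts_scalar c : acts (c *: L) c%:M.
Proof.
move=> k; have -> : \sum_l (c%:M : 'M_4) k l *: w l = c *: w k.
  rewrite (bigD1 k) //= mxE eqxx mulr1n big1 ?addr0 // => l lk.
  by rewrite mxE eq_sym (negPf lk) scale0r.
by rewrite -scalerAl -scalerAr.
Qed.

Lemma actsD p q A B : acts p A -> acts q B -> acts (p + q) (A + B).
Proof.
move=> HA HB k; have -> : \sum_l (A + B) k l *: w l = \sum_l A k l *: w l + \sum_l B k l *: w l.
  by rewrite -big_split; apply: eq_bigr => l _; rewrite mxE scalerDl.
by rewrite mulrDl mulrDr; apply: congD.
Qed.

Lemma actsZ c p A : acts p A -> acts (c *: p) (c *: A).
Proof.
move=> HA k; have -> : \sum_l (c *: A) k l *: w l = c *: \sum_l A k l *: w l.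
  by rewrite scaler_sumr; apply: eq_bigr => l _; rewrite mxE scalerA.
by rewrite -scalerAl -scalerAr; apply: congZ.
Qed.

Lemma acts_cong p q A : cong (s - 1) p q -> acts q A -> acts p A.
Proof.
move=> pq HA k; apply: cong_trans (HA k).
by apply: (cong_mulr pq (hw k)); lia.
Qed.

(** Each variable contributes its matrix together with one factor L, as if multiplying by the
    fraction of the variable by L. *)
Lemma acts_prod (M : 'I_n.+1 -> 'M[K]_4) : (forall i, acts 'X_i (M i)) ->
  forall l : seq 'I_n.+1, (size l + del <= s)%N ->
  forall k, f (w k * (L ^+ (s - del - size l) * \prod_(i <- l) 'X_i)) =
    ((\prod_(i <- l) M i) *m (\col_k f (w k * L ^+ (s - del)))) k 0.
Proof.
move=> HM; elim=> [|i l IH] ls k.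
  by rewrite !big_nil mulr1 mul1mx mxE subn0.
rewrite /= in ls *; rewrite !big_cons -mulmxA mxE.
have hl := hg_prodX l; set P := \prod_(j <- l) _ in hl IH *.
have -> : w k * (L ^+ (s - del - (size l).+1) * ('X_i * P)) =
   'X_i * w k * (L ^+ (s - del - (size l).+1) * P) by ring.
rewrite (HM i k); last by hom.
rewrite mulrC mulr_sumr mulr_sumr (f_sum lin); apply: eq_bigr => j _.
rewrite -IH; last by lia.
rewrite -(fZ lin); congr f.
have -> : (s - del - size l = (s - del - (size l).+1).+1)%N by lia.
by rewrite exprS -!mul_mpolyC; ring.
Qed.

End Module.

End Matching.

Lemma ci_elt_row0 (R : comNzRingType) (a0 a1 a2 b0 b1 b2 : R) m k :
  ci_elt a0 a1 a2 b0 b1 b2 m 0 k = m k.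
Proof.
rewrite !mxE !big_ord_recl !big_ord0 !mxE /=.
case: k => [[|[|[|[|//]]]] ?] /=; rewrite !(mulr1n, mulr0n, mulr0, mulr1, mul0r, addr0, add0r);
  congr m; exact: val_inj.
Qed.

(** * Forms modelled on a complete intersection of two quadrics *)

Section CompleteIntersections.
Variables (K : numClosedFieldType) (n s : nat).
Local Notation S := {mpoly K[n.+1]}.
Implicit Types (p q x y z L M N : S).
Variable f : S -> K.
Hypothesis lin : functional f.
Hypothesis s4 : (4 <= s)%N.
Variables (L x y : S) (a0 a1 a2 b0 b1 b2 : K).
Hypotheses (hL : hg 1 L) (hx : hg 1 x) (hy : hg 1 y).
Hypothesis x2 : cong f (s - 2) (x ^+ 2) (L * (a0 *: L + a1 *: x + a2 *: y)).
Hypothesis y2 : cong f (s - 2) (y ^+ 2) (L * (b0 *: L + b1 *: x + b2 *: y)).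
Let X := ci_x a0 a1 a2 b0 b1 b2.
Let Y := ci_y a0 a1 a2 b0 b1 b2.

Lemma sum_ci (A : 'M[K]_4) k (w : 'I_4 -> S) :
  \sum_l A k l *: w l = A k 0 *: w 0 + A k 1 *: w 1 + A k 2%:R *: w 2%:R + A k 3%:R *: w 3%:R.
Proof.
rewrite !big_ord_recl big_ord0 addr0 -!addrA.
by congr (A k _ *: w _ + (A k _ *: w _ + (A k _ *: w _ + A k _ *: w _))); apply: val_inj.
Qed.

(** x y need not lie in L A_1, so the model lives in degree two, on L^2, L x, L y, x y. The first
    two variables of a monomial are expanded by hand; the remaining s - 2 act by matrices. *)
Theorem ci3_limit : (forall M, hg 1 M -> exists m : K * K * K,
    cong f (s - 1) M (m.1.1 *: L + m.1.2 *: x + m.2 *: y)) ->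
  limit_power_sum s 4 (fun a => f 'X_[a]).
Proof.
move=> span; have [m Hm] := choice (fun i => span 'X_i (hgX K i)).
pose mm i (k : 'I_4) : K := nth 0 [:: (m i).1.1; (m i).1.2; (m i).2; 0] k.
pose w (k : 'I_4) : S := nth 0 [:: L ^+ 2; L * x; L * y; x * y] k.
have hw k : hg 2 (w k) by case: k => [[|[|[|[|//]]]] ?]; rewrite /w /=; hom.
have s2 : (2 < s)%N by lia.
have xX : acts s f L 2 w x X.
  move=> k; rewrite sum_ci /X !mxE /w.
  case: k => [[|[|[|[|//]]]] ?] /=; rewrite ?scale0r ?scale1r ?addr0 ?add0r.
  - by rewrite (_ : x * L ^+ 2 = L * (L * x)); [exact: cong_refl | ring].
  - rewrite (_ : x * (L * x) = L * x ^+ 2); last by ring.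
    rewrite (_ : L * (_ + _ + _) = L * (L * (a0 *: L + a1 *: x + a2 *: y))).
      by apply: (cong_mull x2 hL); lia.
    by rewrite -!mul_mpolyC; ring.
  - by rewrite (_ : x * (L * y) = L * (x * y)); [exact: cong_refl | ring].
  rewrite (_ : x * (x * y) = x ^+ 2 * y); last by ring.
  apply: (@cong_trans _ _ _ _ _ (L * (a0 *: L + a1 *: x + a2 *: y) * y)).
    by apply: (cong_mulr x2 hy); lia.
  rewrite (_ : L * (a0 *: L + a1 *: x + a2 *: y) * y =
    L * (a0 *: (L * y) + a1 *: (x * y)) + (a2 *: L) * y ^+ 2); last first.
    by rewrite -!mul_mpolyC; ring.
  rewrite (_ : L * (_ + _ + _ + _) = L * (a0 *: (L * y) + a1 *: (x * y)) +
    (a2 *: L) * (L * (b0 *: L + b1 *: x + b2 *: y))); last first.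
    by rewrite -!mul_mpolyC; ring.
  apply: congD => //; apply: (cong_mull y2 (hgZ a2 hL)); lia.
have yY : acts s f L 2 w y Y.
  move=> k; rewrite sum_ci /Y !mxE /w.
  case: k => [[|[|[|[|//]]]] ?] /=; rewrite ?scale0r ?scale1r ?addr0 ?add0r.
  - by rewrite (_ : y * L ^+ 2 = L * (L * y)); [exact: cong_refl | ring].
  - by rewrite (_ : y * (L * x) = L * (x * y)); [exact: cong_refl | ring].
  - rewrite (_ : y * (L * y) = L * y ^+ 2); last by ring.
    rewrite (_ : L * (_ + _ + _) = L * (L * (b0 *: L + b1 *: x + b2 *: y))).
      by apply: (cong_mull y2 hL); lia.
    by rewrite -!mul_mpolyC; ring.
  rewrite (_ : y * (x * y) = y ^+ 2 * x); last by ring.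
  apply: (@cong_trans _ _ _ _ _ (L * (b0 *: L + b1 *: x + b2 *: y) * x)).
    by apply: (cong_mulr y2 hx); lia.
  rewrite (_ : L * (b0 *: L + b1 *: x + b2 *: y) * x =
    L * (b0 *: (L * x) + b2 *: (x * y)) + (b1 *: L) * x ^+ 2); last first.
    by rewrite -!mul_mpolyC; ring.
  rewrite (_ : L * (_ + _ + _ + _) = L * (b0 *: (L * x) + b2 *: (x * y)) +
    (b1 *: L) * (L * (a0 *: L + a1 *: x + a2 *: y))); last first.
    by rewrite -!mul_mpolyC; ring.
  apply: congD => //; apply: (cong_mull x2 (hgZ b1 hL)); lia.
have HM i : acts s f L 2 w 'X_i (ci_elt a0 a1 a2 b0 b1 b2 (mm i)).
  apply: (acts_cong hw s2 (Hm i)); rewrite /ci_elt /mm /= scale0r addr0.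
  by apply: (actsD lin _ (actsZ lin _ yY)); apply: (actsD lin _ (actsZ lin _ xX));
     apply: acts_scalar.
pose phi : 'cV[K]_4 := \col_k f (w k * L ^+ (s - 2)).
apply: (eq_limit _ (@ciform_limit _ _ s a0 a1 a2 b0 b1 b2 mm phi)) => a da.
rewrite /ciform -prod_mlist mpolyX_mlist.
have := size_mlist a; rewrite da; case: (mlist a) => [|i [|j l]] /= sl; try by lia.
rewrite !big_cons.
have := acts_prod lin hL s2 HM (l := l); rewrite -/phi (_ : s - 2 - size l = 0)%N; last by lia.
rewrite expr0 mul1r => Hl.
set P := \prod_(k <- l) 'X_k in Hl *; set Q := \prod_(k <- l) _ in Hl *.
have {}Hl k : f (w k * P) = (Q *m phi) k 0 by rewrite -Hl ?mul1r //; lia.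
have hP : hg (s - 2) P by rewrite (_ : s - 2 = size l)%N; [exact: hg_prodX | lia].
rewrite !mulrA -[_ * Q]/(_ *m Q) -!mulmxA mulmxA; move: (Q *m phi) Hl => u Hl.
rewrite -[delta_mx 0 0 *m _]rowE mxE.
have -> : \sum_k row 0 (ci_elt a0 a1 a2 b0 b1 b2 (mm i)) 0 k *
      (ci_elt a0 a1 a2 b0 b1 b2 (mm j) *m u) k 0 =
    \sum_k mm i k * (\sum_l ci_elt a0 a1 a2 b0 b1 b2 (mm j) k l * f (w l * P)).
  apply: eq_bigr => k _; rewrite mxE ci_elt_row0 mxE; congr (_ * _).
  by apply: eq_bigr => l' _; rewrite Hl.
have -> : f ('X_i * 'X_j * P) = f (((m i).1.1 *: L + (m i).1.2 *: x + (m i).2 *: y) *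
    ((m j).1.1 *: L + (m j).1.2 *: x + (m j).2 *: y) * P).
  rewrite -mulrA (Hm i); last by have := hgX K j => ?; hom.
  rewrite mulrCA (Hm j); last by hom.
  by congr f; ring.
have fx2 : f (x ^+ 2 * P) = a0 * f (L ^+ 2 * P) + a1 * f (L * x * P) + a2 * f (L * y * P).
  by rewrite x2 // -!(fZ lin) -!(fD lin); congr f; rewrite -!mul_mpolyC; ring.
have fy2 : f (y ^+ 2 * P) = b0 * f (L ^+ 2 * P) + b1 * f (L * x * P) + b2 * f (L * y * P).
  by rewrite y2 // -!(fZ lin) -!(fD lin); congr f; rewrite -!mul_mpolyC; ring.
rewrite /mm; case: (m i) (m j) => [[p0 p1] p2] [[q0 q1] q2] /=.
have -> : (p0 *: L + p1 *: x + p2 *: y) * (q0 *: L + q1 *: x + q2 *: y) * P =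
  (p0 * q0) *: (L ^+ 2 * P) + (p0 * q1 + p1 * q0) *: (L * x * P) +
  (p0 * q2 + p2 * q0) *: (L * y * P) + (p1 * q2 + p2 * q1) *: (x * y * P) +
  (p1 * q1) *: (x ^+ 2 * P) + (p2 * q2) *: (y ^+ 2 * P).
  by rewrite -!mul_mpolyC; ring.
rewrite !(fD lin) !(fZ lin) fx2 fy2.
rewrite !big_ord_recl !big_ord0 /w /=.
by rewrite !mxE !big_ord_recl !big_ord0 !mxE /= !mulr1n !mulr0n; ring.
Qed.

Variable z : S.
Hypothesis hz : hg 1 z.
Hypothesis Lz : cong f (s - 2) (L * z) (x * y).
Hypothesis injL2 : forall w, hg 2 w -> nul f (s - 3) (L * w) -> nul f (s - 2) w.

Lemma cong_cancel p q : hg 2 p -> hg 2 q -> cong f (s - 3) (L * p) (L * q) ->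
  cong f (s - 2) p q.
Proof.
move=> hp hq /(congP lin) H; apply/(congP lin); apply: injL2; first by hom.
by rewrite mulrBr.
Qed.

(** Here z plays the part of x y / L, and the model lives in degree one. The products of z with the
    basis are found after multiplying by L, which can be cancelled on A_2. *)
Theorem ci4_limit : (forall M, hg 1 M -> exists m : K * K * K * K,
    cong f (s - 1) M (m.1.1.1 *: L + m.1.1.2 *: x + m.1.2 *: y + m.2 *: z)) ->
  limit_power_sum s 4 (fun a => f 'X_[a]).
Proof.
move=> span; have [m Hm] := choice (fun i => span 'X_i (hgX K i)).
pose mm i (k : 'I_4) : K := nth 0 [:: (m i).1.1.1; (m i).1.1.2; (m i).1.2; (m i).2] k.
pose w (k : 'I_4) : S := nth 0 [:: L; x; y; z] k.
have hw k : hg 1 (w k) by case: k => [[|[|[|[|//]]]] ?]; rewrite /w /=; hom.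
have s1 : (1 < s)%N by lia.
have xz : cong f (s - 2) (x * z)
    (L * ((a2 * b0) *: L + (a2 * b1) *: x + (a0 + a2 * b2) *: y + a1 *: z)).
  apply: cong_cancel; [by hom | by hom |].
  rewrite (_ : L * (x * z) = x * (L * z)); last by ring.
  apply: (@cong_trans _ _ _ _ _ (x * (x * y))); first by apply: (cong_mull Lz hx); lia.
  rewrite (_ : x * (x * y) = x ^+ 2 * y); last by ring.
  apply: (@cong_trans _ _ _ _ _ (L * (a0 *: L + a1 *: x + a2 *: y) * y)).
    by apply: (cong_mulr x2 hy); lia.
  rewrite (_ : L * (a0 *: L + a1 *: x + a2 *: y) * y =
    L * L * (a0 *: y) + (a1 *: L) * (x * y) + (a2 *: L) * y ^+ 2); last first.
    by rewrite -!mul_mpolyC; ring.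
  rewrite (_ : L * (L * _) = L * L * (a0 *: y) + (a1 *: L) * (L * z) +
    (a2 *: L) * (L * (b0 *: L + b1 *: x + b2 *: y))); last first.
    by rewrite -!mul_mpolyC; ring.
  apply: congD => //; last by apply: (cong_mull y2 (hgZ a2 hL)); lia.
  apply: congD => //; apply: cong_sym; apply: (cong_mull Lz (hgZ a1 hL)); lia.
have yz : cong f (s - 2) (y * z)
    (L * ((b1 * a0) *: L + (b0 + b1 * a1) *: x + (b1 * a2) *: y + b2 *: z)).
  apply: cong_cancel; [by hom | by hom |].
  rewrite (_ : L * (y * z) = y * (L * z)); last by ring.
  apply: (@cong_trans _ _ _ _ _ (y * (x * y))); first by apply: (cong_mull Lz hy); lia.
  rewrite (_ : y * (x * y) = y ^+ 2 * x); last by ring.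
  apply: (@cong_trans _ _ _ _ _ (L * (b0 *: L + b1 *: x + b2 *: y) * x)).
    by apply: (cong_mulr y2 hx); lia.
  rewrite (_ : L * (b0 *: L + b1 *: x + b2 *: y) * x =
    L * L * (b0 *: x) + (b2 *: L) * (x * y) + (b1 *: L) * x ^+ 2); last first.
    by rewrite -!mul_mpolyC; ring.
  rewrite (_ : L * (L * _) = L * L * (b0 *: x) + (b2 *: L) * (L * z) +
    (b1 *: L) * (L * (a0 *: L + a1 *: x + a2 *: y))); last first.
    by rewrite -!mul_mpolyC; ring.
  apply: congD => //; last by apply: (cong_mull x2 (hgZ b1 hL)); lia.
  apply: congD => //; apply: cong_sym; apply: (cong_mull Lz (hgZ b2 hL)); lia.
have xX : acts s f L 1 w x X.
  move=> k; rewrite sum_ci /X !mxE /w.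
  case: k => [[|[|[|[|//]]]] ?] /=; rewrite ?scale0r ?scale1r ?addr0 ?add0r.
  - by rewrite mulrC.
  - by rewrite -expr2.
  - exact: cong_sym.
  - exact: xz.
have yY : acts s f L 1 w y Y.
  move=> k; rewrite sum_ci /Y !mxE /w.
  case: k => [[|[|[|[|//]]]] ?] /=; rewrite ?scale0r ?scale1r ?addr0 ?add0r.
  - by rewrite mulrC.
  - by rewrite mulrC; apply: cong_sym.
  - by rewrite -expr2.
  - exact: yz.
have zZ : acts s f L 1 w z (X * Y).
  move=> k; apply: cong_cancel; first by have := hw k => ?; hom.
    by apply: (hgM hL (e := 1)) => //; apply: hg_sum => l _; apply: hgZ.
  rewrite mulrA; apply: (@cong_trans _ _ _ _ _ (x * y * w k)).
    by apply: (cong_mulr Lz (hw k)); lia.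
  rewrite -mulrA; apply: (@cong_trans _ _ _ _ _ (x * (L * \sum_l Y k l *: w l))).
    by apply: (cong_mull (yY k) hx); lia.
  rewrite mulrCA; rewrite mulr_sumr.
  apply: (@cong_trans _ _ _ _ _ (L * \sum_l Y k l *: (L * \sum_j X l j *: w j))).
    apply: (cong_mull (j := s - 3) (d := 1) (k := s - 2)) => //; last by lia.
    apply: (cong_sum lin) => l _; rewrite -scalerAr; apply: (congZ lin); exact: xX.
  rewrite (_ : \sum_l _ = L * \sum_l (X * Y) k l *: w l); first exact: cong_refl.
  rewrite /X /Y ci_comm mulr_sumr -/X -/Y.
  under eq_bigr => l _ do rewrite mulr_sumr scaler_sumr.
  rewrite exchange_big; apply: eq_bigr => j _ /=.
  rewrite mxE scaler_suml mulr_sumr; apply: eq_bigr => l _.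
  by rewrite -scalerAr scalerA -!scalerAr.
have HM i : acts s f L 1 w 'X_i (ci_elt a0 a1 a2 b0 b1 b2 (mm i)).
  apply: (acts_cong hw s1 (Hm i)); rewrite /ci_elt /mm /=.
  apply: (actsD lin _ (actsZ lin _ zZ)); apply: (actsD lin _ (actsZ lin _ yY)).
  by apply: (actsD lin _ (actsZ lin _ xX)); apply: acts_scalar.
pose phi : 'cV[K]_4 := \col_k f (w k * L ^+ (s - 1)).
apply: (eq_limit _ (@ciform_limit _ _ s a0 a1 a2 b0 b1 b2 mm phi)) => a da.
rewrite /ciform -prod_mlist mpolyX_mlist.
have := size_mlist a; rewrite da; case: (mlist a) => [|i l] /= sl; try by lia.
rewrite !big_cons.
have := acts_prod lin hL s1 HM (l := l); rewrite -/phi (_ : s - 1 - size l = 0)%N; last by lia.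
rewrite expr0 => Hl.
set P := \prod_(k <- l) 'X_k in Hl *; set Q := \prod_(k <- l) _ in Hl *.
have {}Hl k : f (w k * P) = (Q *m phi) k 0 by rewrite -Hl ?mul1r //; lia.
have hP : hg (s - 1) P by rewrite (_ : s - 1 = size l)%N; [exact: hg_prodX | lia].
rewrite -[_ * Q]/(_ *m Q) -!mulmxA mulmxA; move: (Q *m phi) Hl => u Hl.
rewrite -[delta_mx 0 0 *m _]rowE mxE (Hm i) //.
rewrite (_ : _ + _ = \sum_k mm i k *: w k); last first.
  by rewrite !big_ord_recl big_ord0 /mm /w /= addr0 !addrA.
rewrite mulr_suml (f_sum lin); apply: eq_bigr => k _.
by rewrite mxE ci_elt_row0 -Hl -scalerAl (fZ lin).
Qed.

End CompleteIntersections.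

(** * One and two variables *)

Section FewVariables.
Variables (K : numClosedFieldType) (n s : nat).
Local Notation S := {mpoly K[n.+1]}.
Implicit Types (p q x y z L M N : S).
Variable f : S -> K.
Hypothesis lin : functional f.

(** After the substitution L = L' + t x, the coefficient of x^(r+1) is the value of the relation at
    (t, 1), nonzero for general t. A recurrence with invertible leading coefficient results. *)
Lemma binary_relation_shift r L x (g : nat -> K) : (exists k : 'I_r.+2, g k != 0) ->
  exists t : K, exists2 g' : nat -> K, g' r.+1 != 0 &
    \sum_(k < r.+2) g k *: (L ^+ (r.+1 - k) * x ^+ k) =
    \sum_(j < r.+2) g' j *: ((L - t *: x) ^+ (r.+1 - j) * x ^+ j).
Proof.
move=> [k0 gk0]; pose P := \poly_(k < r.+2) g (r.+1 - k)%N.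
have [t Pt] : exists t, P.[t] != 0.
  apply: poly_nonroot; apply: contraNneq gk0 => /(congr1 (fun q : {poly K} => q`_(r.+1 - k0))).
  rewrite coef_poly ltnS leq_subr coef0 subKn; first by move=> ->.
  by rewrite -ltnS ltn_ord.
exists t; set L' := L - _; have LE : L = L' + t *: x by rewrite /L' subrK.
exists (fun j => \sum_(k < r.+2) g k *
    (if (k <= j)%N then t ^+ (j - k) *+ 'C(r.+1 - k, j - k) else 0)).
  move: Pt; congr (_ != 0); rewrite /P horner_poly (reindex_inj rev_ord_inj) /=.
  apply: eq_bigr => k _; rewrite subSS; have kr : (k <= r.+1)%N by rewrite -ltnS ltn_ord.
  by rewrite subKn // kr binn mulr1n.
under [RHS]eq_bigr do rewrite scaler_suml.
rewrite exchange_big; apply: eq_bigr => k _ /=.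
under eq_bigr do rewrite -scalerA; rewrite -scaler_sumr; congr (_ *: _).
rewrite LE exprDn mulr_suml.
have kr : (k <= r.+1)%N by rewrite -ltnS ltn_ord.
rewrite -(big_mkord xpredT (fun j => (if (k <= j)%N then t ^+ (j - k) *+ 'C(r.+1 - k, j - k) else 0)
   *: (L' ^+ (r.+1 - j) * x ^+ j))).
rewrite (@big_cat_nat _ _ _ k) //=; last by rewrite ltnW.
rewrite [X in _ = X + _]big_nat_cond [X in _ = X + _]big1 ?add0r; last first.
  move=> j; rewrite andbT => /andP [_ jk].
  by rewrite leqNgt jk scale0r.
rewrite -[X in index_iota X _]add0n big_addn big_mkord (subSn kr); apply: eq_bigr => j _.
rewrite leq_addl addnK exprZn exprD (_ : r.+1 - (j + k) = r.+1 - k - j)%N; last by lia.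
by rewrite mulrnAl -scalerMnl; congr (_ *+ _); rewrite -!mul_mpolyC; ring.
Qed.

(** Multiplied by the monomials in L' and x, the relation becomes a recurrence for h j = f (L'^(s-j)
    x^j). *)
Lemma binary_form_limit r L x (c d : 'I_n.+1 -> K) (g : nat -> K) :
  hg 1 L -> hg 1 x -> (r.+1 <= s)%N -> (exists k : 'I_r.+2, g k != 0) ->
  nul f (s - r.+1) (\sum_(k < r.+2) g k *: (L ^+ (r.+1 - k) * x ^+ k)) ->
  limit_power_sum s r.+1 (fun a => f (\prod_i (c i *: L + d i *: x) ^+ a i)).
Proof.
move=> hL hx rs g0 rel; have [t [g' top relE]] := binary_relation_shift L x g0.
rewrite {}relE in rel; set L' := L - t *: x in rel.
have hL' : hg 1 L' by rewrite /L'; hom.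
have LE : L = L' + t *: x by rewrite /L' subrK.
pose h j := f (L' ^+ (s - j) * x ^+ j).
have H := @binary_limit K n s r h g' c (fun i => d i + c i * t) top.
apply: (eq_limit _ (H _)).
  move=> a da; rewrite -(binary_expand lin) //; congr f; apply: eq_bigr => i _.
  by congr (_ ^+ _); rewrite LE -!mul_mpolyC; ring.
move=> i is_; have hz : hg (s - r.+1) (L' ^+ (s - r.+1 - i) * x ^+ i) by hom.
rewrite -[RHS](rel _ hz) mulr_suml (f_sum lin); apply: eq_bigr => k _.
have kr : (k <= r.+1)%N by rewrite -ltnS ltn_ord.
rewrite /h -(fZ lin); congr f.
rewrite (_ : s - (i + k) = (r.+1 - k) + (s - r.+1 - i))%N; last by lia.
by rewrite !exprD -!mul_mpolyC; ring.
Qed.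

Lemma one_variable_limit L : hg 1 L -> (1 <= s)%N ->
  (forall M, hg 1 M -> exists c, nul f (s - 1) (M - c *: L)) ->
  limit_power_sum s 4 (fun a => f 'X_[a]).
Proof.
move=> hL s1 span; have [c Hc] := choice (fun i => span 'X_i (hgX K i)).
apply: (@limit_power_sum_mono _ _ _ 1) => //.
have H0 : hg 1 (0 : S) by apply: hg0.
(* A binary form with x = 0, subject to the relation x = 0 of degree one: a single power. *)
apply: (eq_limit _ (@binary_form_limit 0 L 0 c (fun=> 0) (fun k => (k == 1%N)%:R) hL H0 s1 _ _)).
- move=> a da; rewrite (subst_linear da (v := fun i => c i *: L + 0 *: 0)) //.
    by move=> i; hom.
  by move=> i; apply/(congP lin); rewrite scaler0 addr0.
- by exists 1; rewrite oner_eq0.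
- by rewrite big_ord_recl big_ord_recl big_ord0 /= expr1 mulr0 scale0r scaler0 !addr0; apply: (nul0 lin).
Qed.

Lemma two_variables_limit L x : hg 1 L -> hg 1 x -> (4 <= s)%N -> dep5 f 4 (s - 4) ->
  (forall M, hg 1 M -> exists c : K * K, cong f (s - 1) M (c.1 *: L + c.2 *: x)) ->
  limit_power_sum s 4 (fun a => f 'X_[a]).
Proof.
move=> hL hx s4 dep span; have [c Hc] := choice (fun i => span 'X_i (hgX K i)).
have [k|g [k gk] rel] := dep (fun k => L ^+ (4 - k) * x ^+ k).
  by have := ltn_ord k => ?; hom.
have gE (l : 'I_5) : g (inord l) = g l by rewrite inord_val.
have H := @binary_form_limit 3 L x (fun i => (c i).1) (fun i => (c i).2)
  (fun k => g (inord k)) hL hx s4 _ _.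
apply: (eq_limit _ (H _ _)).
- move=> a da; rewrite (subst_linear da (v := fun i => (c i).1 *: L + (c i).2 *: x)) //.
  by move=> i; hom.
- by exists k; rewrite gE.
- by move: rel; congr (nul _ _ _); apply: eq_bigr => l _; rewrite gE.
Qed.

End FewVariables.

(** * Splitting off a power or a tangent direction *)

Section Expansions.
Variables (K : numClosedFieldType) (n s : nat).
Local Notation S := {mpoly K[n.+1]}.
Implicit Types (p q x y z L M N : S).
Variable f : S -> K.
Hypothesis lin : functional f.
Variables (u : 'I_n.+1 -> S) (e : 'I_n.+1 -> K) (al : S).
Hypotheses (hu : forall i, hg 1 (u i)) (hal : hg 1 al).

Lemma hg_prodl (v : 'I_n.+1 -> S) (l : seq 'I_n.+1) : (forall i, hg 1 (v i)) ->
  hg (size l) (\prod_(k <- l) v k).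
Proof.
move=> hv; elim: l => [|k l IH]; first by rewrite big_nil; apply: hg1.
by rewrite big_cons; apply: (hgM (hv k) IH).
Qed.

(** Mixed products vanish because al u_i = 0 in A; only the product of the u_i and that of the e_i
    al remain. *)
Lemma expand_split (a : 'X_{1..n.+1}) : (0 < s)%N -> mdeg a = s ->
  (forall i, cong f (s - 2) (al * u i) 0) ->
  f (\prod_i (u i + e i *: al) ^+ a i) =
  f (\prod_i u i ^+ a i) + f (al ^+ s) * \prod_i e i ^+ a i.
Proof.
move=> s0 da Hu; pose v i := u i + e i *: al.
have hv i : hg 1 (v i) by have := hu i => ?; rewrite /v; hom.
have HA (l : seq 'I_n.+1) k : (k.+1 + size l)%N = s ->
    f (al ^+ k.+1 * \prod_(i <- l) v i) = f (al ^+ s) * \prod_(i <- l) e i.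
  elim: l k => [|i l IH] k kl; first by rewrite !big_nil !mulr1 -kl addn0.
  have hl := hg_prodl l hv; rewrite /= in kl; rewrite !big_cons.
  rewrite [in LHS](_ : _ * _ = al * u i * (al ^+ k * \prod_(j <- l) v j) +
     e i *: (al ^+ k.+2 * \prod_(j <- l) v j)); last first.
    by rewrite {1}/v !exprS -!mul_mpolyC; ring.
  rewrite (fD lin) (fZ lin) Hu; last by hom.
  by rewrite mul0r (f0 lin) add0r IH; [ring | lia].
have HC (l : seq 'I_n.+1) p k : (k + size l)%N = s -> hg k p ->
    ((k < s)%N -> cong f (s - 1 - k) (al * p) 0) ->
    f (p * \prod_(i <- l) v i) = f (p * \prod_(i <- l) u i).
  elim: l p k => [|i l IH] p k kl hp alp; first by rewrite !big_nil.
  have hl := hg_prodl l hv; rewrite /= in kl; rewrite !big_cons; have hui := hu i.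
  rewrite [in LHS](_ : _ * _ = p * u i * \prod_(j <- l) v j +
     e i *: (al * p * \prod_(j <- l) v j)); last first.
    by rewrite {1}/v -!mul_mpolyC; ring.
  rewrite (fD lin) (fZ lin) alp; [|by lia|by rewrite (_ : s - 1 - k = size l)%N //; lia].
  rewrite mul0r (f0 lin) mulr0 addr0 (IH _ k.+1).
  - by congr f; ring.
  - by lia.
  - by hom.
  move=> ks; rewrite mulrA; apply: (@cong_trans _ _ _ _ _ (0 * u i)); last by rewrite mul0r.
  by apply: (cong_mulr (alp _) hui); lia.
rewrite -!(prod_mlist v) -!(prod_mlist u) -(prod_mlist e).
have := size_mlist a; rewrite da; case: (mlist a) => [|i l] /= sl; first by lia.
have hl := hg_prodl l hv; rewrite !big_cons {1}/v mulrDl (fD lin); congr (_ + _).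
  by apply: (HC _ _ 1%N) => // s1; rewrite -subnDA.
by rewrite -scalerAl (fZ lin) -(expr1 al) HA; [rewrite expr1; ring | lia].
Qed.

(** As al^2 = 0, at most one factor al survives, and next to it each u_i acts as c_i L: the sum over
    its positions is the coefficient of X. *)
Lemma expand_tangent L (c : 'I_n.+1 -> K) (a : 'X_{1..n.+1}) : hg 1 L -> mdeg a = s ->
  (forall i, cong f (s - 2) (al * u i) (c i *: (L * al))) -> cong f (s - 2) (al ^+ 2) 0 ->
  f (\prod_i (u i + e i *: al) ^+ a i) =
  f (\prod_i u i ^+ a i) + f (al * L ^+ (s - 1)) *
    (\prod_i ((c i)%:P + e i *: 'X) ^+ a i)`_1.
Proof.
move=> hL da Hu al2; pose v i := u i + e i *: al.
pose w i : {poly K} := (c i)%:P + e i *: 'X.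
have hv i : hg 1 (v i) by have := hu i => ?; rewrite /v; hom.
have HA (l : seq 'I_n.+1) k : (k + size l)%N = (s - 1)%N -> (0 < s)%N ->
    f (al * L ^+ k * \prod_(i <- l) v i) = f (al * L ^+ (s - 1)) * \prod_(i <- l) c i.
  elim: l k => [|i l IH] k kl s0; first by rewrite !big_nil !mulr1 -kl addn0.
  have hl := hg_prodl l hv; rewrite /= in kl; rewrite !big_cons.
  rewrite [in LHS](_ : _ * _ = al * u i * (L ^+ k * \prod_(j <- l) v j) +
     e i *: (al ^+ 2 * (L ^+ k * \prod_(j <- l) v j))); last first.
    by rewrite {1}/v -!mul_mpolyC; ring.
  rewrite (fD lin) (fZ lin) Hu; last by hom.
  rewrite al2; last by hom.
  rewrite mul0r (f0 lin) mulr0 addr0.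
  rewrite [in LHS](_ : _ * _ = c i *: (al * L ^+ k.+1 * \prod_(j <- l) v j)); last first.
    by rewrite exprS -!mul_mpolyC; ring.
  by rewrite (fZ lin) IH; [ring | lia | lia].
have c0 (l : seq 'I_n.+1) : (\prod_(i <- l) w i)`_0 = \prod_(i <- l) c i.
  elim: l => [|i l IH]; first by rewrite !big_nil coef1.
  by rewrite !big_cons coef0M IH /w coefD coefC coefZ coefX mulr0 addr0.
have HB (l : seq 'I_n.+1) p k g : (k + size l)%N = s -> hg k p ->
    ((k < s)%N -> cong f (s - 1 - k) (al * p) (g *: (al * L ^+ k))) ->
    f (p * \prod_(i <- l) v i) = f (p * \prod_(i <- l) u i) +
      g * f (al * L ^+ (s - 1)) * (\prod_(i <- l) w i)`_1.
  elim: l p k g => [|i l IH] p k g kl hp alp.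
    by rewrite !big_nil coef1 mulr0 addr0.
  have hl := hg_prodl l hv; rewrite /= in kl; rewrite !big_cons; have hui := hu i.
  rewrite [in LHS](_ : _ * _ = p * u i * \prod_(j <- l) v j +
     e i *: (al * p * \prod_(j <- l) v j)); last first.
    by rewrite {1}/v -!mul_mpolyC; ring.
  rewrite (fD lin) (fZ lin) alp; [|by lia|by rewrite (_ : s - 1 - k = size l)%N //; lia].
  rewrite -[_ *: _ * _]scalerAl (fZ lin) HA; [|by lia|by lia].
  rewrite (IH _ k.+1 (g * c i)); [|by lia|by hom|].
    have -> : (w i * \prod_(j <- l) w j)`_1 =
       c i * (\prod_(j <- l) w j)`_1 + e i * (\prod_(j <- l) w j)`_0.
      by rewrite /w mulrDl coefD coefCM -scalerAl coefZ coefXM.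
    rewrite c0 (_ : p * u i * \prod_(j <- l) u j = p * (u i * \prod_(j <- l) u j)); first by ring.
    by rewrite mulrA.
  move=> ks; rewrite mulrA; apply: (@cong_trans _ _ _ _ _ (g *: (al * L ^+ k) * u i)).
    by apply: (cong_mulr (alp _) hui); lia.
  rewrite (_ : g *: _ * _ = (g *: L ^+ k) * (al * u i)); last by rewrite -!mul_mpolyC; ring.
  rewrite (_ : (g * c i) *: (al * L ^+ k.+1) = (g *: L ^+ k) * (c i *: (L * al))); last first.
    by rewrite exprS -!mul_mpolyC; ring.
  apply: (cong_mull (d := k) (Hu i)); last by lia.
  by hom.
rewrite -!(prod_mlist v) -!(prod_mlist u) -(prod_mlist w).
have := HB (mlist a) 1 0%N 1; rewrite !mul1r => -> //; first by rewrite size_mlist.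
  exact: hg1.
by rewrite expr0 !mulr1 scale1r.
Qed.

End Expansions.

(** * Three variables *)

Section ThreeVariables.
Variables (K : numClosedFieldType) (n s : nat).
Local Notation S := {mpoly K[n.+1]}.
Implicit Types (p q u v x y z L M N : S).
Variable f : S -> K.
Hypothesis lin : functional f.
Hypothesis s4 : (4 <= s)%N.

Definition spanned3 L x y := forall M, hg 1 M -> exists m : K * K * K,
  cong f (s - 1) M (m.1.1 *: L + m.1.2 *: x + m.2 *: y).

Definition free3 L x y := forall a b c : K,
  nul f (s - 1) (a *: L + b *: x + c *: y) -> [/\ a = 0, b = 0 & c = 0].

(* The class of u in A_2 lies in L A_1. *)
Definition multiple L u := exists2 l, hg 1 l & cong f (s - 2) u (L * l).

Lemma multipleD L u v : multiple L u -> multiple L v -> multiple L (u + v).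
Proof.
move=> [a ha ua] [b hb vb]; exists (a + b); first by hom.
by rewrite mulrDr; apply: congD.
Qed.

Lemma multipleZ L c u : multiple L u -> multiple L (c *: u).
Proof.
move=> [a ha ua]; exists (c *: a); first by hom.
by rewrite -scalerAr; apply: congZ.
Qed.

Lemma multiple_mul L a : hg 1 a -> multiple L (L * a).
Proof. by move=> ha; exists a. Qed.

Lemma eq_multiple L u v : u = v -> multiple L v -> multiple L u.
Proof. by move=> ->. Qed.

Lemma multiple_expand L x y u : hg 1 L -> spanned3 L x y -> multiple L u ->
  exists m : K * K * K, cong f (s - 2) u (L * (m.1.1 *: L + m.1.2 *: x + m.2 *: y)).
Proof.
move=> hL sp [a ha ua]; have [m Hm] := sp a ha; exists m.
by apply: cong_trans ua _; apply: (cong_mull Hm hL); lia.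
Qed.

Lemma ci3_multiple L x y : hg 1 L -> hg 1 x -> hg 1 y -> spanned3 L x y ->
  multiple L (x ^+ 2) -> multiple L (y ^+ 2) -> limit_power_sum s 4 (fun a => f 'X_[a]).
Proof.
move=> hL hx hy sp /(multiple_expand hL sp) [m Hm] /(multiple_expand hL sp) [m' Hm'].
exact: (ci3_limit lin s4 hL hx hy Hm Hm' sp).
Qed.

Lemma spanned3_change L x y L' x' y' (p q r : K * K * K) : spanned3 L x y ->
  L = p.1.1 *: L' + p.1.2 *: x' + p.2 *: y' ->
  x = q.1.1 *: L' + q.1.2 *: x' + q.2 *: y' ->
  y = r.1.1 *: L' + r.1.2 *: x' + r.2 *: y' -> spanned3 L' x' y'.
Proof.
move=> sp EL Ex Ey M hM; have [m Hm] := sp M hM.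
exists (m.1.1 * p.1.1 + m.1.2 * q.1.1 + m.2 * r.1.1,
        m.1.1 * p.1.2 + m.1.2 * q.1.2 + m.2 * r.1.2,
        m.1.1 * p.2 + m.1.2 * q.2 + m.2 * r.2).
apply: cong_trans Hm _; rewrite /= EL Ex Ey.
by apply: cong_eq; rewrite -!mul_mpolyC; ring.
Qed.

Section Pairs.
Variables (L x y : S).
Hypotheses (hL : hg 1 L) (hx : hg 1 x) (hy : hg 1 y).
Hypotheses (dep : dep5 f 2 (s - 2)) (fr : free3 L x y).
Hypothesis inj : forall M, hg 1 M -> nul f (s - 2) (L * M) -> nul f (s - 1) M.

(** L A_1 has dimension three and A_2 at most four, so A_2 / L A_1 is at most a line. *)
Lemma multiple_pair u v : hg 2 u -> hg 2 v ->
  exists a b : K, (a != 0) || (b != 0) /\ multiple L (a *: u + b *: v).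
Proof.
move=> hu hv.
have [|c [k0 ck0] nc] := @dep (tnth [tuple L * L; L * x; L * y; u; v]).
  by case=> [[|[|[|[|[|?]]]]] ?] //=; rewrite (tnth_nth 0) /=; hom.
move: nc; rewrite !big_ord_recl big_ord0 !(tnth_nth 0) /= addr0.
set c0 := c _; set c1 := c _; set c2 := c _; set c3 := c _; set c4 := c _ => nc.
exists c3, c4; split; last first.
  exists (- (c0 *: L + c1 *: x + c2 *: y)); first by rewrite -scaleN1r; hom.
  apply/(congP lin); move: nc; congr (nul _ _ _); rewrite -!mul_mpolyC; ring.
rewrite -negb_and; apply/negP => /andP [/eqP c30 /eqP c40].
have [|c00 c10 c20] := @fr c0 c1 c2.
  apply: inj; first by hom.
  move: nc; congr (nul _ _ _); rewrite c30 c40 -!mul_mpolyC mpolyC0; ring.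
move/eqP: ck0; apply.
case: k0 => [[|[|[|[|[|?]]]]] k0] //.
- by rewrite -[RHS]c00; congr c; apply: val_inj.
- by rewrite -[RHS]c10; congr c; apply: val_inj.
- by rewrite -[RHS]c20; congr c; apply: val_inj.
- by rewrite -[RHS]c30; congr c; apply: val_inj.
- by rewrite -[RHS]c40; congr c; apply: val_inj.
Qed.
End Pairs.

(** By induction S_i y is spanned by y w^i; if f (y w^(s-1)) = 0, then f vanishes on the whole of
    S_(s-1) y. *)
Lemma line_annihilator y w : hg 1 y -> hg 1 w ->
  (forall M, hg 1 M -> exists c, cong f (s - 2) (y * M) (c *: (y * w))) ->
  f (y * w ^+ (s - 1)) = 0 -> nul f (s - 1) y.
Proof.
move=> hy hw sq fyw.
have H i z : hg i z -> (i < s)%N -> exists c, cong f (s - 1 - i) (y * z) (c *: (y * w ^+ i)).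
  elim: i z => [|i IH] z hz is1.
    exists z@_0; rewrite expr0 {1}(_ : z = z@_0 *: 1); last first.
      apply/mpolyP => m'; rewrite mcoeffZ mcoeff1.
      case: eqP => [->|/eqP]; rewrite ?mulr1 // mulr0 -mdeg_eq0 => nz.
      exact: dhomog_nemf_coeff hz nz.
    by rewrite -scalerAr mulr1.
  apply: (hgS_ind (P := fun z => exists c, cong f (s - 1 - i.+1) (y * z) (c *: (y * w ^+ i.+1))) _ _ _ hz).
  - by exists 0; rewrite mulr0 scale0r.
  - by move=> p q [c Hc] [d Hd]; exists (c + d); rewrite mulrDr scalerDl; apply: congD.
  - move=> M q hM hq; have [m Hm] := sq M hM; have [c Hc] := IH q hq (ltnW is1).
    exists (m * c); rewrite mulrA.
    apply: (@cong_trans _ _ _ _ _ (m *: (y * w) * q)).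
      by apply: (cong_mulr Hm hq); lia.
    rewrite (_ : m *: (y * w) * q = (m *: w) * (y * q)); last by rewrite -!mul_mpolyC; ring.
    rewrite (_ : (m * c) *: _ = (m *: w) * (c *: (y * w ^+ i))); last first.
      by rewrite exprS -!mul_mpolyC; ring.
    by apply: (cong_mull (d := 1) Hc); [hom | lia].
move=> z hz; have [|c Hc] := H _ z hz; first by lia.
have := Hc 1; rewrite subnn => /(_ (hg1 _ _)); rewrite !mulr1 => ->.
by rewrite (fZ lin) fyw mulr0.
Qed.

Lemma cong_comb3 j y p q r (a b c : K) : cong f j (y * p) 0 -> cong f j (y * q) 0 ->
  cong f j (y * (a *: p + b *: q + c *: r)) (c *: (y * r)).
Proof.
move=> yp yq z hz.
rewrite (_ : _ * z = a *: (y * p * z) + b *: (y * q * z) + c *: (y * r * z)); last first.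
  by rewrite -!mul_mpolyC; ring.
by rewrite !(fD lin) !(fZ lin) yp // yq // !mul0r (f0 lin) !mulr0 !add0r -scalerAl (fZ lin).
Qed.

Section Degenerate.
Variables (L x y : S) (k : K).
Hypotheses (hL : hg 1 L) (hx : hg 1 x) (hy : hg 1 y).
Hypotheses (dep : dep5 f 3 (s - 3)) (sp : spanned3 L x y) (fr : free3 L x y).
Hypotheses (xy : cong f (s - 2) (x * y) 0) (yy : cong f (s - 2) (y ^+ 2) (k *: (L * y))).

Lemma kill_mul u v z : hg 1 u -> hg 1 v -> cong f (s - 2) (u * v) 0 -> hg (s - 2) z ->
  f (u * v * z) = 0.
Proof. by move=> hu hv H hz; rewrite H // mul0r (f0 lin). Qed.

(** y kills both x and N = L - y / k, so that F is a power plus a binary form in N and x. Pairing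
    the cubic relation with y^(s-3) removes its y^3 term; the binary part then obeys a recurrence of
    order three. *)
Lemma split_limit : k != 0 -> limit_power_sum s 4 (fun a => f 'X_[a]).
Proof.
move=> k0; pose N := L - k^-1 *: y; have hN : hg 1 N by rewrite /N; hom.
have yN : cong f (s - 2) (y * N) 0.
  rewrite (_ : y * N = L * y - k^-1 *: y ^+ 2); last first.
    by rewrite /N -!mul_mpolyC; ring.
  apply: (@cong_trans _ _ _ _ _ (L * y - k^-1 *: (k *: (L * y)))).
    by apply: (congB lin) => //; apply: (congZ lin).
  by rewrite scalerA mulVf // scale1r subrr.
have spN : spanned3 N x y.
  apply: (spanned3_change (p := (1, 0, k^-1)) (q := (0, 1, 0)) (r := (0, 0, 1)) sp) => /=.
  - by rewrite /N -!mul_mpolyC; ring.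
  - by rewrite !scale0r scale1r addr0 add0r.
  - by rewrite !scale0r scale1r !add0r.
have yx : cong f (s - 2) (y * x) 0 by rewrite mulrC.
have fy : f (y ^+ s) != 0.
  apply/eqP => fy; suff H : nul f (s - 1) y.
    have [|_ _ /eqP] := @fr 0 0 1; last by rewrite oner_eq0.
    by rewrite !scale0r !add0r scale1r.
  apply: (line_annihilator hy hy); last by rewrite -exprS (_ : (s - 1).+1 = s) //; lia.
  move=> M hM; have [m Hm] := spN M hM; exists m.2.
  apply: (@cong_trans _ _ _ _ _ (y * (m.1.1 *: N + m.1.2 *: x + m.2 *: y))).
    by apply: (cong_mull Hm hy); lia.
  exact: cong_comb3.
have [|g [k1 gk1] rel] := @dep ( tnth [tuple N ^+ 3; N ^+ 2 * x; N * x ^+ 2; x ^+ 3; y ^+ 3]).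
  by case=> [[|[|[|[|[|?]]]]] ?] //=; rewrite (tnth_nth 0) /=; hom.
pose g' i := g (inord i).
have {}rel : nul f (s - 3) (\sum_(i < 4) g' i *: (N ^+ (3 - i) * x ^+ i) + g' 4 *: y ^+ 3).
  move: rel; rewrite big_ord_recr /= (tnth_nth 0) /= /g'.
  congr (nul _ _ (_ + g _ *: _)); last by apply: val_inj; rewrite /= inordK.
  apply: eq_bigr => i _; congr (g _ *: _).
    by apply: val_inj; rewrite /= inordK // ltnS ltnW.
  by rewrite (tnth_nth 0); case: i => [[|[|[|[|?]]]] ?] //=; rewrite ?expr0 ?mulr1 ?mul1r ?expr1.
have g4 : g' 4 = 0.
  have := rel (y ^+ (s - 3)); rewrite mulrDl (fD lin) mulr_suml (f_sum lin) big1 => [|i _].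
    rewrite add0r -scalerAl (fZ lin) -exprD (_ : 3 + (s - 3) = s)%N; last by lia.
    by move=> /(_ _)/eqP; rewrite mulf_eq0 (negPf fy) orbF => H; apply/eqP/H; hom.
  rewrite -scalerAl (fZ lin) (_ : s - 3 = (s - 4).+1)%N; last by lia.
  rewrite exprS; have [i3|i3] := eqVneq (i : nat) 3%N.
    rewrite i3 (_ : _ * (y * _) = y * x * (x ^+ 2 * y ^+ (s - 4))); last by rewrite subnn expr0; ring.
    by rewrite (kill_mul hy hx yx) ?mulr0 //; hom.
  have i3' : (i < 3)%N by have := ltn_ord i; lia.
  rewrite (_ : _ * (y * _) = y * N * (N ^+ (2 - i) * x ^+ i * y ^+ (s - 4))).
    by rewrite (kill_mul hy hN yN) ?mulr0 //; hom.
  by rewrite (_ : 3 - i = (2 - i).+1)%N ?exprS; [ring | lia].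
rewrite g4 scale0r addr0 in rel.
have [c Hc] := choice (fun i => spN _ (hgX K i)).
pose u i := (c i).1.1 *: N + (c i).1.2 *: x.
have hu i : hg 1 (u i) by rewrite /u; hom.
have Hu i : cong f (s - 2) (y * u i) 0.
  rewrite (_ : y * _ = (c i).1.1 *: (y * N) + (c i).1.2 *: (y * x)); last first.
    by rewrite /u -!mul_mpolyC; ring.
  rewrite -[X in cong _ _ _ X]addr0 -[X in cong _ _ _ (X + _)](scaler0 _ (c i).1.1).
  rewrite -[X in cong _ _ _ (_ + X)](scaler0 _ (c i).1.2).
  by apply: (congD lin); apply: (congZ lin).
have B := @binary_form_limit _ _ _ _ lin 2 N x (fun i => (c i).1.1) (fun i => (c i).1.2) g'
  hN hx (leq_trans (isT : 3 <= 4)%N s4) _ rel.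
apply: (eq_limit _ (limit_power_sum_add (f (y ^+ s)) (fun i => (c i).2) (B _))) => [a da|].
  rewrite (subst_linear da (v := fun i => u i + (c i).2 *: y)) //; last by move=> i; have := hu i => ?; hom.
  by rewrite (expand_split lin (fun i => (c i).2) hu hy _ da Hu) //; lia.
apply: contrapT => nex; move/eqP: gk1; apply.
have -> : g k1 = g' k1 by rewrite /g' inord_val.
have [k3|k3] := eqVneq (k1 : nat) 4%N; first by rewrite k3.
apply/eqP; apply: contraPT nex => gk; apply.
have k13 : (k1 < 4)%N by have := ltn_ord k1; lia.
by exists (Ordinal k13).
Qed.

(** y^2 = x y = 0 makes y a tangent direction along L. The cubic relation in L and x has a further
    term y L^2, whose coefficient is the correction b of [tangent_limit]. *)
Lemma tangent_case_limit : k = 0 -> limit_power_sum s 4 (fun a => f 'X_[a]).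
Proof.
move=> k0; have y2 : cong f (s - 2) (y ^+ 2) 0 by move: yy; rewrite k0 scale0r.
have yx : cong f (s - 2) (y * x) 0 by rewrite mulrC.
have yLN M : hg 1 M -> exists c, cong f (s - 2) (y * M) (c *: (y * L)).
  move=> hM; have [m Hm] := sp hM; exists m.1.1.
  apply: (@cong_trans _ _ _ _ _ (y * (m.1.2 *: x + m.2 *: y + m.1.1 *: L))).
    by apply: (cong_mull _ hy); [rewrite addrC addrA; exact: Hm | lia].
  by apply: cong_comb3 => //; rewrite -expr2.
have fy : f (y * L ^+ (s - 1)) != 0.
  apply/eqP => fy; have [|_ _ /eqP] := @fr 0 0 1; last by rewrite oner_eq0.
  by rewrite !scale0r !add0r scale1r; apply: (line_annihilator hy hL yLN fy).
have [|g [k1 gk1] rel] := @dep (tnth [tuple L ^+ 3; L ^+ 2 * x; L * x ^+ 2; x ^+ 3; y * L ^+ 2]).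
  by case=> [[|[|[|[|[|?]]]]] ?] //=; rewrite (tnth_nth 0) /=; hom.
pose g' i := g (inord i).
have {}rel : nul f (s - 3) (\sum_(i < 4) g' i *: (L ^+ (3 - i) * x ^+ i) + g' 4 *: (y * L ^+ 2)).
  move: rel; rewrite big_ord_recr /= (tnth_nth 0) /= /g'.
  congr (nul _ _ (_ + g _ *: _)); last by apply: val_inj; rewrite /= inordK.
  apply: eq_bigr => i _; congr (g _ *: _).
    by apply: val_inj; rewrite /= inordK // ltnS ltnW.
  by rewrite (tnth_nth 0); case: i => [[|[|[|[|?]]]] ?] //=; rewrite ?expr0 ?mulr1 ?mul1r ?expr1.
have yLs : f (y * L ^+ 2 * L ^+ (s - 3)) != 0.
  by rewrite -mulrA -exprD (_ : 2 + (s - 3) = s - 1)%N //; lia.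
have g0 : exists i : 'I_4, g' i != 0.
  apply: contrapT => nex.
  have g'0 (i : 'I_4) : g' i = 0.
    by apply/eqP; apply: contraPT nex => gi; apply; exists i.
  move: rel; rewrite big1 ?add0r => [|i _]; last by rewrite g'0 scale0r.
  have hz : hg (s - 3) (L ^+ (s - 3)) by hom.
  move=> /(_ _ hz); rewrite -scalerAl (fZ lin) => /eqP.
  rewrite mulf_eq0 (negPf yLs) orbF => /eqP g4.
  move/eqP: gk1; apply; have -> : g k1 = g' k1 by rewrite /g' inord_val.
  have [->//|k3] := eqVneq (k1 : nat) 4%N.
  have k13 : (k1 < 4)%N by have := ltn_ord k1; lia.
  exact: (g'0 (Ordinal k13)).
have [t [h top relE]] := binary_relation_shift L x g0.
rewrite {}relE in rel; set N := L - t *: x in rel.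
have hN : hg 1 N by rewrite /N; hom.
have LE : L = N + t *: x by rewrite /N subrK.
have yxz z : hg (s - 2) z -> f (y * x * z) = 0 by exact: kill_mul.
have yyz z : hg (s - 2) z -> f (y ^+ 2 * z) = 0 by move=> hz; rewrite y2 // mul0r (f0 lin).
have yNL i z : hg (s - 1 - i) z -> (i <= s - 1)%N -> f (y * N ^+ i * z) = f (y * L ^+ i * z).
  elim: i z => [|i IH] z hz is1; first by rewrite !expr0.
  rewrite [in LHS](_ : y * N ^+ i.+1 * z = y * N ^+ i * (L * z) - t *: (y * x * (N ^+ i * z))); last first.
    by rewrite exprS {1}/N -!mul_mpolyC; ring.
  rewrite (fB lin) (fZ lin) yxz; last by hom.
  rewrite mulr0 subr0 IH; [congr f; rewrite exprS; ring | hom | lia].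
pose C := f (y * N ^+ (s - 1)).
have spN : spanned3 N x y.
  apply: (spanned3_change (p := (1, t, 0)) (q := (0, 1, 0)) (r := (0, 0, 1)) sp) => /=.
  - by rewrite LE -!mul_mpolyC; ring.
  - by rewrite !scale0r scale1r addr0 add0r.
  - by rewrite !scale0r scale1r !add0r.
have [c Hc] := choice (fun i => spN _ (hgX K i)).
pose u i := (c i).1.1 *: N + (c i).1.2 *: x.
have hu i : hg 1 (u i) by rewrite /u; hom.
have Hu i : cong f (s - 2) (y * u i) ((c i).1.1 *: (N * y)).
  move=> z hz; rewrite (_ : _ * z = (c i).1.1 *: (N * y * z) + (c i).1.2 *: (y * x * z)); last first.
    by rewrite /u -!mul_mpolyC; ring.
  by rewrite (fD lin) !(fZ lin) yxz // mulr0 addr0 -scalerAl (fZ lin).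
pose w i := f (N ^+ (s - i) * x ^+ i).
have relz z : hg (s - 3) z -> \sum_(i < 4) h i * f (N ^+ (3 - i) * x ^+ i * z) +
    g' 4 * f (y * L ^+ 2 * z) = 0.
  move=> hz; rewrite -[RHS](rel z hz) mulrDl (fD lin) mulr_suml (f_sum lin).
  by rewrite -scalerAl (fZ lin); congr (_ + _); apply: eq_bigr => i _; rewrite -scalerAl (fZ lin).
(* Pairing with y N^(s-4) keeps only the N^3 term, because x y = y^2 = 0. *)
have h0 : h 0%N = 0.
  have hz : hg (s - 3) (y * N ^+ (s - 4)) by hom.
  have := relz _ hz; rewrite big_ord_recl big1 => [|i _]; last first.
    rewrite /= /bump /= (_ : _ * (y * _) = y * x * (N ^+ (3 - i.+1) * x ^+ i * N ^+ (s - 4))).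
      by rewrite yxz ?mulr0 //; have := ltn_ord i => ?; hom.
    by rewrite add1n exprS; ring.
  rewrite (_ : y * L ^+ 2 * _ = y ^+ 2 * (L ^+ 2 * N ^+ (s - 4))); last by ring.
  rewrite yyz; last by hom.
  rewrite mulr0 !addr0 subn0 expr0 mulr1 (_ : N ^+ 3 * _ = y * N ^+ (s - 1) * 1); last first.
    by rewrite (_ : s - 1 = 3 + (s - 4))%N ?exprD; [ring | lia].
  rewrite yNL //; [|by rewrite subnn; apply: hg1].
  by rewrite mulr1 => /eqP; rewrite mulf_eq0 (negPf fy) orbF => /eqP.
have T := @tangent_limit K n s w h (g' 4) C (fun i => (c i).1.1) (fun i => (c i).1.2)
  (fun i => (c i).2) top h0.
apply: (eq_limit _ (T _ _)) => [a da||i i1 is3].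
- rewrite (subst_linear da (v := fun i => u i + (c i).2 *: y)) //; last by move=> i; have := hu i => ?; hom.
  rewrite (expand_tangent lin (fun i => (c i).2) hu hy hN da Hu) //.
  by rewrite (binary_expand lin _ _ _ _ da).
- have hz : hg (s - 3) (N ^+ (s - 3)) by hom.
  have := relz _ hz; rewrite !big_ord_recl big_ord0 /= /bump /= !(addSn, add0n) h0 mul0r add0r addr0.
  rewrite !addrA /w /C => <-; congr (_ * f _ + _ * f _ + _ * f _ + _ * _).
  + by rewrite (_ : s - 1 = 2 + (s - 3))%N ?exprD; [ring | lia].
  + by rewrite (_ : s - 2 = 1 + (s - 3))%N ?exprD; [ring | lia].
  + by rewrite subnn expr0; ring.
  + rewrite -(yNL 2%N); [|by rewrite (_ : s - 1 - 2 = s - 3)%N //; lia|by lia].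
    by congr f; rewrite -mulrA -exprD (_ : 2 + (s - 3) = s - 1)%N //; lia.
- have hz : hg (s - 3) (N ^+ (s - 3 - i) * x ^+ i) by hom.
  have := relz _ hz; rewrite !big_ord_recl big_ord0 /= /bump /= !(addSn, add0n) h0 mul0r add0r addr0.
  rewrite (_ : y * L ^+ 2 * _ = y * x * (L ^+ 2 * N ^+ (s - 3 - i) * x ^+ (i - 1))); last first.
    have -> : x ^+ i = x * x ^+ (i - 1) by rewrite -exprS (_ : (i - 1).+1 = i) //; lia.
    by ring.
  rewrite yxz; last by hom.
  rewrite mulr0 addr0 addrA /w => <-; congr (_ * f _ + _ * f _ + _ * f _).
  + by rewrite (_ : s - (i + 1) = 2 + (s - 3 - i))%N ?exprD; [ring | lia].
  + by rewrite (_ : s - (i + 2) = 1 + (s - 3 - i))%N ?exprD; [ring | lia].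
  + by rewrite (_ : s - (i + 3) = s - 3 - i)%N ?exprD; [ring | lia].
Qed.

End Degenerate.

Lemma sqrt_ex (c : K) : exists d : K, d ^+ 2 = c.
Proof. by exists (sqrtC c); rewrite sqrtCK. Qed.

(* Here the two conics A_2 kills meet on every line: unless they share a
   component, moving the line L to L - t x separates the two points. *)
Lemma rank_one_limit L x y : hg 1 L -> hg 1 x -> hg 1 y ->
  dep5 f 3 (s - 3) -> spanned3 L x y -> free3 L x y ->
  multiple L (x * y) -> multiple L (y ^+ 2) -> limit_power_sum s 4 (fun a => f 'X_[a]).
Proof.
move=> hL hx0 hy0 dep sp0 fr0 /(multiple_expand hL sp0) [[[a0 a1] a2] /= Hxy] my2.
(* Completing the product x y, so that X Y = k L^2. *)
pose X := x - a2 *: L; pose Y := y - a1 *: L; pose k := a0 + a1 * a2.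
have hX : hg 1 X by rewrite /X; hom.
have hY : hg 1 Y by rewrite /Y; hom.
have sp : spanned3 L X Y.
  apply: (spanned3_change (p := (1, 0, 0)) (q := (a2, 1, 0)) (r := (a1, 0, 1)) sp0) => /=;
    by rewrite /X /Y -!mul_mpolyC; ring.
have fr : free3 L X Y.
  move=> p q r; have -> : p *: L + q *: X + r *: Y = (p - q * a2 - r * a1) *: L + q *: x + r *: y.
    by rewrite /X /Y -!mul_mpolyC; ring.
  by case/fr0 => e1 q0 r0; move: e1; rewrite q0 r0 !mul0r !subr0.
have XY : cong f (s - 2) (X * Y) (k *: L ^+ 2).
  rewrite (_ : X * Y = x * y - L * (a1 *: x + a2 *: y - (a1 * a2) *: L)); last first.
    by rewrite /X /Y -!mul_mpolyC; ring.
  rewrite (_ : k *: L ^+ 2 = L * (a0 *: L + a1 *: x + a2 *: y) -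
     L * (a1 *: x + a2 *: y - (a1 * a2) *: L)); last first.
    by rewrite /k -!mul_mpolyC; ring.
  exact: congB.
have : multiple L (Y ^+ 2).
  apply: (@eq_multiple _ _ (y ^+ 2 + L * (a1 ^+ 2 *: L - (2 * a1) *: y))).
    by rewrite /Y -!mul_mpolyC; ring.
  by apply: multipleD => //; apply: multiple_mul; hom.
move=> /(multiple_expand hL sp) [[[b0 b1] b2] /= HY].
clearbody X Y k; clear x y hx0 hy0 sp0 fr0 my2 Hxy a0 a1 a2.
(* Put L = t X, that is, work modulo N = L - t X, and let B = Y - k t^2 X: the relations become X B
   = 0 and B^2 = - D(t) X^2. With d^2 = D(t), the squares of B + d X and B - d X are then multiples
   of N, and d <> 0 keeps them independent. *)
pose D t := k ^+ 2 * t ^+ 4 - b2 * k * t ^+ 3 - b0 * t ^+ 2 - b1 * t.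
have [[t Dt]|D0] := EM (exists t, D t != 0).
  have [d d2] := sqrt_ex (D t); pose N := L - t *: X; pose B := Y - (k * t ^+ 2) *: X.
  have d0 : d != 0 by move: Dt; rewrite -d2 expf_eq0.
  have hN : hg 1 N by rewrite /N; hom.
  have hB : hg 1 B by rewrite /B; hom.
  have mXB : multiple N (X * B).
    exists (k *: (L + t *: X)); first by hom.
    rewrite (_ : X * B = X * Y - (k * t ^+ 2) *: X ^+ 2); last by rewrite /B -!mul_mpolyC; ring.
    rewrite (_ : N * _ = k *: L ^+ 2 - (k * t ^+ 2) *: X ^+ 2); last by rewrite /N -!mul_mpolyC; ring.
    exact: (congB lin).
  have mBB : multiple N (B ^+ 2 + D t *: X ^+ 2).
    pose e := b0 + b2 * t * k - 2 * k ^+ 2 * t ^+ 2.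
    exists (e *: (L + t *: X) + b1 *: X + b2 *: Y); first by hom.
    rewrite (_ : B ^+ 2 + _ = (Y ^+ 2 - (2 * k * t ^+ 2) *: (X * Y)) +
      (k ^+ 2 * t ^+ 4 + D t) *: X ^+ 2 +
      ((b2 * t) *: (X * Y) - (b2 * t) *: (X * Y))); last by rewrite /B -!mul_mpolyC; ring.
    rewrite (_ : N * _ = (L * (b0 *: L + b1 *: X + b2 *: Y) - (2 * k * t ^+ 2) *: (k *: L ^+ 2)) +
      (k ^+ 2 * t ^+ 4 + D t) *: X ^+ 2 + ((b2 * t) *: (k *: L ^+ 2) - (b2 * t) *: (X * Y))); last first.
      by rewrite /N /e /D -!mul_mpolyC; ring.
    apply: (congD lin); last by apply: (congB lin) => //; apply: (congZ lin).
    by apply: (congD lin) => //; apply: (congB lin) => //; apply: (congZ lin).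
  apply: (@ci3_multiple N (B + d *: X) (B - d *: X)); [by [] | by hom | by hom | | |].
  - have [r rd] : exists r, r * (2 * d) = 1.
      by exists (2 * d)^-1; rewrite mulVf // mulf_neq0 // pnatr_eq0.
    have [v v2] : exists v : K, v * 2 = 1 by exists 2^-1; rewrite mulVf // pnatr_eq0.
    apply: (spanned3_change (p := (1, t * r, - (t * r))) (q := (0, r, - r))
      (r := (0, v + k * t ^+ 2 * r, v - k * t ^+ 2 * r)) sp) => /=.
    + rewrite [RHS](_ : _ = N + (t * (r * (2 * d))) *: X); last by rewrite -!mul_mpolyC; ring.
      by rewrite rd mulr1 /N subrK.
    + rewrite [RHS](_ : _ = (r * (2 * d)) *: X); last by rewrite -!mul_mpolyC; ring.
      by rewrite rd scale1r.
    + rewrite [RHS](_ : _ = (v * 2) *: B + (k * t ^+ 2 * (r * (2 * d))) *: X); last first.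
        by rewrite -!mul_mpolyC; ring.
      by rewrite rd v2 scale1r mulr1 /B subrK.
  - apply: (@eq_multiple _ _ (B ^+ 2 + D t *: X ^+ 2 + (2 * d) *: (X * B))).
      by rewrite -d2 -!mul_mpolyC; ring.
    by apply: multipleD => //; apply: multipleZ.
  - apply: (@eq_multiple _ _ (B ^+ 2 + D t *: X ^+ 2 + (- (2 * d)) *: (X * B))).
      by rewrite -d2 -!mul_mpolyC; ring.
    by apply: multipleD => //; apply: multipleZ.
(* If D vanishes identically, then k = b0 = b1 = 0: the degenerate relations X Y = 0 and Y^2 = b2 L
   Y. *)
have P0 : k ^+ 2 *: 'X^4 - (b2 * k) *: 'X^3 - b0 *: 'X^2 - b1 *: 'X = 0 :> {poly K}.
  apply: poly_eq0_horner => t; apply/eqP; apply: contraPT D0 => H; apply; exists t.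
  by move: H; rewrite !(hornerD, hornerN, hornerZ, hornerXn, hornerX).
have co i := congr1 (fun q : {poly K} => q`_i) P0.
have := co 4%N; rewrite !(coefD, coefN, coefZ, coefXn, coefX) coef0 /= !mulr0 !subr0 mulr1 => /eqP.
rewrite expf_eq0 /= => /eqP k0.
have := co 2%N; rewrite !(coefD, coefN, coefZ, coefXn, coefX) coef0 /= !mulr0 !subr0 sub0r mulr1 => /eqP.
rewrite oppr_eq0 => /eqP b00.
have := co 1%N; rewrite !(coefD, coefN, coefZ, coefXn, coefX) coef0 /= !mulr0 !subr0 sub0r mulr1 => /eqP.
rewrite oppr_eq0 => /eqP b10.
have XY0 : cong f (s - 2) (X * Y) 0 by move: XY; rewrite k0 scale0r.
have YY : cong f (s - 2) (Y ^+ 2) (b2 *: (L * Y)).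
  apply: cong_trans HY _; apply: cong_eq.
  by rewrite b00 b10 -!mul_mpolyC mpolyC0; ring.
have [b20|b20] := eqVneq b2 0.
  exact: (tangent_case_limit hL hX hY dep sp fr XY0 YY b20).
exact: (split_limit hL hX hY dep sp fr XY0 YY b20).
Qed.

(** Squaring modulo L A_1 is a quadratic form on the plane of x and y, with values in at most a
    line, so it has a zero Y. A relation a X^2 + b X Y in L A_1 then puts X Y in L A_1 if a = 0, and
    otherwise becomes a second square. *)
Lemma three_variables_limit L x y : hg 1 L -> hg 1 x -> hg 1 y ->
  dep5 f 2 (s - 2) -> dep5 f 3 (s - 3) -> spanned3 L x y -> free3 L x y ->
  (forall M, hg 1 M -> nul f (s - 2) (L * M) -> nul f (s - 1) M) ->
  limit_power_sum s 4 (fun a => f 'X_[a]).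
Proof.
move=> hL hx hy dep2 dep3 sp fr inj.
suff H X Y : hg 1 X -> hg 1 Y -> spanned3 L X Y -> free3 L X Y -> multiple L (Y ^+ 2) ->
    limit_power_sum s 4 (fun a => f 'X_[a]).
  have [my|nmy] := EM (multiple L (y ^+ 2)); first exact: (H x y).
  have two u : hg 2 u -> exists c, multiple L (u - c *: y ^+ 2).
    move=> hu; have hy2 : hg 2 (y ^+ 2) by hom.
    have [a [b [ab mab]]] := multiple_pair hL hx hy dep2 fr inj hu hy2.
    have [a0|a0] := eqVneq a 0.
      case: nmy; move: ab mab; rewrite a0 eqxx /= scale0r add0r => b0 mb.
      apply: (eq_multiple _ (multipleZ b^-1 mb)).
      by rewrite scalerA mulVf // scale1r.
    exists (- (b / a)); apply: (eq_multiple _ (multipleZ a^-1 mab)).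
    by rewrite scalerDr !scalerA mulVf // scale1r scaleNr opprK mulrC.
  have [k mk] := two (x ^+ 2) ltac:(hom); have [e me] := two (x * y) ltac:(hom).
  (* A root of t^2 + 2 e t + k, the class of (x + t y)^2 relative to y^2. *)
  have [d d2] := sqrt_ex (e ^+ 2 - k); pose t := d - e.
  apply: (H y (x + t *: y)) => //; first by hom.
  - apply: (spanned3_change (p := (1, 0, 0)) (q := (0, - t, 1)) (r := (0, 1, 0)) sp) => /=;
      by rewrite -!mul_mpolyC; ring.
  - move=> p q r; have -> : p *: L + q *: y + r *: (x + t *: y) = p *: L + r *: x + (q + r * t) *: y.
      by rewrite -!mul_mpolyC; ring.
    by case/fr => -> -> ; rewrite mul0r addr0.
  apply: (@eq_multiple _ _ ((x ^+ 2 - k *: y ^+ 2) + (2 * t) *: (x * y - e *: y ^+ 2))).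
    have kE : k = e ^+ 2 - d ^+ 2 by rewrite d2; ring.
    by rewrite kE /t -!mul_mpolyC; ring.
  by apply: multipleD => //; apply: multipleZ.
move=> hX hY spX frX mY.
have hX2 : hg 2 (X ^+ 2) by hom.
have hXY : hg 2 (X * Y) by hom.
have [a [b [ab mab]]] := multiple_pair hL hX hY dep2 frX inj hX2 hXY.
have [a0|a0] := eqVneq a 0.
  move: ab mab; rewrite a0 eqxx /= scale0r add0r => b0 mb.
  apply: (rank_one_limit hL hX hY dep3 spX frX _ mY).
  apply: (eq_multiple _ (multipleZ b^-1 mb)).
  by rewrite scalerA mulVf // scale1r.
pose t := b / a / 2; have tE : 2 * t = b / a by rewrite /t mulrC divfK // pnatr_eq0.
apply: (@ci3_multiple L (X + t *: Y) Y) => //; first by hom.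
  apply: (spanned3_change (p := (1, 0, 0)) (q := (0, 1, - t)) (r := (0, 0, 1)) spX) => /=;
    by rewrite -!mul_mpolyC; ring.
apply: (@eq_multiple _ _ (a^-1 *: (a *: X ^+ 2 + b *: (X * Y)) + t ^+ 2 *: Y ^+ 2)).
  rewrite scalerDr !scalerA mulVf // scale1r [a^-1 * b]mulrC -tE -!mul_mpolyC; ring.
by apply: multipleD => //; apply: multipleZ.
Qed.

End ThreeVariables.

(** * Four variables *)

Section FourVariables.
Variables (K : numClosedFieldType) (n s : nat).
Local Notation S := {mpoly K[n.+1]}.
Implicit Types (p q u v w x y z L M N : S).
Variable f : S -> K.
Hypothesis lin : functional f.
Hypothesis s4 : (4 <= s)%N.

Definition basis4 L x y z :=
  (forall M, hg 1 M -> exists m : K * K * K * K,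
    cong f (s - 1) M (m.1.1.1 *: L + m.1.1.2 *: x + m.1.2 *: y + m.2 *: z)) /\
  (forall a b c d : K, nul f (s - 1) (a *: L + b *: x + c *: y + d *: z) ->
    [/\ a = 0, b = 0, c = 0 & d = 0]).

Lemma basis4_swap_xy L x y z : basis4 L x y z -> basis4 L y x z.
Proof.
move=> [sp fr]; split=> [M /sp [m Hm]|a b c d].
  by exists (m.1.1.1, m.1.2, m.1.1.2, m.2); rewrite /= [X in X + _]addrAC.
by rewrite [X in X + _]addrAC => /fr [].
Qed.

Lemma basis4_swap_yz L x y z : basis4 L x y z -> basis4 L x z y.
Proof.
move=> [sp fr]; split=> [M /sp [m Hm]|a b c d].
  by exists (m.1.1.1, m.1.1.2, m.2, m.1.2); rewrite /= addrAC.
by rewrite addrAC => /fr [].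
Qed.

Lemma basis4_shear L x y z t : basis4 L x y z -> basis4 L (x + t *: y) y z.
Proof.
move=> [sp fr]; split=> [M /sp [m Hm]|a b c d H].
  exists (m.1.1.1, m.1.1.2, m.1.2 - t * m.1.1.2, m.2); apply: cong_trans Hm _.
  by apply: cong_eq; rewrite /= -!mul_mpolyC; ring.
have [|-> b0 c0 ->] := fr a b (c + t * b) d.
  by move: H; congr (nul _ _ _); rewrite -!mul_mpolyC; ring.
by split=> //; move: c0; rewrite b0 mulr0 addr0.
Qed.

Section Quadric.
Variables L : S.
Hypothesis hL : hg 1 L.
Hypothesis mult : forall u, hg 2 u -> multiple s f L u.

Lemma degree_reduction j z : (j < s)%N -> hg j.+1 z ->
  exists2 v, hg 1 v & cong f (s - j.+1) z (L ^+ j * v).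
Proof.
elim: j z => [|j IH] z js hz; first by exists z; rewrite // expr0 mul1r.
apply: (hgS_ind (P := fun z => exists2 v, hg 1 v & cong f (s - j.+2) z (L ^+ j.+1 * v)) _ _ _ hz).
- by exists 0; rewrite ?mulr0 //; apply: hg0.
- move=> p q [u hu pu] [v hv qv]; exists (u + v); first by hom.
  by rewrite mulrDr; apply: congD.
move=> M q hM hq; have [v hv qv] := IH q (ltnW js) hq.
have [|l hl Hl] := mult (u := M * v); first by hom.
exists l => //; apply: (@cong_trans _ _ _ _ _ (M * (L ^+ j * v))).
  by apply: (cong_mull qv hM); lia.
rewrite (_ : M * _ = L ^+ j * (M * v)); last by ring.
rewrite (_ : L ^+ j.+1 * l = L ^+ j * (L * l)); last by rewrite exprS; ring.
by apply: (cong_mull (d := j) Hl); [hom | lia].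
Qed.

(** Every class of degree s - 1 is L^(s-2) v for a linear v, because A_2 = L A_1. *)
Lemma quadric_nondegenerate u : hg 1 u ->
  (forall v, hg 1 v -> f (L ^+ (s - 2) * u * v) = 0) -> nul f (s - 1) u.
Proof.
move=> hu H z hz.
have [| |v hv zv] := @degree_reduction (s - 2) z; [by lia | by rewrite (_ : _.+1 = s - 1)%N //; lia |].
rewrite (_ : s - (s - 2).+1 = 1)%N in zv; last by lia.
rewrite mulrC zv; first by rewrite -[RHS](H v hv); congr f; ring.
by hom.
Qed.

Lemma mul_inj2 u : hg 2 u -> nul f (s - 3) (L * u) -> nul f (s - 2) u.
Proof.
move=> hu H z hz.
have [| |v hv zv] := @degree_reduction (s - 3) z; [by lia | by rewrite (_ : _.+1 = s - 2)%N //; lia |].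
rewrite (_ : s - (s - 3).+1 = 2)%N in zv; last by lia.
rewrite mulrC zv; last by hom.
rewrite -[RHS](H (L ^+ (s - 4) * v)); last by hom.
by congr f; rewrite (_ : s - 3 = (s - 4).+1)%N ?exprS; [ring | lia].
Qed.

Section Orthogonal.
Variables (w : S).
Hypothesis hw : hg 1 w.
Hypothesis wL : f (L ^+ (s - 2) * w * L) = 0.
Hypothesis nondeg : forall u, hg 1 u ->
  (forall v, hg 1 v -> f (L ^+ (s - 3) * w * u * v) = 0) -> nul f (s - 1) u.

(** For b(u, v) = f (L^(s-3) w u v), the vector L is isotropic with orthogonal spanned by L, x, y.
    Nondegeneracy gives b(x, y) <> 0, and y can be corrected to an isotropic y1. Since b(L, x^2 / L)
    = b(x, x) = 0, and likewise for y1, these squares divided by L have no z component, whereas x y1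
    / L has one and replaces z. *)
Lemma isotropic_limit x y z : hg 1 x -> hg 1 y -> hg 1 z -> basis4 L x y z ->
  f (L ^+ (s - 2) * w * x) = 0 -> f (L ^+ (s - 2) * w * y) = 0 ->
  f (L ^+ (s - 3) * w * x * x) = 0 -> limit_power_sum s 4 (fun a => f 'X_[a]).
Proof.
move=> hx hy hz bs wx wy xx.
have span_ext u : hg 1 u -> forall (g : S -> K), functional g ->
  (forall p q, hg 1 p -> hg 1 q -> cong f (s - 1) p q -> g p = g q) ->
  g L = 0 -> g x = 0 -> g y = 0 -> g z = 0 -> g u = 0.
  move=> hu g gl gc gL gx gy gz; have [m Hm] := bs.1 u hu.
  rewrite (gc _ _ hu _ Hm); last by hom.
  by rewrite !(fD gl) !(fZ gl) gL gx gy gz !mulr0 !addr0.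
have Bc u : hg 1 u -> forall p q, hg 1 p -> hg 1 q -> cong f (s - 1) p q ->
    f (L ^+ (s - 3) * w * u * p) = f (L ^+ (s - 3) * w * u * q).
  by move=> hu p q hp hq pq; rewrite ![_ * u * _]mulrC; apply: pq; hom.
have Cc p q : cong f (s - 1) p q -> f (L ^+ (s - 2) * w * p) = f (L ^+ (s - 2) * w * q).
  by move=> pq; rewrite ![_ * w * _]mulrC; apply: pq; hom.
have LB u : f (L ^+ (s - 3) * w * L * u) = f (L ^+ (s - 2) * w * u).
  by congr f; rewrite (_ : s - 2 = (s - 3).+1)%N ?exprS; [ring | lia].
have nul_b u : hg 1 u -> f (L ^+ (s - 3) * w * u * L) = 0 -> f (L ^+ (s - 3) * w * u * x) = 0 ->
    f (L ^+ (s - 3) * w * u * y) = 0 -> f (L ^+ (s - 3) * w * u * z) = 0 -> nul f (s - 1) u.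
  move=> hu uL ux uy uz; apply: nondeg => // v hv.
  apply: (span_ext v hv (fun v => f (L ^+ (s - 3) * w * u * v))) => //; last exact: Bc.
  exact: functional_mulr.
have wz : f (L ^+ (s - 2) * w * z) != 0.
  apply/eqP => wz; have [|/eqP] := bs.2 1 0 0 0; last by rewrite oner_eq0.
  by rewrite !scale0r !addr0 scale1r; apply: nul_b; rewrite ?LB.
have xy : f (L ^+ (s - 3) * w * x * y) != 0.
  apply/eqP => xy; pose c := f (L ^+ (s - 3) * w * x * z) / f (L ^+ (s - 2) * w * z).
  have [|_ /eqP] := bs.2 (- c) 1 0 0; last by rewrite oner_eq0.
  rewrite !scale0r !addr0 scale1r.
  have E u : f (L ^+ (s - 3) * w * (- c *: L + x) * u) = f (L ^+ (s - 3) * w * x * u) -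
      c * f (L ^+ (s - 2) * w * u).
    rewrite -LB -(fZ lin) -(fB lin); congr f; rewrite -!mul_mpolyC; ring.
  apply: nul_b; rewrite ?E; first by hom.
  - by rewrite wL mulr0 subr0 -[RHS]wx -LB; congr f; ring.
  - by rewrite xx wx mulr0 subr0.
  - by rewrite xy wy mulr0 subr0.
  - by rewrite /c divfK // subrr.
pose t := f (L ^+ (s - 3) * w * y * y) / f (L ^+ (s - 3) * w * x * y) / 2.
pose y1 := y + (- t) *: x; have hy1 : hg 1 y1 by rewrite /y1; hom.
have {bs} bs : basis4 L x y1 z by apply/basis4_swap_xy/basis4_shear/basis4_swap_xy.
have wy1 : f (L ^+ (s - 2) * w * y1) = 0.
  by rewrite /y1 mulrDr (fD lin) (fZr lin) wx wy mulr0 addr0.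
have xy1 : f (L ^+ (s - 3) * w * x * y1) != 0.
  by rewrite /y1 mulrDr (fD lin) (fZr lin) xx mulr0 addr0.
have yy1 : f (L ^+ (s - 3) * w * y1 * y1) = 0.
  rewrite (_ : _ * _ = L ^+ (s - 3) * w * y * y - (2 * t) *: (L ^+ (s - 3) * w * x * y) +
    t ^+ 2 *: (L ^+ (s - 3) * w * x * x)); last by rewrite /y1 -!mul_mpolyC; ring.
  rewrite (fD lin) (fB lin) !(fZ lin) xx mulr0 addr0.
  by rewrite (mulrC 2) /t !divfK ?pnatr_eq0 // subrr.
clearbody y1 t; clear y hy wy xy t span_ext nul_b Bc.
have expand u l : hg 1 l -> cong f (s - 2) u (L * l) -> exists m : K * K * K * K,
    let e := m.1.1.1 *: L + m.1.1.2 *: x + m.1.2 *: y1 + m.2 *: z in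
    [/\ cong f (s - 1) l e, cong f (s - 2) u (L * e) &
        m.2 * f (L ^+ (s - 2) * w * z) = f (L ^+ (s - 3) * w * u)].
  move=> hl ul; have [m Hm] := bs.1 l hl; exists m; split=> //.
    by apply: cong_trans ul _; apply: (cong_mull Hm hL); lia.
  have -> : f (L ^+ (s - 3) * w * u) = f (L ^+ (s - 2) * w * l).
    rewrite mulrC ul; last by hom.
    by congr f; rewrite (_ : s - 2 = (s - 3).+1)%N ?exprS; [ring | lia].
  by rewrite (Cc _ _ Hm) !mulrDr !(fD lin) !(fZr lin) wx wy1 wL ?mulr0 ?add0r.
have square v : hg 1 v -> f (L ^+ (s - 3) * w * v * v) = 0 -> exists a b c : K,
    cong f (s - 2) (v ^+ 2) (L * (a *: L + b *: x + c *: y1)).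
  move=> hv vv; have [|l hl ul] := mult (u := v ^+ 2); first by hom.
  have [m [_ Hm mE]] := expand _ _ hl ul; exists m.1.1.1, m.1.1.2, m.1.2.
  suff m0 : m.2 = 0 by move: Hm; rewrite m0 scale0r addr0.
  by move: mE; rewrite expr2 mulrA vv => /eqP; rewrite mulf_eq0 (negPf wz) orbF => /eqP.
have [a0 [a1 [a2 x2]]] := square x hx xx.
have [b0 [b1 [b2 y2]]] := square y1 hy1 yy1.
have [|z1 hz1 xyz] := mult (u := x * y1); first by hom.
have [m [Hm _ mE]] := expand _ _ hz1 xyz.
have m0 : m.2 != 0 by apply: contraNneq xy1 => m0; rewrite -mulrA -mE m0 mul0r.
apply: (ci4_limit lin s4 hL hx hy1 x2 y2 hz1 (cong_sym xyz) mul_inj2) => M hM.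
have [c Hc] := bs.1 M hM; pose r := c.2 / m.2.
exists (c.1.1.1 - r * m.1.1.1, c.1.1.2 - r * m.1.1.2, c.1.2 - r * m.1.2, r) => /=.
apply: cong_trans Hc _.
rewrite (_ : _ + _ = (c.1.1.1 *: L + c.1.1.2 *: x + c.1.2 *: y1 + c.2 *: z -
  r *: (m.1.1.1 *: L + m.1.1.2 *: x + m.1.2 *: y1 + m.2 *: z)) +
  r *: (m.1.1.1 *: L + m.1.1.2 *: x + m.1.2 *: y1 + m.2 *: z)); last by rewrite subrK.
rewrite [X in cong _ _ _ X](_ : _ = (c.1.1.1 *: L + c.1.1.2 *: x + c.1.2 *: y1 + (r * m.2) *: z -
  r *: (m.1.1.1 *: L + m.1.1.2 *: x + m.1.2 *: y1 + m.2 *: z)) + r *: z1); last first.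
  by rewrite -!mul_mpolyC; ring.
rewrite /r divfK //; apply: (congD lin) => //; apply: (congZ lin); exact: cong_sym.
Qed.

(** K has square roots, so the plane of x and y contains an isotropic vector; unless it is x, it is
    taken of the form y + r x. *)
Lemma orthogonal_limit x y z : hg 1 x -> hg 1 y -> hg 1 z -> basis4 L x y z ->
  f (L ^+ (s - 2) * w * x) = 0 -> f (L ^+ (s - 2) * w * y) = 0 ->
  limit_power_sum s 4 (fun a => f 'X_[a]).
Proof.
move=> hx hy hz bs wx wy; pose b u v := f (L ^+ (s - 3) * w * u * v).
have [xx|xx] := eqVneq (b x x) 0; first exact: (isotropic_limit hx hy hz).
have [d d2] := sqrt_ex (b x y ^+ 2 - b x x * b y y); pose r := (d - b x y) / b x x.
apply: (isotropic_limit (x := y + r *: x) (y := x) (z := z)) => //.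
- by hom.
- exact/basis4_shear/basis4_swap_xy.
- by rewrite mulrDr (fD lin) (fZr lin) wx wy mulr0 addr0.
rewrite (_ : _ * _ = L ^+ (s - 3) * w * y * y + (2 * r) *: (L ^+ (s - 3) * w * x * y) +
    r ^+ 2 *: (L ^+ (s - 3) * w * x * x)); last by rewrite -!mul_mpolyC; ring.
rewrite !(fD lin) !(fZ lin) -!/(b _ _); apply: (mulfI xx).
have E : b x x * r = d - b x y by rewrite mulrC /r divfK.
have -> : b x x * (b y y + 2 * r * b x y + r ^+ 2 * b x x) =
    b x x * b y y + 2 * b x y * (b x x * r) + (b x x * r) ^+ 2 by ring.
by rewrite E (_ : b x x * b y y = b x y ^+ 2 - d ^+ 2); [ring | rewrite d2; ring].
Qed.

(** If one basis vector t has f (L^(s-2) w t) <> 0, multiples of it are added to the other two to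
    make this value vanish for them. *)
Lemma nondegenerate_limit x y z : hg 1 x -> hg 1 y -> hg 1 z -> basis4 L x y z ->
  limit_power_sum s 4 (fun a => f 'X_[a]).
Proof.
have H u v t : hg 1 u -> hg 1 v -> hg 1 t -> basis4 L u v t ->
    f (L ^+ (s - 2) * w * t) != 0 -> limit_power_sum s 4 (fun a => f 'X_[a]).
  move=> hu hv ht bs wt; pose c m := - (f (L ^+ (s - 2) * w * m) / f (L ^+ (s - 2) * w * t)).
  have wc m : f (L ^+ (s - 2) * w * (m + c m *: t)) = 0.
    by rewrite mulrDr (fD lin) (fZr lin) mulNr divfK // subrr.
  apply: (orthogonal_limit (x := u + c u *: t) (y := v + c v *: t) (z := t)) => //; try by hom.
  apply/basis4_swap_yz/basis4_shear/basis4_swap_yz/basis4_swap_xy.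
  exact/basis4_swap_yz/basis4_shear/basis4_swap_yz/basis4_swap_xy.
move=> hx hy hz bs; have [wx|wx] := eqVneq (f (L ^+ (s - 2) * w * x)) 0; last first.
  exact/(H y z x)/wx/basis4_swap_yz/basis4_swap_xy.
have [wy|wy] := eqVneq (f (L ^+ (s - 2) * w * y)) 0; last first.
  exact/(H x z y)/wy/basis4_swap_yz.
exact: (orthogonal_limit hx hy hz).
Qed.

End Orthogonal.

(** The quadratic form f (L^(s-2) u v) is nondegenerate, so x has a partner v orthogonal to L; one
    of x, v, x + v is not isotropic. *)
Lemma nonorthogonal_kernel x : hg 1 x -> ~ nul f (s - 1) x -> f (L ^+ s) != 0 ->
  f (L ^+ (s - 1) * x) = 0 ->
  exists2 w, hg 1 w /\ f (L ^+ (s - 1) * w) = 0 & f (L ^+ (s - 2) * w * w) != 0.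
Proof.
move=> hx nx Ls Lx; have [u [hu xu]] : exists u, hg 1 u /\ f (L ^+ (s - 2) * x * u) != 0.
  apply: contrapT => H; apply: nx; apply: quadric_nondegenerate => // v hv.
  by apply/eqP; apply: contraT => nz; case: H; exists v.
have E1 v : f (L ^+ (s - 2) * v * L) = f (L ^+ (s - 1) * v).
  by congr f; rewrite (_ : s - 1 = (s - 2).+1)%N ?exprS; [ring | lia].
have Es : f (L ^+ (s - 1) * L) = f (L ^+ s).
  by rewrite mulrC -exprS (_ : (s - 1).+1 = s) //; lia.
pose v := u - (f (L ^+ (s - 1) * u) / f (L ^+ s)) *: L.
have hv : hg 1 v by rewrite /v; hom.
have Lv : f (L ^+ (s - 1) * v) = 0.
  by rewrite /v mulrBr (fB lin) (fZr lin) Es divfK // subrr.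
have xv : f (L ^+ (s - 2) * x * v) != 0.
  by rewrite /v mulrBr (fB lin) (fZr lin) E1 Lx mulr0 subr0.
have [xx|xx] := eqVneq (f (L ^+ (s - 2) * x * x)) 0; last by exists x.
have [vv|vv] := eqVneq (f (L ^+ (s - 2) * v * v)) 0; last by exists v.
exists (x + v); first by split; [hom | rewrite mulrDr (fD lin) Lx Lv addr0].
rewrite (_ : _ * _ = L ^+ (s - 2) * x * x + (2 : K) *: (L ^+ (s - 2) * x * v) +
  L ^+ (s - 2) * v * v); last by rewrite -!mul_mpolyC; ring.
by rewrite !(fD lin) (fZ lin) xx vv addr0 add0r mulf_neq0 ?pnatr_eq0.
Qed.

(* Injectivity of w - b L for b outside the spectrum of the multiplication by w / L. *)
Lemma spectrum_mul w x y z : hg 1 w -> hg 1 x -> hg 1 y -> hg 1 z -> basis4 L x y z ->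
  (forall M, hg 1 M -> nul f (s - 2) (L * M) -> nul f (s - 1) M) ->
  exists A : 'M[K]_4, forall b u, ~~ eigenvalue A b -> hg 1 u ->
    nul f (s - 2) ((w - b *: L) * u) -> nul f (s - 1) u.
Proof.
move=> hw hx hy hz bs inj; pose e := tnth [tuple L; x; y; z].
have he k : hg 1 (e k) by case: k => [[|[|[|[|?]]]] ?]; rewrite /e (tnth_nth 0).
have span u : hg 1 u -> exists m : 'I_4 -> K, cong f (s - 1) u (\sum_k m k *: e k).
  move=> hu; have [m Hm] := bs.1 u hu.
  exists (tnth [tuple m.1.1.1; m.1.1.2; m.1.2; m.2]); apply: cong_trans Hm _; apply: cong_eq.
  by rewrite !big_ord_recl big_ord0 /e !(tnth_nth 0) /= addr0 !addrA.
have free (m : 'I_4 -> K) : nul f (s - 1) (\sum_k m k *: e k) -> forall k, m k = 0.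
  rewrite !big_ord_recl big_ord0 /e !(tnth_nth 0) /= addr0 !addrA => /(bs.2) [m0 m1 m2 m3].
  case=> [[|[|[|[|//]]]] k4]; [rewrite -[RHS]m0 | rewrite -[RHS]m1 | rewrite -[RHS]m2 | rewrite -[RHS]m3];
    by congr m; apply: val_inj.
have mulw k : exists m : 'I_4 -> K, cong f (s - 2) (w * e k) (L * \sum_l m l *: e l).
  have [|l hl Hl] := mult (u := w * e k); first by have := he k => ?; hom.
  have [m Hm] := span l hl; exists m; apply: cong_trans Hl _.
  by apply: (cong_mull Hm hL); lia.
have [A HA] := choice mulw; exists (\matrix_(k, l) A k l) => b u nb hu H.
have [v Hv] := span u hu.
suff v0 k0 : v k0 = 0.
  by move=> t ht; rewrite Hv // big1 ?mul0r ?(f0 lin) // => k _; rewrite v0 scale0r.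
pose v' := \row_k v k; set A' := \matrix_(k, l) A k l in nb.
have : nul f (s - 1) (\sum_l (\sum_k v k * A k l - b * v l) *: e l).
  apply: inj; first by apply: hg_sum => l _; apply: hgZ.
  have E : cong f (s - 2) ((w - b *: L) * u) (L * \sum_l (\sum_k v k * A k l - b * v l) *: e l).
    apply: (@cong_trans _ _ _ _ _ ((w - b *: L) * \sum_k v k *: e k)).
      by apply: (cong_mull (d := 1) Hv); [hom | lia].
    rewrite (_ : (w - b *: L) * _ =
      \sum_k v k *: (w * e k) - L * (b *: \sum_k v k *: e k)); last first.
      have -> : \sum_k v k *: (w * e k) = w * \sum_k v k *: e k.
        by rewrite mulr_sumr; apply: eq_bigr => k _; rewrite -!mul_mpolyC; ring.
      by rewrite -!mul_mpolyC; ring.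
    rewrite [X in cong _ _ _ X](_ : _ =
      \sum_k v k *: (L * \sum_l A k l *: e l) - L * (b *: \sum_k v k *: e k)).
      apply: (congB lin) => //; apply: (cong_sum lin) => k _; exact: (congZ lin).
    have -> : \sum_k v k *: (L * \sum_l A k l *: e l) = L * \sum_k v k *: \sum_l A k l *: e l.
      by rewrite mulr_sumr; apply: eq_bigr => k _; rewrite -!mul_mpolyC; ring.
    rewrite -mulrBr; congr (_ * _).
    under [X in _ = X - _]eq_bigr => i _ do rewrite scaler_sumr.
    rewrite exchange_big scaler_sumr -sumrB; apply: eq_bigr => l _.
    by rewrite scalerBl scaler_suml scalerA; congr (_ - _); apply: eq_bigr => i _; rewrite scalerA.
  by move=> t ht; rewrite -E // H.
move=> /free H0; apply/eqP; apply: contraNT nb => vk; apply/eigenvalueP; exists v'.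
  apply/rowP => l; rewrite !mxE; have /eqP := H0 l; rewrite subr_eq0 => /eqP <-.
  by apply: eq_bigr => j _; rewrite !mxE.
by apply: contraNneq vk => /rowP /(_ k0); rewrite !mxE => ->.
Qed.

End Quadric.

(** Q collects the values of p to be avoided: zero, the eigenvalues, and the roots of b p + c for
    each eigenvalue b, where - c / p equals b. *)
Lemma noneigenvalue_pair m (A : 'M[K]_m) (c : K) : c != 0 ->
  exists2 p, p != 0 & ~~ eigenvalue A p /\ ~~ eigenvalue A (- (c / p)).
Proof.
move=> c0; have [r Pr] := closed_field_poly_normal (char_poly A).
rewrite (monicP (char_poly_monic A)) scale1r in Pr.
have root b : eigenvalue A b -> b \in r.
  by rewrite eigenvalue_root_char Pr root_prod_XsubC.
pose Q : {poly K} := 'X * char_poly A * \prod_(b <- r) (b *: 'X + c%:P).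
have [|p Qp] := @poly_nonroot K Q.
  rewrite !mulf_neq0 ?polyX_eq0 ?(monic_neq0 (char_poly_monic A)) //.
  rewrite prodf_seq_neq0; apply/allP => b _ /=; apply/eqP => /(congr1 (fun q : {poly K} => q.[0])).
  by rewrite !(hornerD, hornerZ, hornerX, hornerC) mulr0 add0r => /eqP; rewrite (negPf c0).
move: Qp; rewrite !hornerM hornerX !mulf_eq0 !negb_or => /andP [/andP [p0 Ap] Rp].
exists p => //; split; first by rewrite eigenvalue_root_char.
apply: contra Rp => /root cr; rewrite horner_prod prodf_seq_eq0.
apply/hasP; exists (- (c / p)) => //=.
by rewrite !(hornerD, hornerZ, hornerX, hornerC) mulNr divfK // addNr.
Qed.

(** w is (w0 - p L) (w0 - q L) / L. Both factors act injectively on A_1, which makes the form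
    attached to w nondegenerate. Orthogonality to L amounts to p q = - c with c = f (L^(s-2) w0^2) /
    f (L^s), since w0 is orthogonal to L; c <> 0 leaves p free to avoid the spectrum. *)
Lemma four_variables_limit L x y z : hg 1 L -> hg 1 x -> hg 1 y -> hg 1 z ->
  basis4 L x y z -> f (L ^+ s) != 0 -> dep5 f 2 (s - 2) ->
  (forall M, hg 1 M -> nul f (s - 2) (L * M) -> nul f (s - 1) M) ->
  limit_power_sum s 4 (fun a => f 'X_[a]).
Proof.
move=> hL hx hy hz bs Ls dep inj.
have mult u : hg 2 u -> multiple s f L u.
  move=> hu; have [|c [k0 ck0] nc] := @dep (tnth [tuple L * L; L * x; L * y; L * z; u]).
    by case=> [[|[|[|[|[|?]]]]] ?] //=; rewrite (tnth_nth 0) /=; hom.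
  move: nc; rewrite !big_ord_recl big_ord0 !(tnth_nth 0) /= addr0.
  set c0 := c _; set c1 := c _; set c2 := c _; set c3 := c _; set c4 := c _ => nc.
  have [c40|c40] := eqVneq c4 0.
    have [|c00 c10 c20 c30] := bs.2 c0 c1 c2 c3.
      apply: inj; first by hom.
      by move: nc; congr (nul _ _ _); rewrite c40 -!mul_mpolyC mpolyC0; ring.
    case/eqP: ck0; case: k0 => [[|[|[|[|[|?]]]]] k0] //;
      [rewrite -[RHS]c00 | rewrite -[RHS]c10 | rewrite -[RHS]c20 | rewrite -[RHS]c30 | rewrite -[RHS]c40];
      by congr c; apply: val_inj.
  exists ((- c4^-1) *: (c0 *: L + c1 *: x + c2 *: y + c3 *: z)); first by hom.
  apply/(congP lin); rewrite (_ : u - _ = c4^-1 *: (c4 *: u) - L *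
    ((- c4^-1) *: (c0 *: L + c1 *: x + c2 *: y + c3 *: z))); last first.
    by rewrite scalerA mulVf // scale1r.
  move/(nulZ lin c4^-1): nc; congr (nul _ _ _); rewrite -!mul_mpolyC; ring.
pose x1 := x - (f (L ^+ (s - 1) * x) / f (L ^+ s)) *: L.
have Es : f (L ^+ (s - 1) * L) = f (L ^+ s).
  by rewrite mulrC -exprS (_ : (s - 1).+1 = s) //; lia.
have [w0 [hw0 Lw0] ww0] : exists2 w, hg 1 w /\ f (L ^+ (s - 1) * w) = 0 &
    f (L ^+ (s - 2) * w * w) != 0.
  apply: (nonorthogonal_kernel hL mult (x := x1)) => //; first by rewrite /x1; hom.
    move=> nx; set t := f _ / _ in @x1 nx.
    have [|_ /eqP] := bs.2 (- t) 1 0 0; last by rewrite oner_eq0.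
    by move: nx; congr (nul _ _ _); rewrite /x1 -!mul_mpolyC mpolyC0; ring.
  by rewrite /x1 mulrBr (fB lin) (fZr lin) Es divfK // subrr.
have [A HA] := spectrum_mul hL mult hw0 hx hy hz bs inj.
pose c := f (L ^+ (s - 2) * w0 * w0) / f (L ^+ s).
have [|p p0 [Ap Aq]] := noneigenvalue_pair A (c := c); first by rewrite mulf_neq0 ?invr_eq0.
pose q := - (c / p).
have [|w hw Hw] := mult ((w0 - p *: L) * (w0 - q *: L)); first by hom.
apply: (nondegenerate_limit hL mult hw _ _ hx hy hz bs).
  rewrite (_ : _ * L = L * w * L ^+ (s - 2)); last by ring.
  rewrite -Hw; last by hom.
  rewrite (_ : _ * _ = L ^+ (s - 2) * w0 * w0 - (p + q) *: (L ^+ (s - 1) * w0) +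
    (p * q) *: (L ^+ (s - 1) * L)); last first.
    by rewrite (_ : s - 1 = (s - 2).+1)%N ?exprS; [rewrite -!mul_mpolyC; ring | lia].
  rewrite (fD lin) (fB lin) !(fZ lin) Lw0 Es mulr0 subr0 /q mulrN [p * _]mulrC divfK //.
  by rewrite mulNr /c divfK // subrr.
move=> u hu H.
have [|u1 hu1 Hu1] := mult ((w0 - q *: L) * u); first by hom.
have [|u2 hu2 Hu2] := mult ((w0 - p *: L) * u1); first by hom.
have nulL v l : hg 1 l -> nul f (s - 1) l -> cong f (s - 2) v (L * l) -> nul f (s - 2) v.
  move=> hl nl vl t ht; rewrite vl // -mulrA mulrCA nl //; by hom.
apply: (HA q) => //; apply: (nulL _ u1) => //.
apply: (HA p) => //; apply: (nulL _ u2) => //.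
apply: (quadric_nondegenerate hL mult) => // v hv.
rewrite -(H v hv) (_ : _ * v = L * u2 * (L ^+ (s - 3) * v)); last first.
  by rewrite (_ : s - 2 = (s - 3).+1)%N ?exprS; [ring | lia].
rewrite -Hu2; last by hom.
rewrite (_ : _ * _ = L * u1 * ((w0 - p *: L) * (L ^+ (s - 4) * v))); last first.
  by rewrite (_ : s - 3 = (s - 4).+1)%N ?exprS; [ring | lia].
rewrite -Hu1; last by hom.
rewrite [X in f X](_ : _ = (w0 - p *: L) * (w0 - q *: L) * (u * (L ^+ (s - 4) * v))); last by ring.
rewrite Hw; last by hom.
by congr f; rewrite (_ : s - 3 = (s - 4).+1)%N ?exprS; [ring | lia].
Qed.

End FourVariables.

(** * Distinguishing the number of essential variables *)

Section Assembly.
Variables (K : numClosedFieldType) (n s : nat).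
Local Notation S := {mpoly K[n.+1]}.
Implicit Types (p q u v w x y z L M N : S).
Variable f : S -> K.
Hypothesis lin : functional f.

Lemma cong_of_nul j u v b : b != 0 -> nul f j (u + b *: v) -> cong f j v ((- b^-1) *: u).
Proof.
move=> b0 H; apply/(congP lin); rewrite (_ : _ - _ = b^-1 *: (u + b *: v)); first exact: nulZ.
by rewrite scalerDr scalerA mulVf // scale1r scaleNr opprK addrC.
Qed.

Theorem dep5_limit : (4 <= s)%N -> dep5 f s./2 (s - s./2) ->
  (exists2 p, hg s p & f p != 0) -> limit_power_sum s 4 (fun a => f 'X_[a]).
Proof.
move=> s4 dep nz; have s1 : (1 <= s)%N by lia.
have [L [hL Ls [span1|[deps inj]]]] := lefschetz_reduction lin s4 dep nz.
  exact: (one_variable_limit lin hL s1 span1).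
have L0 a : nul f (s - 1) (a *: L) -> a = 0.
  move=> /(_ (L ^+ (s - 1))); rewrite -scalerAl (fZ lin) -exprS (_ : (s - 1).+1 = s); last by lia.
  move=> H; apply/eqP; have /eqP := H ltac:(hom); by rewrite mulf_eq0 (negPf Ls) orbF.
have [span1|] := EM (forall M, hg 1 M -> exists c, nul f (s - 1) (M - c *: L)).
  exact: (one_variable_limit lin hL s1 span1).
move=> /existsNP [x /not_implyP [hx nx]].
have fr2 a b : nul f (s - 1) (a *: L + b *: x) -> a = 0 /\ b = 0.
  move=> H; have [b0|b0] := eqVneq b 0.
    by move: H; rewrite b0 scale0r addr0 => /L0.
  case: nx; exists (- b^-1 * a); apply/(congP lin); rewrite -scalerA; exact: cong_of_nul.
have [span2|] := EM (forall M, hg 1 M -> exists c : K * K, cong f (s - 1) M (c.1 *: L + c.2 *: x)).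
  exact: (two_variables_limit lin hL hx s4 (deps 4 s4) span2).
move=> /existsNP [y /not_implyP [hy ny]].
have fr3 : free3 s f L x y.
  move=> a b c H; have [c0|c0] := eqVneq c 0.
    by move: H; rewrite c0 scale0r addr0 => /fr2 [-> ->].
  case: ny; exists (- c^-1 * a, - c^-1 * b); rewrite -!scalerA -scalerDr; exact: cong_of_nul.
have [span3|] := EM (spanned3 s f L x y).
  by apply: (three_variables_limit lin s4 hL hx hy _ _ span3 fr3 inj); apply: deps; lia.
move=> /existsNP [z /not_implyP [hz nz3]].
have fr4 a b c d : nul f (s - 1) (a *: L + b *: x + c *: y + d *: z) ->
    [/\ a = 0, b = 0, c = 0 & d = 0].
  move=> H; have [d0|d0] := eqVneq d 0.
    by move: H; rewrite d0 scale0r addr0 => /fr3 [-> -> ->].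
  case: nz3; exists (- d^-1 * a, - d^-1 * b, - d^-1 * c); rewrite -!scalerA -!scalerDr.
  exact: cong_of_nul.
apply: (four_variables_limit lin s4 hL hx hy hz _ Ls _ inj); last by apply: deps; lia.
split=> // M hM.
have [|c [k0 ck0] nc] := deps 1%N s1 (tnth [tuple L; x; y; z; M]).
  by case=> [[|[|[|[|[|?]]]]] ?] //=; rewrite (tnth_nth 0).
move: nc; rewrite !big_ord_recl big_ord0 !(tnth_nth 0) /= addr0 !addrA.
set c0 := c _; set c1 := c _; set c2 := c _; set c3 := c _; set c4 := c _ => nc.
have [c40|c40] := eqVneq c4 0; last first.
  exists (- c4^-1 * c0, - c4^-1 * c1, - c4^-1 * c2, - c4^-1 * c3).
  by rewrite /= -!scalerA -!scalerDr; apply: cong_of_nul.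
have [|c00 c10 c20 c30] := fr4 c0 c1 c2 c3; first by move: nc; rewrite c40 scale0r addr0.
case/eqP: ck0; case: k0 => [[|[|[|[|[|?]]]]] k0] //;
  [rewrite -[RHS]c00 | rewrite -[RHS]c10 | rewrite -[RHS]c20 | rewrite -[RHS]c30 | rewrite -[RHS]c40];
  by congr c; apply: val_inj.
Qed.

End Assembly.

(** * Catalecticants and secant varieties *)

Local Open Scope classical_set_scope.

Section Apolarity.
Variables (K : numFieldType) (n s : nat).
Local Notation S := {mpoly K[n.+1]}.
Local Notation V := (dhomog n.+1 K s).
Implicit Types (F G : V) (p x z : S).

Definition apolar F p : K := (contraction p F)@_0.

Lemma apolar_functional F : functional (apolar F).
Proof. by move=> c p q; rewrite /apolar contraction_is_linear mcoeffD mcoeffZ. Qed.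

Lemma apolarX F a : apolar F 'X_[a] = F@_a.
Proof. by rewrite /apolar mcoeff_contraction msuppX big_seq1 mcoeffX eqxx mul1r add0m. Qed.

Lemma apolarE F p : apolar F p = \sum_(a <- msupp p) p@_a * F@_a.
Proof. by rewrite /apolar mcoeff_contraction; under eq_bigr do rewrite add0m. Qed.

Lemma apolar_sum (I : Type) (r : seq I) (c : I -> K) (G : I -> V) p :
  apolar (\sum_(i <- r) c i *: G i) p = \sum_(i <- r) c i * apolar (G i) p.
Proof.
rewrite apolarE; under [RHS]eq_bigr do rewrite apolarE mulr_sumr.
rewrite exchange_big; apply: eq_bigr => a _ /=.
rewrite [X in _ * X](_ : _ = \sum_(i <- r) c i * (G i)@_a).
  by rewrite mulr_sumr; apply: eq_bigr => i _; rewrite mulrCA.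
by elim/big_rec2: _ => [|i u v _ <-]; rewrite ?mcoeff0 // mcoeffD mcoeffZ.
Qed.

Lemma apolar_mulX F x m : apolar F (x * 'X_[m]) = (contraction x F)@_m.
Proof.
have lin := apolar_functional F.
rewrite mcoeff_contraction {1}[x]mpolyE mulr_suml (f_sum lin); apply: eq_bigr => b _.
by rewrite -scalerAl (fZ lin) -mpolyXD apolarX addmC.
Qed.

Lemma nul_contraction a F x : (a <= s)%N -> hg a x ->
  nul (apolar F) (s - a) x <-> contraction x F = 0.
Proof.
move=> as_ hx; have lin := apolar_functional F; split=> [H|H z hz].
  apply/mpolyP => m; rewrite mcoeff0; have [dm|dm] := eqVneq (mdeg m) (s - a)%N; last first.
    exact: (dhomog_nemf_coeff (contraction_homog hx (dhomog_is_dhomog F)) dm).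
  by rewrite -apolar_mulX H //; rewrite /hg dhomogX; apply/eqP.
rewrite [z]mpolyE mulr_sumr (f_sum lin) big1 // => m _.
by rewrite (fZr lin) apolar_mulX H mcoeff0 mulr0.
Qed.

Lemma catalecticant_comb a F k (c : 'I_k -> K) (x : 'I_k -> S) (hx : forall i, hg a (x i)) :
  (a <= s)%N -> \sum_i c i *: catalecticant a F (DHomog (hx i)) = 0 <->
    nul (apolar F) (s - a) (\sum_i c i *: x i).
Proof.
move=> as_; rewrite nul_contraction //; last by apply: hg_sum => i _; apply: hgZ.
have -> : \sum_i c i *: catalecticant a F (DHomog (hx i)) =
    catalecticant a F (\sum_i c i *: DHomog (hx i)).
  by rewrite linear_sum; apply: eq_bigr => i _; rewrite linearZ.
have E : \sum_i c i *: x i = \sum_i c i *: DHomog (hx i).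
  by rewrite raddf_sum; apply: eq_bigr => i _.
rewrite E -catalecticantE; split=> [-> //|H]; exact/val_inj.
Qed.

Lemma catalecticant_rankP a F : (a <= s)%N ->
  (catalecticant_rank a F <= 4)%N <-> dep5 (apolar F) a (s - a).
Proof.
move=> as_; have lin := apolar_functional F; split=> [r4 x hx|dep].
  pose X := [tuple catalecticant a F (DHomog (hx k)) | k < 5].
  have nf : ~~ free X.
    apply/negP => fr; move: r4; rewrite leqNgt => /negP; apply.
    rewrite -(size_tuple X) -(eqP fr); apply/dimvS/span_subvP => v /mapP [k _ ->].
    exact/memv_img/memvf.
  have [c c0 [k ck]] : exists2 c : 'I_5 -> K, \sum_k c k *: X`_k = 0 & exists k, c k != 0.
    apply: contrapT => H; case/negP: nf; apply/freeP => c Xc k.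
    by apply/eqP; apply: contrapT => ck; apply: H; exists c => //; exists k; apply/negP.
  exists c; first by exists k.
  apply/(catalecticant_comb F c hx as_); rewrite -[RHS]c0; apply: eq_bigr => i _.
  by rewrite -tnth_nth tnth_mktuple.
rewrite leqNgt; apply/negP => r5; pose B := vbasis (limg (catalecticant a F)).
have Bi (i : 'I_5) : exists y, catalecticant a F y = B`_i.
  have : B`_i \in limg (catalecticant a F).
    by apply/vbasis_mem/mem_nth; rewrite size_tuple; apply: leq_trans r5.
  by move=> /memv_imgP [y _ ->]; exists y.
have [y Hy] := choice Bi; have [|c [k ck] nc] := dep (fun i => val (y i)).
  by move=> i; apply: dhomog_is_dhomog.
have hy i : hg a (val (y i)) := dhomog_is_dhomog (y i).
have := (catalecticant_comb F c hy as_).2 nc.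
rewrite (eq_bigr (fun i => c i *: B`_i)) => [|i _]; last first.
  by rewrite -Hy; congr (_ *: catalecticant a F _); apply: val_inj.
have /freeP fr := basis_free (vbasisP (limg (catalecticant a F))).
pose d i := if insub i is Some i' then c i' else 0.
move=> H; case/eqP: ck; have := fr (fun i => d (val i)) _ (widen_ord r5 k).
rewrite /d /= valK; apply.
rewrite -[RHS]H; transitivity (\sum_(i < 5) d i *: B`_i).
  rewrite (big_ord_widen _ (fun i => d i *: B`_i) r5) [RHS]big_mkcond.
  by apply: eq_bigr => i _ /=; rewrite /d; case: insubP => [j ->//|/negPf ->]; rewrite scale0r.
by apply: eq_bigr => i _; rewrite /d valK.
Qed.

(* The 5x5 minors of the catalecticant matrix, and more generally its 5x5 minors
   along arbitrary vectors, as polynomial functions of F. *)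
Definition minor (x z : 'I_5 -> S) : {mpoly K[\dim {:V}]} :=
  \det (\matrix_(i, j) \sum_(k < \dim {:V}) apolar (vbasis {:V})`_k (x i * z j) *: 'X_k).

Lemma minor_homog (x z : 'I_5 -> S) : minor x z \is 5.-homog.
Proof.
have prod1 m (g : 'I_m -> {mpoly K[\dim {:V}]}) : (forall i, g i \is 1.-homog) ->
    \prod_i g i \is m.-homog.
  elim: m g => [|m IH] g hg; first by rewrite big_ord0 dhomog1.
  by rewrite big_ord_recl; apply: (dhomogM (d := 1)) => //; apply: IH.
apply: rpred_sum => g _; rewrite rpredMsign; apply: prod1 => i; rewrite mxE.
by apply: rpred_sum => k _; apply: rpredZ; rewrite dhomogX /= mdeg1.
Qed.

Lemma coord_eval_minor (x z : 'I_5 -> S) F :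
  coord_eval (minor x z) F = \det (\matrix_(i, j) apolar F (x i * z j)).
Proof.
rewrite /coord_eval /minor -det_map_mx; congr (\det _); apply/matrixP => i j; rewrite !mxE.
rewrite raddf_sum {2}[F](coord_vbasis (memvf F)) apolar_sum; apply: eq_bigr => k _ /=.
by rewrite mevalZ mevalXU mulrC.
Qed.

(** Five independent classes have a dual family, and the corresponding minor is the determinant of
    the identity. *)
Lemma dep5_minor a F : dep5 (apolar F) a (s - a) <->
  forall x z : 'I_5 -> S, (forall i, hg a (x i)) -> (forall i, hg (s - a) (z i)) ->
    coord_eval (minor x z) F = 0.
Proof.
have lin := apolar_functional F; split=> [dep x z hx hz|H x hx].
  rewrite coord_eval_minor; apply/eqP/det0P; have [c [k ck] nc] := dep x hx.
  exists (\row_i c i); first by apply: contraNneq ck => /rowP /(_ k); rewrite !mxE => ->.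
  apply/rowP => j; rewrite !mxE -[RHS](nc _ (hz j)) mulr_suml (f_sum lin).
  by apply: eq_bigr => i _; rewrite !mxE -scalerAl (fZ lin).
have [[z hz E]|//] := dual_or_dependent lin (s - a) x.
have := H x z hx hz; rewrite coord_eval_minor (_ : \matrix_(i, j) _ = 1%:M).
  by move=> /eqP; rewrite det1 oner_eq0.
by apply/matrixP => i j; rewrite !mxE E.
Qed.

End Apolarity.

(** * The secant variety and the rank condition *)

Section SecantVariety.
Variables (K : numClosedFieldType) (n s : nat).
Local Notation S := {mpoly K[n.+1]}.
Local Notation V := (dhomog n.+1 K s).
Implicit Types (F G : V) (p : S).

Lemma apolarZ c F p : apolar (c *: F) p = c * apolar F p.
Proof.
have := apolar_sum [:: tt] (fun=> c) (fun=> F) p; by rewrite !big_seq1.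
Qed.

Lemma dep5Z a c F : dep5 (apolar F) a (s - a) -> dep5 (apolar (c *: F)) a (s - a).
Proof.
move=> dep x hx; have [e e0 ne] := dep x hx; exists e => // z hz.
by rewrite apolarZ ne // mulr0.
Qed.

Lemma apolar_power_sum k (c : 'I_k -> K) l p : hg s p ->
  apolar (form s (power_sum c l)) p = \sum_i c i * p.@[l i].
Proof.
move=> hp; rewrite apolarE; under [RHS]eq_bigr do rewrite mevalE mulr_sumr.
rewrite exchange_big; apply: eq_big_seq => a ap /=.
rewrite mcoeff_form; last by move/dhomogP: hp; apply.
by rewrite /power_sum mulr_sumr; apply: eq_bigr => i _; rewrite mulrCA.
Qed.

(** For a sum of four powers the functional is a combination of evaluations at four points, and five
    vectors of values in K^4 are dependent. *)
Lemma dep5_power_sum a (c : 'I_4 -> K) (l : 'I_4 -> 'I_n.+1 -> K) : (a <= s)%N ->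
  dep5 (apolar (form s (power_sum c l))) a (s - a).
Proof.
move=> as_ x hx; pose A := \matrix_(k < 5, i < 4) (x k).@[l i].
have : kermx A != 0 by rewrite kermx_eq0 /row_free neq_ltn ltnS rank_leq_col.
case/rowV0Pn => v /sub_kermxP vA v0; exists (fun k => v 0 k).
  apply: contrapT => H; case/eqP: v0; apply/rowP => k; rewrite mxE; apply/eqP.
  by apply: contraPT H => ? H; apply: H; exists k.
move=> z hz; rewrite apolar_power_sum; last first.
  by apply: (hgM (d := a) (e := s - a)) => //; [apply: hg_sum => k _; apply: hgZ | lia].
rewrite big1 // => i _; rewrite mevalM raddf_sum (_ : \sum_k _ = 0) ?mul0r ?mulr0 //=.
have := congr1 (fun B : 'rV_4 => B 0 i) vA; rewrite !mxE => E; rewrite -[RHS]E.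
by apply: eq_bigr => k _; rewrite !mxE mevalZ.
Qed.

Lemma coord_eval0_of_dep5 F (P : {mpoly K[\dim {:V}]}) : (4 <= s)%N ->
  dep5 (apolar F) s./2 (s - s./2) ->
  (forall c l, coord_eval P (form s (@power_sum K n 4 c l)) = 0) -> coord_eval P F = 0.
Proof.
move=> s4 dep HP; have lin := apolar_functional F; rewrite -(form_mcoeff F).
have [->|F0] := eqVneq F 0.
  rewrite -[RHS](HP (fun=> 0) (fun _ _ => 0)); congr coord_eval; apply: eq_form => a _.
  by rewrite mcoeff0 /power_sum big1 // => i _; rewrite mul0r.
have H : limit_power_sum s 4 (fun a => F@_a).
  apply: (eq_limit (g1 := fun a => apolar F 'X_[a])) => [a _|]; first exact: apolarX.
  apply: dep5_limit => //; apply: contrapT => H; case/eqP: F0; apply/val_inj/mpolyP => a.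
  rewrite mcoeff0; have [da|da] := eqVneq (mdeg a) s; last first.
    exact: (dhomog_nemf_coeff (dhomog_is_dhomog F) da).
  apply/eqP; apply: contrapT => /negP nz; apply: H; exists 'X_[a]; last by rewrite apolarX.
  by rewrite /hg dhomogX; apply/eqP.
exact: H.
Qed.

Lemma linear_form_key (l : 'I_n.+1 -> K) : \sum_j l j *: 'X_j \is 1.-homog.
Proof. by apply: hg_sum => j _; apply/hgZ/hgX. Qed.

Definition linear_form l : dhomog n.+1 K 1 := DHomog (linear_form_key l).

Lemma mcoeff_linear_form l j : (linear_form l)@_U_(j) = l j.
Proof.
rewrite raddf_sum (bigD1 j) //= mcoeffZ mcoeffX eqxx mulr1 big1 ?addr0 // => i ij.
by rewrite mcoeffZ mcoeffX eq_mnm1 (negPf ij) mulr0.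
Qed.

Lemma form_power_sum k (c : 'I_k -> K) (u : 'I_k -> dhomog n.+1 K 1) :
  form s (power_sum c (fun i j => (u i)@_U_(j))) = \sum_i c i *: divided_power s (u i).
Proof.
apply/val_inj/mpolyP => a; have [da|da] := eqVneq (mdeg a) s; last first.
  by rewrite !(dhomog_nemf_coeff (dhomog_is_dhomog _) da).
rewrite [LHS](mcoeff_form _ da) raddf_sum raddf_sum; apply: eq_bigr => i _ /=.
by rewrite mcoeffZ [_@_a](mcoeff_divided_power _ da).
Qed.

Lemma secant_union_sub a : (a <= s)%N -> forall p : pspace V,
  secant_union 4 (range (@veronese K n s)) p ->
  forall v, v \in pline p -> dep5 (apolar v) a (s - a).
Proof.
move=> as_ p [t Ht sub] v /(subvP sub); rewrite big_tuple => /memv_sumP [w Hw ->].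
have /choice [u Hu] i : exists u, exists c, w i = c *: divided_power s u.
  have [q _ qE] := Ht _ (mem_tnth i t); have := Hw i isT; rewrite -qE => /vlineP [c wE].
  by exists (vpick q), c.
have [c Hc] := choice Hu; rewrite (eq_bigr _ (fun i _ => Hc i)) -form_power_sum.
exact: dep5_power_sum.
Qed.

(** A zero linear form defines no point and is replaced by the default point of [x0], as its power
    is zero when 1 <= s. If the whole sum is zero, any point of the secant union serves. *)
Lemma power_sum_secant (X : set (pspace V)) (c : 'I_4 -> K) (l : 'I_4 -> 'I_n.+1 -> K) :
  (1 <= s)%N ->
  secant_union 4 (range (@veronese K n s)) `<=` X ->
  exists2 p, X p & form s (power_sum c l) \in pline p.
Proof.
move=> s1 sub; have x0 : linear_form (fun=> 1) != 0.
  by apply/eqP => /(congr1 (fun u : dhomog n.+1 K 1 => u@_U_(ord0)))/eqP;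
     rewrite mcoeff_linear_form mcoeff0 oner_eq0.
pose q i := if insub (linear_form (l i)) is Some u
  then veronese s (ppoint (valP (u : {u | u != 0}))) else veronese s (ppoint x0).
have Hq i : range (@veronese K n s) (q i).
  by rewrite /q; case: insub => [u|]; [exists (ppoint (valP u)) | exists (ppoint x0)].
have mem : form s (power_sum c l) \in (\sum_(i < 4) pline (q i))%VS.
  have -> : form s (power_sum c l) = \sum_i c i *: divided_power s (linear_form (l i)).
    rewrite -form_power_sum; apply: eq_form => a _; apply: eq_bigr => i _; congr (_ * _).
    by apply: eq_bigr => j _; rewrite mcoeff_linear_form.
  apply: memv_sumr => i _; apply: memvZ; rewrite /q; case: insubP => [u _ <-|].
    by rewrite veronese_ppoint /= memv_line.
  rewrite negbK => /eqP ->; suff -> : divided_power s (0 : dhomog n.+1 K 1) = 0 by rewrite mem0v.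
  by rewrite -(scale0r (0 : dhomog n.+1 K 1)) divided_powerZ expr0n eqn0Ngt s1 scale0r.
have [G0|G0] := eqVneq (form s (power_sum c l)) 0.
  exists (q ord0); last by rewrite G0 mem0v.
  apply: sub; exists [tuple q ord0 | i < 4].
    by move=> p /mapP [i _ ->].
  by rewrite big_tuple (bigD1 ord0) //= tnth_mktuple addvSl.
exists (ppoint G0); last by rewrite /= memv_line.
apply: sub; exists [tuple q i | i < 4]; first by move=> p /mapP [i _ ->].
by rewrite big_tuple -memvE; under eq_bigr do rewrite tnth_mktuple.
Qed.

(** Z is cut out by the minors and contains the spans, hence the closure. Conversely, the equations
    of a closed set containing the spans vanish on all sums of four powers, and therefore on their
    limits, which exhaust Z. *)
Theorem secant4_catalecticant : (4 <= s)%N ->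
  secant_variety 4 (range (@veronese K n s)) =
  [set p : pspace V | exists (F : V) (F0 : F != 0),
     p = ppoint F0 /\ (catalecticant_rank s./2 F <= 4)%N].
Proof.
move=> s4; set Z := [set p | _]; have as_ : (s./2 <= s)%N by lia.
have ZP (p : pspace V) : Z p <-> forall v, v \in pline p -> dep5 (apolar v) s./2 (s - s./2).
  split=> [[F [F0 [-> /catalecticant_rankP dep]]] v /vlineP [c ->]|H].
    by apply/dep5Z/dep.
  exists (vpick (pline p)), (vpick_pline_neq0 p); split; first by rewrite ppoint_vpick.
  exact/catalecticant_rankP/H/memv_pick.
rewrite eqEsubset; split=> [|p].
  apply: smallest_sub => [|p /secant_union_sub H]; last by apply/ZP => v pv; apply: H pv.
  exists [set P | exists x z : 'I_5 -> S, [/\ forall i, hg s./2 (x i),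
      forall i, hg (s - s./2) (z i) & P = minor s x z]].
    by move=> P [x [z [_ _ ->]]]; exists 5%N; apply: minor_homog.
  apply/seteqP; split=> p.
    move=> /ZP H P [x [z [hx hz ->]]] v /H /dep5_minor; exact.
  move=> H; apply/ZP => v pv; apply/dep5_minor => x z hx hz.
  by apply: H pv; exists x, z.
move=> /ZP H X [[I Ih XE] sub]; rewrite XE => P IP v pv.
apply: coord_eval0_of_dep5 => // [|c l]; first exact: H.
have [q] := power_sum_secant c l (ltnW (ltnW (ltnW s4))) sub.
by rewrite XE => /(_ P IP); apply.
Qed.

End SecantVariety.

Local Open Scope complex_scope.

Theorem corollary4p11 (R : realType) (s n : nat) (hs : (4 <= s)%N)
    (hn : (1 <= n)%N) :
  secant_variety 4 (range (@veronese R[i] n s)) =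
  [set p : pspace (dhomog n.+1 R[i] s) |
    exists (F : dhomog n.+1 R[i] s) (F0 : F != 0),
      p = ppoint F0 /\ (catalecticant_rank s./2 F <= 4)%N].
Proof. exact: secant4_catalecticant. Qed.
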